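(* Let $f$ be a transcendental meromorphic function with a finite number of poles and suppose that there are positive constants $c$, $d$ and $r_0$ such that $d>1$ and $$\text{for all } r\ge r_0\ \text{there exists } \rho\in(r,dr)\ \text{such that } m(\rho,f)\le c.$$ If $(a_n)$ is a positive sequence such that $a_n\to\infty$ as $n\to\infty$ and $a_{n+1}=O(M(a_n,f))$ as $n\to\infty$, then there exist $\zeta\in J(f)$ and $C>1$ such that $$a_n\le|f^n(\zeta)|\le Ca_n,\quad\text{for all } n\in\mathbb{N}.$$
   Context: A transcendental meromorphic function is a non-rational meromorphic function $f:\mathbb{C}\to\hat{\mathbb{C}}=\mathbb{C}\cup\{\infty\}$ (transcendental entire functions are included; the finite number of poles may be zero). $\mathbb{N}=\{1,2,\dots\}$ and $f^n$ denotes the $n$th iterate of $f$. For $r>0$, $M(r,f)=\max_{|z|=r}|f(z)|$ and $m(r,f)=\min_{|z|=r}|f(z)|$. The Fatou set $F(f)$ is the set of $z\in\mathbb{C}$ such that $(f^n)_{n\in\mathbb{N}}$ is well-defined and forms a normal family in some neighbourhood of $z$. The Julia set $J(f)$ is the complement of $F(f)$ in $\mathbb{C}$. *)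

(* Defs.v *)
From Stdlib Require Import Reals.
From Coquelicot Require Import Coquelicot.

Open Scope R_scope.

(** The Riemann sphere, as a bare set: convergence is measured by [chordal]. *)
Inductive Chat : Type :=
  | Fin (z : C)
  | Inf.

(** The value [0] at [Inf] is a dummy. *)
Definition fin_part (w : Chat) : C :=
  match w with Fin z => z | Inf => RtoC 0 end.

Definition modulus (w : Chat) : Rbar :=
  match w with Fin z => Finite (Cmod z) | Inf => p_infty end.

Definition chordal (u v : Chat) : R :=
  match u, v with
  | Fin z, Fin w =>
      2 * Cmod (z - w)%C / (sqrt (1 + Cmod z ^ 2) * sqrt (1 + Cmod w ^ 2))
  | Fin z, Inf | Inf, Fin z => 2 / sqrt (1 + Cmod z ^ 2)
  | Inf, Inf => 0
  end.

Definition disc (z : C) (r : R) : C -> Prop :=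
  fun w => Cmod (w - z)%C < r.

Definition complex_differentiable (g : C -> C) (z : C) : Prop :=
  @ex_derive C_AbsRing C_NormedModule g z.

(** [z] is a point of holomorphy or a pole of [f]; the constant [Inf] is
    excluded. *)
Definition meromorphic_at (f : C -> Chat) (z : C) : Prop :=
  locally' z (fun w =>
    f w <> Inf /\ complex_differentiable (fun v => fin_part (f v)) w) /\
  match f z with
  | Fin _ => complex_differentiable (fun v => fin_part (f v)) z
  | Inf => filterlim (fun w => Cmod (fin_part (f w)))
             (locally' z) (Rbar_locally p_infty)
  end.

Definition meromorphic (f : C -> Chat) : Prop :=
  forall z : C, meromorphic_at f z.

Definition Cpoly (n : nat) (a : nat -> C) (z : C) : C :=
  sum_n (fun k => (a k * Cpow z k)%C) n.

(** [f = p / q] off the zeros of [q]; for a meromorphic [f] this determines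
    its values at the remaining, finitely many, points. *)
Definition rational (f : C -> Chat) : Prop :=
  exists (n m : nat) (p q : nat -> C),
    (exists z : C, Cpoly m q z <> RtoC 0) /\
    (forall z : C, Cpoly m q z <> RtoC 0 ->
       f z = Fin (Cpoly n p z / Cpoly m q z)%C).

Definition transcendental_meromorphic (f : C -> Chat) : Prop :=
  meromorphic f /\ ~ rational f.

Definition finitely_many_poles (f : C -> Chat) : Prop :=
  exists l : list C, forall z : C, f z = Inf -> List.In z l.

(** [None] means that the iterate is undefined at [z]: some earlier iterate
    takes the value [Inf], where [f] is not defined.  [Some Inf] means that
    the iterate is defined and has a pole at [z]. *)
Fixpoint iterate (f : C -> Chat) (n : nat) (z : C) : option Chat :=
  match n with
  | O => Some (Fin z)
  | S k =>
      match iterate f k z with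
      | Some (Fin w) => Some (f w)
      | _ => None
      end
  end.

Definition locally_uniform_cvg (U : C -> Prop) (g : nat -> C -> Chat)
    (h : C -> Chat) : Prop :=
  forall z : C, U z ->
    exists r : R, 0 < r /\
      forall eps : R, 0 < eps ->
        exists N : nat, forall n : nat, (N <= n)%nat ->
          forall w : C, U w -> disc z r w -> chordal (g n w) (h w) < eps.

(** Only the values on [U] of the members of the family matter. *)
Definition normal_on (U : C -> Prop) (family : (C -> Chat) -> Prop) : Prop :=
  forall u : nat -> C -> Chat, (forall j, family (u j)) ->
    exists (phi : nat -> nat) (h : C -> Chat),
      (forall i j : nat, (i < j)%nat -> (phi i < phi j)%nat) /\
      locally_uniform_cvg U (fun j => u (phi j)) h.

Definition Fatou (f : C -> Chat) (z : C) : Prop :=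
  exists r : R, 0 < r /\
    (forall (n : nat) (w : C), (1 <= n)%nat -> disc z r w ->
       iterate f n w <> None) /\
    normal_on (disc z r)
      (fun g => exists n : nat, (1 <= n)%nat /\
         forall w : C, disc z r w -> iterate f n w = Some (g w)).

Definition Julia (f : C -> Chat) (z : C) : Prop := ~ Fatou f z.

(** For [0 <= r] and [f] meromorphic the bounds below are attained, since
    [|f|] is continuous from the circle [|z| = r] to [[0, +oo]]; the value
    [p_infty] accounts for poles on the circle. *)
Definition max_modulus (r : R) (f : C -> Chat) : Rbar :=
  Rbar_lub (fun x => exists z : C, Cmod z = r /\ x = modulus (f z)).

Definition min_modulus (r : R) (f : C -> Chat) : Rbar :=
  Rbar_glb (fun x => exists z : C, Cmod z = r /\ x = modulus (f z)).

(* Main.v *)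
Require Import Defs.
From Stdlib Require Import Reals Lra Lia Psatz List Classical ClassicalEpsilon.
From Coquelicot Require Import Coquelicot.
Open Scope R_scope.

(** Write [g] for the finite part of [f]; far from the
    origin [g] is holomorphic and equals [f].  Around the circle of radius [a n] take
    [k] consecutive annuli whose radii grow by the factor [H = 6 d].

    Each of these annuli contains a circle on which [g] has a value of modulus at most [c + 1],
    by the hypothesis on the minimum modulus, and also a value much larger than [a (n + 1)]:
    the maximum modulus of a transcendental function gains any prescribed factor when a
    large radius is doubled ([transcendental_growth]), and [a (n + 1)] is at most
    a constant times the maximum modulus on the circle of radius [a n].  Such a function cannot
    omit [k] values, one chosen in each annulus of level [n + 1]
    ([omitted_values_on_circle]).  Hence, given one target per annulus of level [n + 1], every
    annulus of level [n] contains a preimage of some target ([preimages_in_annuli]).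
    This statement reproduces itself: the preimages are [k] points, one per annulus, and
    serve as targets for level [n - 1].  A single target would not do, since it could be
    a Picard exceptional value.

    Start the backward construction at level [n] with points where [|g|] is at most [c + 1].  It
    ends with a point [y n] whose orbit stays comparable to [a j] for [j <= n] and
    returns to the disc of radius [c + 1] at time [n + 1] ([escaping_then_returning]).
    A cluster point [zeta] of the sequence [y] inherits the bounds at all times.  It lies in
    the Julia set: its orbit tends to infinity, while the orbits of points arbitrarily
    close to it return, so that a limit of iterates could not be continuous at [zeta]
    ([Julia_criterion]).  The finitely many [a n] that are too small for the estimates are
    first enlarged ([enlarge_initial_terms]), at the cost of the constant.

    The omitted values are handled by the method of Ahlfors.  With six values [w_j] and
    [x_j = |g - w_j|], the metric whose conformal factor has fourth power
    [prod_j (1 + x_j) / x_j ^ 2] has curvature bounded above by a negative constant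
    ([density_le_curv]).  At a maximum of its ratio to the metric of a disc the Laplacian of the
    logarithm is nonpositive, which bounds [|g'|] at the scale of the six values
    ([Ahlfors_estimate], [Landau_bound]).  Six omitted values in each of [m] consecutive ranges
    of size bound [|g'| / |g|] through all these ranges, hence the variation of [ln |g|]
    on the circle; but this variation grows with [m], which is at our disposal.

    Since differentiability is given pointwise, the theory of holomorphic functions starts
    from Goursat's theorem, proved by bisection ([goursat]).  It yields primitives, Cauchy's
    formula on circles, holomorphy of derivatives ([hol_derivative]) and removable
    singularities; the maximum modulus principle ([max_modulus_principle]) comes
    from the second derivative test for the Laplacian.  Removable singularities allow
    to clear the poles of [f], which reduces growth to entire functions. *)

(** * Continuity and complex derivatives *)

Ltac use_min d1 d2 :=
  exists (Rmin d1 d2); pose proof (Rmin_l d1 d2); pose proof (Rmin_r d1 d2);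
  split; [apply Rmin_pos; first [assumption | lra]|].

Definition ccont (f : C -> C) (z : C) : Prop :=
  forall eps, 0 < eps -> exists del, 0 < del /\
    forall w, Cmod (w - z) < del -> Cmod (f w - f z) < eps.

Definition cder (f : C -> C) (z l : C) : Prop :=
  forall eps, 0 < eps -> exists del, 0 < del /\
    forall w, Cmod (w - z) < del ->
      Cmod (f w - f z - l * (w - z)) <= eps * Cmod (w - z).

(** Holomorphy at a point is differentiability at that point alone; regularity
    comes only from differentiability on a disc, see [hol_derivative]. *)
Definition hol (f : C -> C) (z : C) : Prop := exists l, cder f z l.

Lemma Cmod_sub_sym (z w : C) : Cmod (z - w) = Cmod (w - z).
Proof. rewrite <- Cmod_opp. f_equal. ring. Qed.

Lemma Cmod_sub_triangle (a b c : C) :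
  Cmod (a - c) <= Cmod (a - b) + Cmod (b - c).
Proof. replace (a - c)%C with ((a - b) + (b - c))%C by ring. apply Cmod_triangle. Qed.

Lemma Cmod_triangle_sub (a b : C) : Cmod (a - b) <= Cmod a + Cmod b.
Proof.
  unfold Cminus. eapply Rle_trans; [apply Cmod_triangle|]. rewrite Cmod_opp. lra.
Qed.

Lemma Cmod_le_add (a b : C) : Cmod a <= Cmod (a - b) + Cmod b.
Proof. replace a with ((a - b) + b)%C at 1 by ring. apply Cmod_triangle. Qed.

Lemma Cmod_sub_self (z : C) : Cmod (z - z) = 0.
Proof. replace (z - z)%C with (RtoC 0) by ring. apply Cmod_0. Qed.

Lemma Cmod_sub_pos (z w : C) : z <> w -> 0 < Cmod (z - w).
Proof.
  intros H. apply Cmod_gt_0. intros E. apply H.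
  replace z with ((z - w) + w)%C by ring. rewrite E. ring.
Qed.

Lemma Re_le_Cmod (z : C) : Rabs (fst z) <= Cmod z.
Proof. eapply Rle_trans; [|apply Rmax_Cmod]. apply Rmax_l. Qed.

Lemma Im_le_Cmod (z : C) : Rabs (snd z) <= Cmod z.
Proof. eapply Rle_trans; [|apply Rmax_Cmod]. apply Rmax_r. Qed.

Lemma Cmod_le_Re_Im (z : C) : Cmod z <= Rabs (fst z) + Rabs (snd z).
Proof.
  replace z with (RtoC (fst z) + Ci * RtoC (snd z))%C at 1.
  - eapply Rle_trans; [apply Cmod_triangle|].
    rewrite Cmod_mult, !Cmod_R, Cmod_Ci. lra.
  - destruct z as [x y]; apply injective_projections; simpl; ring.
Qed.

Lemma Cmod_sqr (z : C) : Cmod z ^ 2 = fst z ^ 2 + snd z ^ 2.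
Proof. exact (Cmod2_alt z). Qed.

Lemma ccont_const (k z : C) : ccont (fun _ => k) z.
Proof. intros e He. exists 1. split; [lra|]. intros. rewrite Cmod_sub_self. lra. Qed.

Lemma ccont_id (z : C) : ccont (fun w => w) z.
Proof. intros e He. exists e. auto. Qed.

Lemma ccont_plus (f g : C -> C) (z : C) :
  ccont f z -> ccont g z -> ccont (fun w => f w + g w)%C z.
Proof.
  intros Hf Hg e He.
  destruct (Hf (e/2)) as [d1 [Hd1 H1]]; [lra|].
  destruct (Hg (e/2)) as [d2 [Hd2 H2]]; [lra|].
  use_min d1 d2. intros w Hw.
  replace (f w + g w - (f z + g z))%C with ((f w - f z) + (g w - g z))%C by ring.
  eapply Rle_lt_trans; [apply Cmod_triangle|].
  specialize (H1 w ltac:(lra)). specialize (H2 w ltac:(lra)). lra.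
Qed.

Lemma ccont_ext_loc (f g : C -> C) (z : C) (r : R) : 0 < r ->
  (forall w, Cmod (w - z) < r -> f w = g w) -> ccont f z -> ccont g z.
Proof.
  intros Hr He Hf e Hep. destruct (Hf e Hep) as [d [Hd H]].
  use_min d r. intros w Hw.
  rewrite <- !He; [apply H; lra|rewrite Cmod_sub_self; lra|lra].
Qed.

Lemma ccont_bounded (f : C -> C) (z : C) : ccont f z ->
  exists del, 0 < del /\ forall w, Cmod (w - z) < del -> Cmod (f w) < Cmod (f z) + 1.
Proof.
  intros Hf. destruct (Hf 1 ltac:(lra)) as [d [Hd H]]. exists d. split; auto.
  intros w Hw. specialize (H w Hw). pose proof (Cmod_le_add (f w) (f z)). lra.
Qed.

Lemma ccont_mult (f g : C -> C) (z : C) :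
  ccont f z -> ccont g z -> ccont (fun w => f w * g w)%C z.
Proof.
  intros Hf Hg e He.
  destruct (ccont_bounded f z Hf) as [d0 [Hd0 H0]].
  pose proof (Cmod_ge_0 (f z)) as Pf. pose proof (Cmod_ge_0 (g z)) as Pg.
  destruct (Hf (e/2/(Cmod (g z) + 1))) as [d1 [Hd1 H1]].
  { apply Rdiv_lt_0_compat; lra. }
  destruct (Hg (e/2/(Cmod (f z) + 1))) as [d2 [Hd2 H2]].
  { apply Rdiv_lt_0_compat; lra. }
  exists (Rmin d0 (Rmin d1 d2)). split; [repeat apply Rmin_pos; auto|]. intros w Hw.
  pose proof (Rmin_l d0 (Rmin d1 d2)). pose proof (Rmin_r d0 (Rmin d1 d2)).
  pose proof (Rmin_l d1 d2). pose proof (Rmin_r d1 d2).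
  replace (f w * g w - f z * g z)%C
    with (f w * (g w - g z) + (f w - f z) * g z)%C by ring.
  eapply Rle_lt_trans; [apply Cmod_triangle|]. rewrite !Cmod_mult.
  specialize (H0 w ltac:(lra)). specialize (H1 w ltac:(lra)). specialize (H2 w ltac:(lra)).
  pose proof (Cmod_ge_0 (f w)).
  pose proof (Cmod_ge_0 (g w - g z)%C). pose proof (Cmod_ge_0 (f w - f z)%C).
  apply (Rmult_lt_compat_r (Cmod (f z) + 1)) in H2; [|lra].
  apply (Rmult_lt_compat_r (Cmod (g z) + 1)) in H1; [|lra].
  replace (e / 2 / (Cmod (f z) + 1) * (Cmod (f z) + 1)) with (e/2) in H2 by (field; lra).
  replace (e / 2 / (Cmod (g z) + 1) * (Cmod (g z) + 1)) with (e/2) in H1 by (field; lra).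
  nra.
Qed.

Lemma ccont_comp (f g : C -> C) (z : C) :
  ccont g z -> ccont f (g z) -> ccont (fun w => f (g w)) z.
Proof.
  intros Hg Hf e He. destruct (Hf e He) as [d [Hd H]].
  destruct (Hg d Hd) as [d' [Hd' H']]. exists d'. split; auto.
Qed.

Lemma ccont_opp (f : C -> C) (z : C) : ccont f z -> ccont (fun w => - f w)%C z.
Proof.
  intros Hf. apply (ccont_ext_loc (fun w => (RtoC (-1)) * f w)%C _ z 1); [lra| |].
  - intros w _. change (RtoC (-1)) with (RtoC (Ropp 1)). rewrite RtoC_opp. ring.
  - apply ccont_mult; auto. apply ccont_const.
Qed.

Lemma ccont_minus (f g : C -> C) (z : C) :
  ccont f z -> ccont g z -> ccont (fun w => f w - g w)%C z.
Proof. intros Hf Hg. apply (ccont_plus f (fun w => - g w)%C); auto. apply ccont_opp; auto. Qed.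

Lemma ccont_away (f : C -> C) (z : C) : ccont f z -> f z <> 0%C ->
  exists del, 0 < del /\ forall w, Cmod (w - z) < del -> Cmod (f z) / 2 < Cmod (f w).
Proof.
  intros Hf Hz. apply Cmod_gt_0 in Hz.
  destruct (Hf (Cmod (f z) / 2)) as [d [Hd H]]; [lra|].
  exists d. split; auto. intros w Hw. specialize (H w Hw).
  pose proof (Cmod_le_add (f z) (f w)). rewrite (Cmod_sub_sym (f w)) in H. lra.
Qed.

Lemma ccont_inv (f : C -> C) (z : C) :
  ccont f z -> f z <> 0%C -> ccont (fun w => / f w)%C z.
Proof.
  intros Hf Hz e He.
  destruct (ccont_away f z Hf Hz) as [d1 [Hd1 H1]].
  assert (Hm := proj1 (Cmod_gt_0 _) Hz).
  destruct (Hf (e * (Cmod (f z) * Cmod (f z) / 2))) as [d2 [Hd2 H2]].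
  { apply Rmult_lt_0_compat; auto. apply Rdiv_lt_0_compat; nra. }
  use_min d1 d2. intros w Hw.
  specialize (H1 w ltac:(lra)). specialize (H2 w ltac:(lra)).
  assert (Hw0 : f w <> 0%C) by (apply Cmod_gt_0; lra).
  replace (/ f w - / f z)%C with ((f z - f w) / (f w * f z))%C by (field; auto).
  rewrite Cmod_div, Cmod_mult by (apply Cmult_neq_0; auto).
  rewrite (Cmod_sub_sym (f z)).
  apply (Rmult_lt_reg_r (Cmod (f w) * Cmod (f z))); [nra|].
  unfold Rdiv. rewrite Rmult_assoc, Rinv_l by nra.
  rewrite Rmult_1_r. eapply Rlt_le_trans; [apply H2|].
  apply Rmult_le_compat_l; nra.
Qed.

Lemma cder_ccont (f : C -> C) (z l : C) : cder f z l -> ccont f z.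
Proof.
  intros H e He. destruct (H 1 ltac:(lra)) as [d [Hd H1]].
  pose proof (Cmod_ge_0 l) as Pl.
  assert (Q : 0 < e / (Cmod l + 1 + 1)) by (apply Rdiv_lt_0_compat; lra).
  exists (Rmin d (e / (Cmod l + 1 + 1))). split; [apply Rmin_pos; auto|].
  intros w Hw.
  pose proof (Rmin_l d (e / (Cmod l + 1 + 1))). pose proof (Rmin_r d (e / (Cmod l + 1 + 1))).
  specialize (H1 w ltac:(lra)).
  replace (f w - f z)%C with ((f w - f z - l * (w - z)) + l * (w - z))%C by ring.
  eapply Rle_lt_trans; [apply Cmod_triangle|]. rewrite Cmod_mult.
  assert (B : Cmod (w - z) < e / (Cmod l + 1 + 1)) by lra.
  apply (Rmult_lt_compat_r (Cmod l + 1 + 1)) in B; [|lra].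
  replace (e / (Cmod l + 1 + 1) * (Cmod l + 1 + 1)) with e in B by (field; lra).
  pose proof (Cmod_ge_0 (w - z)%C). nra.
Qed.

Lemma hol_ccont (f : C -> C) (z : C) : hol f z -> ccont f z.
Proof. intros [l H]. exact (cder_ccont f z l H). Qed.

(** Caratheodory's form of differentiability: it turns the rules of the
    calculus into rules on continuous functions. *)
Lemma cder_slope (f : C -> C) (z l : C) :
  cder f z l <-> exists q, ccont q z /\ q z = l /\ forall w, (f w - f z = q w * (w - z))%C.
Proof.
  split.
  - intros H.
    exists (fun w => if excluded_middle_informative (w = z) then l
                     else ((f w - f z) / (w - z))%C).
    split; [|split].
    + intros e He. destruct (H (e/2)) as [d [Hd Hw]]; [lra|].
      exists d. split; auto. intros w W.
      destruct (excluded_middle_informative (z = z)) as [_|N]; [|congruence].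
      destruct (excluded_middle_informative (w = z)) as [E|N].
      * rewrite Cmod_sub_self. lra.
      * specialize (Hw w W).
        assert (P := Cmod_sub_pos w z N).
        assert (N' : (w - z)%C <> 0%C) by (apply Cmod_gt_0; auto).
        replace ((f w - f z) / (w - z) - l)%C
          with ((f w - f z - l * (w - z)) / (w - z))%C by (field; auto).
        rewrite Cmod_div by auto.
        apply (Rmult_lt_reg_r (Cmod (w - z))); auto.
        unfold Rdiv. rewrite Rmult_assoc, Rinv_l by lra. nra.
    + destruct (excluded_middle_informative (z = z)); congruence.
    + intros w. destruct (excluded_middle_informative (w = z)) as [E|N].
      * subst. ring.
      * assert (P := Cmod_sub_pos w z N).
        assert (N' : (w - z)%C <> 0%C) by (apply Cmod_gt_0; auto).
        field; auto.
  - intros [q [Hq [Hl H]]] e He. destruct (Hq e He) as [d [Hd Hd']].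
    exists d. split; auto. intros w Hw. rewrite H, <- Hl.
    replace (q w * (w - z) - q z * (w - z))%C with ((q w - q z) * (w - z))%C by ring.
    rewrite Cmod_mult. apply Rmult_le_compat_r; [apply Cmod_ge_0|].
    left. auto.
Qed.

Lemma cder_ext_loc (f g : C -> C) (z l : C) (r : R) : 0 < r ->
  (forall w, Cmod (w - z) < r -> f w = g w) -> cder f z l -> cder g z l.
Proof.
  intros Hr He Hf e Hep. destruct (Hf e Hep) as [d [Hd H]].
  use_min d r. intros w Hw.
  rewrite <- !He; [apply H; lra|rewrite Cmod_sub_self; lra|lra].
Qed.

Lemma cder_unique (f : C -> C) (z l m : C) : cder f z l -> cder f z m -> l = m.
Proof.
  intros Hl Hm. destruct (classic (l = m)) as [E|N]; auto. exfalso.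
  assert (P := Cmod_sub_pos l m N).
  destruct (Hl (Cmod (l - m) / 4)) as [d1 [Hd1 H1]]; [lra|].
  destruct (Hm (Cmod (l - m) / 4)) as [d2 [Hd2 H2]]; [lra|].
  set (h := Rmin d1 d2 / 2).
  assert (Hh : 0 < h) by (unfold h; assert (0 < Rmin d1 d2) by (apply Rmin_pos; auto); lra).
  pose proof (Rmin_l d1 d2). pose proof (Rmin_r d1 d2).
  assert (E : Cmod (z + RtoC h - z) = h).
  { replace (z + RtoC h - z)%C with (RtoC h) by ring. rewrite Cmod_R. apply Rabs_right; lra. }
  specialize (H1 (z + RtoC h)%C). specialize (H2 (z + RtoC h)%C).
  rewrite E in H1, H2. specialize (H1 ltac:(unfold h; lra)). specialize (H2 ltac:(unfold h; lra)).
  assert (Q : Cmod ((l - m) * RtoC h) = Cmod (l - m) * h).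
  { rewrite Cmod_mult, Cmod_R, Rabs_right; lra. }
  replace ((l - m) * RtoC h)%C with
    ((f (z + RtoC h) - f z - m * (z + RtoC h - z)) - (f (z + RtoC h) - f z - l * (z + RtoC h - z)))%C in Q by ring.
  pose proof (Cmod_triangle_sub (f (z + RtoC h) - f z - m * (z + RtoC h - z))%C (f (z + RtoC h) - f z - l * (z + RtoC h - z))%C). nra.
Qed.

Lemma cder_const (k z : C) : cder (fun _ => k) z 0%C.
Proof. apply cder_slope. exists (fun _ => RtoC 0). split; [apply ccont_const|]. split; auto. intros; ring. Qed.

Lemma cder_id (z : C) : cder (fun w => w) z 1%C.
Proof. apply cder_slope. exists (fun _ => RtoC 1). split; [apply ccont_const|]. split; auto. intros; ring. Qed.

Lemma cder_plus (f g : C -> C) (z l m : C) :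
  cder f z l -> cder g z m -> cder (fun w => f w + g w)%C z (l + m)%C.
Proof.
  intros Hf Hg. apply cder_slope in Hf. apply cder_slope in Hg.
  destruct Hf as [p [Hp [Ep Hp']]]. destruct Hg as [q [Hq [Eq Hq']]].
  apply cder_slope. exists (fun w => p w + q w)%C.
  split; [apply ccont_plus; auto|]. split; [congruence|]. intros w.
  replace (f w + g w - (f z + g z))%C with ((f w - f z) + (g w - g z))%C by ring.
  rewrite Hp', Hq'. ring.
Qed.

Lemma cder_mult (f g : C -> C) (z l m : C) :
  cder f z l -> cder g z m -> cder (fun w => f w * g w)%C z (l * g z + f z * m)%C.
Proof.
  intros Hf Hg. pose proof (cder_ccont _ _ _ Hf) as Cf.
  apply cder_slope in Hf. apply cder_slope in Hg.
  destruct Hf as [p [Hp [Ep Hp']]]. destruct Hg as [q [Hq [Eq Hq']]].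
  apply cder_slope. exists (fun w => p w * g z + f w * q w)%C.
  split; [|split].
  - apply ccont_plus; apply ccont_mult; auto. apply ccont_const.
  - congruence.
  - intros w. replace (f w * g w - f z * g z)%C
      with ((f w - f z) * g z + f w * (g w - g z))%C by ring.
    rewrite Hp', Hq'. ring.
Qed.

Lemma cder_inv (f : C -> C) (z l : C) :
  cder f z l -> f z <> 0%C -> cder (fun w => / f w)%C z (- l / (f z * f z))%C.
Proof.
  intros Hf Hz. pose proof (cder_ccont _ _ _ Hf) as Cf.
  destruct (ccont_away f z Cf Hz) as [r [Hr Hr']].
  apply cder_slope in Hf. destruct Hf as [p [Hp [Ep Hp']]].
  (* the zeros of [f] keep away from [z]; there [f] is given the value [f z], which is invertible *)
  apply (cder_ext_loc
    (fun w => / (if excluded_middle_informative (f w = 0%C) then f z else f w))%C _ z _ r Hr).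
  { intros w Hw. specialize (Hr' w Hw).
    destruct (excluded_middle_informative (f w = 0%C)) as [E|N]; auto.
    rewrite E, Cmod_0 in Hr'. pose proof (Cmod_ge_0 (f z)). lra. }
  apply cder_slope.
  exists (fun w => if excluded_middle_informative (f w = 0%C) then RtoC 0
                   else (- p w / (f w * f z))%C).
  split; [|split].
  - apply (ccont_ext_loc (fun w => - p w * / (f w * f z))%C _ z r Hr).
    + intros w Hw. specialize (Hr' w Hw).
      destruct (excluded_middle_informative (f w = 0%C)) as [E|N]; auto.
      rewrite E, Cmod_0 in Hr'. pose proof (Cmod_ge_0 (f z)). lra.
    + apply ccont_mult; [apply ccont_opp; auto|]. apply ccont_inv.
      * apply ccont_mult; auto. apply ccont_const.
      * apply Cmult_neq_0; auto.
  - destruct (excluded_middle_informative (f z = 0%C)); [contradiction|]. congruence.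
  - intros w. destruct (excluded_middle_informative (f z = 0%C)); [contradiction|].
    destruct (excluded_middle_informative (f w = 0%C)) as [E|N]; [ring|].
    replace (/ f w - / f z)%C with (- (f w - f z) / (f w * f z))%C by (field; auto).
    rewrite Hp'. field; auto.
Qed.

Lemma cder_opp (f : C -> C) (z l : C) : cder f z l -> cder (fun w => - f w)%C z (- l)%C.
Proof.
  intros Hf. apply (cder_ext_loc (fun w => (-(1)) * f w)%C _ z _ 1); [lra| |].
  - intros; ring.
  - replace (- l)%C with (0 * f z + (-(1)) * l)%C by ring.
    apply (cder_mult (fun _ => (-(1))%C) f); auto. apply cder_const.
Qed.

Lemma cder_minus (f g : C -> C) (z l m : C) :
  cder f z l -> cder g z m -> cder (fun w => f w - g w)%C z (l - m)%C.
Proof. intros Hf Hg. apply (cder_plus f (fun w => - g w)%C); auto. apply cder_opp; auto. Qed.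

Lemma cder_eq (f : C -> C) (z l m : C) : cder f z l -> l = m -> cder f z m.
Proof. intros H <-. exact H. Qed.

Lemma complex_differentiable_hol (f : C -> C) (z : C) :
  complex_differentiable f z -> hol f z.
Proof.
  intros [l [_ Hl]]. exists l. intros e He.
  specialize (Hl z). 
  assert (F : is_filter_lim (locally (T := AbsRing_UniformSpace C_AbsRing) z) z) by (intros P HP; exact HP).
  specialize (Hl F (mkposreal e He)). simpl in Hl.
  destruct Hl as [d Hd]. exists d. split; [apply cond_pos|].
  intros w Hw. specialize (Hd w Hw).
  change (Cmod ((f w - f z) - ((w - z) * l)) <= e * Cmod (w - z)) in Hd.
  replace (f w - f z - l * (w - z))%C with ((f w - f z) - ((w - z) * l))%C by ring. exact Hd.
Qed.

(** * Compactness by bisection *)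

Definition half (n : nat) : R := (/ 2) ^ n.

Lemma half_pos n : 0 < half n.
Proof. apply pow_lt. lra. Qed.

Lemma half_S n : half (S n) = half n / 2.
Proof. unfold half. simpl. lra. Qed.

Lemma half_small (A eps : R) : 0 < eps -> exists n, A * half n < eps.
Proof.
  intros He.
  destruct (pow_lt_1_zero (/2) ltac:(rewrite Rabs_right; lra) (eps / (Rabs A + 1))) as [N HN].
  { apply Rdiv_lt_0_compat; auto. pose proof (Rabs_pos A). lra. }
  exists N. specialize (HN N (le_n N)).
  rewrite Rabs_right in HN by (apply Rle_ge; left; apply half_pos).
  fold (half N) in HN. pose proof (half_pos N). pose proof (Rabs_pos A).
  pose proof (Rle_abs A).
  apply (Rmult_lt_compat_r (Rabs A + 1)) in HN; [|lra].
  replace (eps / (Rabs A + 1) * (Rabs A + 1)) with eps in HN by (field; lra). nra.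
Qed.

Lemma nested_intervals (u v : nat -> R) :
  (forall n, u n <= u (S n)) -> (forall n, v (S n) <= v n) -> (forall n, u n <= v n) ->
  exists x, forall n, u n <= x <= v n.
Proof.
  intros Hu Hv Huv.
  assert (Mu : forall n k, u n <= u (n + k)%nat).
  { intros n k. induction k; [rewrite Nat.add_0_r; lra|].
    rewrite Nat.add_succ_r. specialize (Hu (n + k)%nat). lra. }
  assert (Mv : forall n k, v (n + k)%nat <= v n).
  { intros n k. induction k; [rewrite Nat.add_0_r; lra|].
    rewrite Nat.add_succ_r. specialize (Hv (n + k)%nat). lra. }
  assert (B : forall n m, u n <= v m).
  { intros n m. specialize (Mu n m). specialize (Mv m n). rewrite Nat.add_comm in Mv.
    specialize (Huv (n + m)%nat). lra. }
  destruct (completeness (fun x => exists n, x = u n)) as [x [Hx1 Hx2]].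
  - exists (v O). intros y [n ->]. apply B.
  - exists (u O). exists O. auto.
  - exists x. intros n. split.
    + apply Hx1. exists n. auto.
    + apply Hx2. intros y [m ->]. apply B.
Qed.

(** Cousin's lemma: otherwise some quarter of every bad rectangle is bad again, and
    the nested bad rectangles shrink to a point near which there are none.  Halving
    preserves the shape, so the local hypothesis may fix the ratio of the sides. *)
Lemma rectangle_bisection (P : R -> R -> R -> R -> Prop) (x1 x2 y1 y2 : R) :
  x1 <= x2 -> y1 <= y2 ->
  (forall a b c d, a <= b -> c <= d ->
     P a ((a + b) / 2) c ((c + d) / 2) -> P ((a + b) / 2) b c ((c + d) / 2) ->
     P a ((a + b) / 2) ((c + d) / 2) d -> P ((a + b) / 2) b ((c + d) / 2) d -> P a b c d) ->
  (forall x y, x1 <= x <= x2 -> y1 <= y <= y2 -> exists del, 0 < del /\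
     forall a b c d t, a <= x <= b -> c <= y <= d -> x1 <= a -> b <= x2 -> y1 <= c -> d <= y2 ->
       0 < t < del -> b - a = t * (x2 - x1) -> d - c = t * (y2 - y1) -> P a b c d) ->
  P x1 x2 y1 y2.
Proof.
  intros Hx Hy Hquart Hloc. apply NNPP. intros HN.
  set (step := fun s : R * R * (R * R) =>
    let '((a, b), (c, d)) := s in
    let m := (a + b) / 2 in let n := (c + d) / 2 in
    if excluded_middle_informative (P a m c n) then
      if excluded_middle_informative (P m b c n) then
        if excluded_middle_informative (P a m n d) then ((m, b), (n, d))
        else ((a, m), (n, d))
      else ((m, b), (c, n))
    else ((a, m), (c, n))).
  set (s := fun n => Nat.iter n step ((x1, x2), (y1, y2))).
  set (a := fun n => fst (fst (s n))). set (b := fun n => snd (fst (s n))).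
  set (c := fun n => fst (snd (s n))). set (d := fun n => snd (snd (s n))).
  assert (Inv : forall n, ~ P (a n) (b n) (c n) (d n) /\
     b n - a n = half n * (x2 - x1) /\ d n - c n = half n * (y2 - y1)).
  { induction n as [|n [I1 [I2 I3]]].
    - unfold a, b, c, d, s, half; simpl. split; auto. split; lra.
    - revert I1 I2 I3. unfold a, b, c, d, s. rewrite Nat.iter_succ.
      destruct (Nat.iter n step (x1, x2, (y1, y2))) as [[p q] [r t]]. simpl.
      rewrite half_S. pose proof (half_pos n). intros I1 I2 I3.
      assert (p <= q) by nra. assert (r <= t) by nra.
      specialize (Hquart p q r t ltac:(lra) ltac:(lra)).
      repeat destruct excluded_middle_informative; simpl; (split; [tauto|split; lra]). }
  assert (Mono : forall n, a n <= a (S n) /\ b (S n) <= b n /\ c n <= c (S n) /\ d (S n) <= d n).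
  { intros n. destruct (Inv n) as [_ [I2 I3]]. revert I2 I3.
    unfold a, b, c, d, s. rewrite Nat.iter_succ.
    destruct (Nat.iter n step (x1, x2, (y1, y2))) as [[p q] [r t]]. simpl.
    pose proof (half_pos n). intros I2 I3.
    assert (p <= q) by nra. assert (r <= t) by nra.
    repeat destruct excluded_middle_informative; simpl; lra. }
  assert (Pos : forall n, a n <= b n /\ c n <= d n).
  { intros n. destruct (Inv n) as [_ [I2 I3]]. pose proof (half_pos n). split; nra. }
  destruct (nested_intervals a b) as [x Hxx]; try (intros n; first [apply Mono | apply Pos]).
  destruct (nested_intervals c d) as [y Hyy]; try (intros n; first [apply Mono | apply Pos]).
  assert (Bd : forall n, x1 <= a n /\ b n <= x2 /\ y1 <= c n /\ d n <= y2).
  { induction n; [unfold a, b, c, d, s; simpl; lra|]. specialize (Mono n). lra. }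
  destruct (Hloc x y) as [del [Hdel Hd]].
  { specialize (Hxx O). unfold a, b, s in Hxx; simpl in Hxx. lra. }
  { specialize (Hyy O). unfold c, d, s in Hyy; simpl in Hyy. lra. }
  destruct (half_small 1 del Hdel) as [n Hn].
  destruct (Inv n) as [I1 [I2 I3]]. apply I1.
  specialize (Bd n). specialize (Hxx n). specialize (Hyy n). pose proof (half_pos n).
  apply (Hd _ _ _ _ (half n)); lra.
Qed.

Lemma Cmod_lt_box (z q : C) (e : R) :
  Rabs (fst z - fst q) < e / 2 -> Rabs (snd z - snd q) < e / 2 -> Cmod (z - q) < e.
Proof.
  intros H1 H2. eapply Rle_lt_trans; [apply Cmod_le_Re_Im|]. simpl.
  unfold Rminus in *. lra.
Qed.

Lemma square_bisection (P : R -> R -> R -> R -> Prop) (M : R) :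
  0 < M ->
  (forall a b c d, a <= b -> c <= d ->
     P a ((a + b) / 2) c ((c + d) / 2) -> P ((a + b) / 2) b c ((c + d) / 2) ->
     P a ((a + b) / 2) ((c + d) / 2) d -> P ((a + b) / 2) b ((c + d) / 2) d -> P a b c d) ->
  (forall q : C, exists del, 0 < del /\ forall a b c d,
     (forall z : C, a <= fst z <= b -> c <= snd z <= d -> Cmod (z - q) < del) -> P a b c d) ->
  P (- M) M (- M) M.
Proof.
  intros HM Hq Hloc. apply rectangle_bisection; auto; try lra.
  intros x y Hx Hy. destruct (Hloc (x, y)) as [del [Hdel Hd]].
  exists (del / (8 * M)). split; [apply Rdiv_lt_0_compat; lra|].
  intros a b c d t Ha Hc Ba Bb Bc Bd Ht Eab Ecd. apply Hd.
  intros [u v] Hu Hv. simpl in Hu, Hv.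
  assert (t * (8 * M) < del).
  { destruct Ht as [_ Ht]. apply (Rmult_lt_compat_r (8 * M)) in Ht; [|lra].
    replace (del / (8 * M) * (8 * M)) with del in Ht by (field; lra). lra. }
  apply Cmod_lt_box; simpl; apply Rabs_def1; nra.
Qed.

(** If no point is a cluster point, then every point has a neighbourhood that the
    sequence eventually avoids, and avoidance passes from four quarters to the whole. *)
Lemma bounded_cluster_point (y : nat -> C) (M : R) :
  (forall n, Cmod (y n) <= M) ->
  exists q, forall del N, 0 < del -> exists n, (N <= n)%nat /\ Cmod (y n - q) < del.
Proof.
  intros Hy. apply NNPP. intros HN.
  assert (Hq : forall q, exists del N, 0 < del /\ forall n, (N <= n)%nat -> del <= Cmod (y n - q)).
  { intros q. apply NNPP. intros Hq. apply HN. exists q. intros del N Hd.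
    apply NNPP. intros Hn. apply Hq. exists del, N. split; auto. intros n Hle.
    apply Rnot_lt_le. intros Hlt. apply Hn. exists n. auto. }
  set (P := fun a b c d => exists N, forall n, (N <= n)%nat ->
     ~ (a <= fst (y n) <= b /\ c <= snd (y n) <= d)).
  assert (Hall : P (- (Rabs M + 1)) (Rabs M + 1) (- (Rabs M + 1)) (Rabs M + 1)).
  { pose proof (Rabs_pos M). apply square_bisection; [lra| |].
    - intros a b c d Hab Hcd [N1 H1] [N2 H2] [N3 H3] [N4 H4].
      exists (N1 + N2 + N3 + N4)%nat. intros n Hn [Ha Hb].
      specialize (H1 n ltac:(lia)). specialize (H2 n ltac:(lia)).
      specialize (H3 n ltac:(lia)). specialize (H4 n ltac:(lia)).
      destruct (Rle_dec (fst (y n)) ((a + b) / 2)), (Rle_dec (snd (y n)) ((c + d) / 2));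
      [apply H1|apply H3|apply H2|apply H4]; lra.
    - intros q. destruct (Hq q) as [del [N [Hd HN']]]. exists del. split; auto.
      intros a b c d Hz. exists N. intros n Hn [Ha Hb].
      specialize (HN' n Hn). specialize (Hz (y n) Ha Hb). lra. }
  destruct Hall as [N H]. apply (H N (le_n N)). specialize (Hy N).
  pose proof (Re_le_Cmod (y N)) as A. pose proof (Im_le_Cmod (y N)) as B.
  pose proof (Rle_abs M).
  apply Rabs_le_between in A. apply Rabs_le_between in B. lra.
Qed.

Definition rcont (u : C -> R) (z : C) : Prop :=
  forall eps, 0 < eps -> exists del, 0 < del /\
    forall w, Cmod (w - z) < del -> Rabs (u w - u z) < eps.

(** Compactness by bisection: if no point of [K] is a maximum, then near every
    point [u] stays below one of its own values, hence also on all of [K]. *)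
Lemma max_attained (u : C -> R) (K : C -> Prop) (M : R) :
  (exists z, K z) -> (forall z, K z -> Cmod z <= M) ->
  (forall z, ~ K z -> exists del, 0 < del /\ forall w, Cmod (w - z) < del -> ~ K w) ->
  (forall z, K z -> rcont u z) ->
  exists z, K z /\ forall w, K w -> u w <= u z.
Proof.
  intros [z0 Hz0] Hb Hcl Hu. apply NNPP. intros HN.
  assert (Hup : forall z, K z -> exists w, K w /\ u z < u w).
  { intros z Hz. apply NNPP. intros H. apply HN. exists z. split; auto.
    intros w Hw. apply Rnot_lt_le. intros L. apply H. exists w. auto. }
  set (P := fun a b c d => exists q, K q /\
     forall w, K w -> a <= fst w <= b -> c <= snd w <= d -> u w < u q).
  assert (Hall : P (- (Rabs M + 1)) (Rabs M + 1) (- (Rabs M + 1)) (Rabs M + 1)).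
  { pose proof (Rabs_pos M). apply square_bisection; [lra| |].
    - assert (Hmax : forall p q, K p -> K q -> exists r, K r /\ u p <= u r /\ u q <= u r).
      { intros p q Hp Hq. destruct (Rle_dec (u p) (u q)); [exists q|exists p]; repeat split; auto; lra. }
      intros a b c d Hab Hcd [q1 [K1 H1]] [q2 [K2 H2]] [q3 [K3 H3]] [q4 [K4 H4]].
      destruct (Hmax q1 q2 K1 K2) as [r [Kr [R1 R2]]].
      destruct (Hmax q3 q4 K3 K4) as [s [Ks [S3 S4]]].
      destruct (Hmax r s Kr Ks) as [t [Kt [T1 T2]]].
      exists t. split; auto. intros w Kw Hw1 Hw2.
      specialize (H1 w Kw). specialize (H2 w Kw). specialize (H3 w Kw). specialize (H4 w Kw).
      destruct (Rle_dec (fst w) ((a + b) / 2)), (Rle_dec (snd w) ((c + d) / 2));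
      [specialize (H1 ltac:(lra) ltac:(lra))|specialize (H3 ltac:(lra) ltac:(lra))
      |specialize (H2 ltac:(lra) ltac:(lra))|specialize (H4 ltac:(lra) ltac:(lra))]; lra.
    - intros q. destruct (classic (K q)) as [Kq|Nq].
      + destruct (Hup q Kq) as [p [Kp Hp]].
        destruct (Hu q Kq (u p - u q)) as [del [Hd H']]; [lra|].
        exists del. split; auto. intros a b c d Hz. exists p. split; auto.
        intros w Kw Hw1 Hw2. specialize (H' w (Hz w Hw1 Hw2)). apply Rabs_def2 in H'. lra.
      + destruct (Hcl q Nq) as [del [Hd H']]. exists del. split; auto.
        intros a b c d Hz. exists z0. split; auto. intros w Kw Hw1 Hw2.
        exfalso. apply (H' w); auto. }
  destruct Hall as [q [Kq H]]. specialize (H q Kq). specialize (Hb q Kq).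
  pose proof (Re_le_Cmod q) as A. pose proof (Im_le_Cmod q) as B. pose proof (Rle_abs M).
  apply Rabs_le_between in A. apply Rabs_le_between in B.
  specialize (H ltac:(lra) ltac:(lra)). lra.
Qed.

(** * Integrals of complex functions of a real variable *)

Definition pcont (g : R -> C) (t : R) : Prop :=
  forall eps, 0 < eps -> exists del, 0 < del /\
    forall s, Rabs (s - t) < del -> Cmod (g s - g t) < eps.

Definition CInt (g : R -> C) (a b : R) : C :=
  (RInt (fun t => fst (g t)) a b, RInt (fun t => snd (g t)) a b).

Lemma pcont_comp (f : C -> C) (g : R -> C) (t : R) :
  ccont f (g t) -> pcont g t -> pcont (fun s => f (g s)) t.
Proof.
  intros Hf Hg e He. destruct (Hf e He) as [d [Hd H]].
  destruct (Hg d Hd) as [d' [Hd' H']]. exists d'. split; auto.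
Qed.

Lemma pcont_intro (g : R -> C) (t : R) :
  continuous (fun s => fst (g s)) t -> continuous (fun s => snd (g s)) t -> pcont g t.
Proof.
  intros H1 H2 e He.
  assert (He2 : 0 < e / 2) by lra.
  destruct (proj1 (filterlim_locally _ _) H1 (mkposreal _ He2)) as [d1 D1].
  destruct (proj1 (filterlim_locally _ _) H2 (mkposreal _ He2)) as [d2 D2].
  exists (Rmin d1 d2). split; [apply Rmin_pos; apply cond_pos|].
  intros s Hs. pose proof (Rmin_l d1 d2). pose proof (Rmin_r d1 d2).
  specialize (D1 s). specialize (D2 s).
  apply Cmod_lt_box; [apply D1|apply D2]; change (Rabs (s - t) < d1) || change (Rabs (s - t) < d2); lra.
Qed.

Lemma pcont_fst (g : R -> C) (t : R) : pcont g t -> continuous (fun s => fst (g s)) t.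
Proof.
  intros H. apply filterlim_locally. intros [e He].
  destruct (H e He) as [d [Hd H']]. exists (mkposreal d Hd). intros s Hs.
  change (Rabs (fst (g s) - fst (g t)) < e).
  eapply Rle_lt_trans; [apply (Re_le_Cmod (g s - g t)%C)|]. apply H'. exact Hs.
Qed.

Lemma pcont_snd (g : R -> C) (t : R) : pcont g t -> continuous (fun s => snd (g s)) t.
Proof.
  intros H. apply filterlim_locally. intros [e He].
  destruct (H e He) as [d [Hd H']]. exists (mkposreal d Hd). intros s Hs.
  change (Rabs (snd (g s) - snd (g t)) < e).
  eapply Rle_lt_trans; [apply (Im_le_Cmod (g s - g t)%C)|]. apply H'. exact Hs.
Qed.

Definition pcont_on (g : R -> C) (a b : R) : Prop := forall t, Rmin a b <= t <= Rmax a b -> pcont g t.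

Lemma ex_RInt_fst (g : R -> C) (a b : R) : pcont_on g a b -> ex_RInt (fun t => fst (g t)) a b.
Proof. intros H. apply (ex_RInt_continuous (V := R_CompleteNormedModule)). intros t Ht. apply pcont_fst, H, Ht. Qed.

Lemma ex_RInt_snd (g : R -> C) (a b : R) : pcont_on g a b -> ex_RInt (fun t => snd (g t)) a b.
Proof. intros H. apply (ex_RInt_continuous (V := R_CompleteNormedModule)). intros t Ht. apply pcont_snd, H, Ht. Qed.

Lemma CInt_Chasles (g : R -> C) (a b c : R) :
  pcont_on g a b -> pcont_on g b c -> (CInt g a b + CInt g b c = CInt g a c)%C.
Proof.
  intros H1 H2. apply injective_projections.
  - exact (RInt_Chasles (V := R_CompleteNormedModule) (fun t => fst (g t)) a b c
             (ex_RInt_fst g a b H1) (ex_RInt_fst g b c H2)).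
  - exact (RInt_Chasles (V := R_CompleteNormedModule) (fun t => snd (g t)) a b c
             (ex_RInt_snd g a b H1) (ex_RInt_snd g b c H2)).
Qed.

Lemma CInt_ext (g h : R -> C) (a b : R) :
  (forall t, Rmin a b <= t <= Rmax a b -> g t = h t) -> CInt g a b = CInt h a b.
Proof.
  intros H. unfold CInt. f_equal; apply RInt_ext; intros t Ht; rewrite H by lra; auto.
Qed.

Lemma CInt_plus (g h : R -> C) (a b : R) : pcont_on g a b -> pcont_on h a b ->
  CInt (fun t => g t + h t)%C a b = (CInt g a b + CInt h a b)%C.
Proof.
  intros Hg Hh. apply injective_projections.
  - exact (RInt_plus (V := R_CompleteNormedModule) (fun t => fst (g t)) (fun t => fst (h t)) a b
             (ex_RInt_fst g a b Hg) (ex_RInt_fst h a b Hh)).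
  - exact (RInt_plus (V := R_CompleteNormedModule) (fun t => snd (g t)) (fun t => snd (h t)) a b
             (ex_RInt_snd g a b Hg) (ex_RInt_snd h a b Hh)).
Qed.

Lemma CInt_Cmult (g : R -> C) (k : C) (a b : R) : pcont_on g a b ->
  CInt (fun t => k * g t)%C a b = (k * CInt g a b)%C.
Proof.
  intros Hg. pose proof (ex_RInt_fst g a b Hg) as H1. pose proof (ex_RInt_snd g a b Hg) as H2.
  destruct k as [k1 k2]. apply injective_projections.
  - etransitivity; [exact (RInt_minus (V := R_CompleteNormedModule)
      (fun t => scal k1 (fst (g t))) (fun t => scal k2 (snd (g t))) a b
      (ex_RInt_scal (V := R_NormedModule) _ a b k1 H1)
      (ex_RInt_scal (V := R_NormedModule) _ a b k2 H2))|].
    exact (f_equal2 Rminus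
      (RInt_scal (V := R_CompleteNormedModule) (fun t => fst (g t)) a b k1 H1)
      (RInt_scal (V := R_CompleteNormedModule) (fun t => snd (g t)) a b k2 H2)).
  - etransitivity; [exact (RInt_plus (V := R_CompleteNormedModule)
      (fun t => scal k1 (snd (g t))) (fun t => scal k2 (fst (g t))) a b
      (ex_RInt_scal (V := R_NormedModule) _ a b k1 H2)
      (ex_RInt_scal (V := R_NormedModule) _ a b k2 H1))|].
    exact (f_equal2 Rplus
      (RInt_scal (V := R_CompleteNormedModule) (fun t => snd (g t)) a b k1 H2)
      (RInt_scal (V := R_CompleteNormedModule) (fun t => fst (g t)) a b k2 H1)).
Qed.

(** The factor [2] comes from bounding the two components separately. *)
Lemma Cmod_CInt_le (g : R -> C) (a b M : R) : a <= b -> pcont_on g a b ->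
  (forall t, a <= t <= b -> Cmod (g t) <= M) -> Cmod (CInt g a b) <= 2 * M * (b - a).
Proof.
  intros Hab Hg HM. eapply Rle_trans; [apply Cmod_le_Re_Im|]. simpl.
  assert (A1 := abs_RInt_le_const _ a b M Hab (ex_RInt_fst g a b Hg)).
  assert (A2 := abs_RInt_le_const _ a b M Hab (ex_RInt_snd g a b Hg)).
  assert (B1 : Rabs (RInt (fun t => fst (g t)) a b) <= (b - a) * M).
  { apply A1. intros t Ht. eapply Rle_trans; [apply Re_le_Cmod|]. auto. }
  assert (B2 : Rabs (RInt (fun t => snd (g t)) a b) <= (b - a) * M).
  { apply A2. intros t Ht. eapply Rle_trans; [apply Im_le_Cmod|]. auto. }
  lra.
Qed.

Lemma CInt_const (k : C) (a b : R) : CInt (fun _ => k) a b = (RtoC (b - a) * k)%C.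
Proof.
  unfold CInt. rewrite !RInt_const. destruct k; unfold scal; simpl; unfold mult; simpl.
  unfold Cmult; simpl. f_equal; ring.
Qed.

(** * Goursat's theorem and primitives *)

Lemma CInt_point (g : R -> C) (a : R) : CInt g a a = RtoC 0.
Proof. unfold CInt. rewrite !RInt_point. reflexivity. Qed.

Lemma CInt_swap (g : R -> C) (a b : R) : pcont_on g a b -> (CInt g b a = - CInt g a b)%C.
Proof.
  intros H. assert (H' : pcont_on g b a).
  { intros t Ht. apply H. rewrite Rmin_comm, Rmax_comm. exact Ht. }
  assert (E := CInt_Chasles g a b a H H').
  rewrite CInt_point in E. replace (CInt g b a) with ((CInt g a b + CInt g b a) - CInt g a b)%C by ring.
  rewrite E. ring.
Qed.

Lemma Cmod_CInt_le_abs (g : R -> C) (a b M : R) : pcont_on g a b ->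
  (forall t, Rmin a b <= t <= Rmax a b -> Cmod (g t) <= M) ->
  Cmod (CInt g a b) <= 2 * M * Rabs (b - a).
Proof.
  intros Hg HM. destruct (Rle_dec a b) as [Hab|Hab].
  - rewrite Rabs_right by lra. apply Cmod_CInt_le; auto. intros t Ht. apply HM.
    rewrite Rmin_left, Rmax_right by lra. exact Ht.
  - rewrite CInt_swap, Cmod_opp.
    + rewrite Rabs_left by lra. replace (- (b - a)) with (a - b) by ring.
      apply Cmod_CInt_le; [lra| |].
      * intros t Ht. apply Hg. rewrite Rmin_comm, Rmax_comm. exact Ht.
      * intros t Ht. apply HM. rewrite Rmin_right, Rmax_left by lra. exact Ht.
    + intros t Ht. apply Hg. rewrite Rmin_comm, Rmax_comm. exact Ht.
Qed.

Lemma pcont_hline (f : C -> C) (y t : R) : (forall z, ccont f z) -> pcont (fun s => f (s, y)) t.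
Proof.
  intros Hf. apply (pcont_comp f (fun s => (s, y))); auto.
  intros e He. exists e. split; auto. intros s Hs.
  eapply Rle_lt_trans; [apply Cmod_le_Re_Im|]. simpl.
  replace (y + - y) with 0 by ring. rewrite Rabs_R0. unfold Rminus in Hs. lra.
Qed.

Lemma pcont_vline (f : C -> C) (x t : R) : (forall z, ccont f z) -> pcont (fun s => f (x, s)) t.
Proof.
  intros Hf. apply (pcont_comp f (fun s => (x, s))); auto.
  intros e He. exists e. split; auto. intros s Hs.
  eapply Rle_lt_trans; [apply Cmod_le_Re_Im|]. simpl.
  replace (x + - x) with 0 by ring. rewrite Rabs_R0. unfold Rminus in Hs. lra.
Qed.

Definition rectint (f : C -> C) (a b c d : R) : C :=
  (CInt (fun t => f (t, c)) a b - CInt (fun t => f (t, d)) a b +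
   Ci * (CInt (fun t => f (b, t)) c d - CInt (fun t => f (a, t)) c d))%C.

Lemma rectint_ext (f g : C -> C) (a b c d : R) :
  (forall z, f z = g z) -> rectint f a b c d = rectint g a b c d.
Proof.
  intros H. unfold rectint.
  rewrite (CInt_ext (fun t => f (t, c)) (fun t => g (t, c))) by auto.
  rewrite (CInt_ext (fun t => f (t, d)) (fun t => g (t, d))) by auto.
  rewrite (CInt_ext (fun t => f (b, t)) (fun t => g (b, t))) by auto.
  rewrite (CInt_ext (fun t => f (a, t)) (fun t => g (a, t))) by auto.
  reflexivity.
Qed.

Lemma rectint_split (f : C -> C) (a m b c n d : R) : (forall z, ccont f z) ->
  (rectint f a b c d = rectint f a m c n + rectint f m b c n +
                       (rectint f a m n d + rectint f m b n d))%C.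
Proof.
  intros Hf.
  assert (HH : forall y, (CInt (fun t => f (t, y)) a m + CInt (fun t => f (t, y)) m b
                = CInt (fun t => f (t, y)) a b)%C).
  { intros y. apply CInt_Chasles; intros t _; apply pcont_hline; auto. }
  assert (HV : forall x, (CInt (fun t => f (x, t)) c n + CInt (fun t => f (x, t)) n d
                = CInt (fun t => f (x, t)) c d)%C).
  { intros x. apply CInt_Chasles; intros t _; apply pcont_vline; auto. }
  unfold rectint. rewrite <- !HH, <- !HV. ring.
Qed.

Lemma rectint_plus (f g : C -> C) (a b c d : R) :
  (forall z, ccont f z) -> (forall z, ccont g z) ->
  (rectint (fun z => f z + g z) a b c d = rectint f a b c d + rectint g a b c d)%C.
Proof.
  intros Hf Hg. unfold rectint.
  rewrite (CInt_plus (fun t => f (t, c)) (fun t => g (t, c))) by (intros t _; apply pcont_hline; auto).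
  rewrite (CInt_plus (fun t => f (t, d)) (fun t => g (t, d))) by (intros t _; apply pcont_hline; auto).
  rewrite (CInt_plus (fun t => f (a, t)) (fun t => g (a, t))) by (intros t _; apply pcont_vline; auto).
  rewrite (CInt_plus (fun t => f (b, t)) (fun t => g (b, t))) by (intros t _; apply pcont_vline; auto).
  ring.
Qed.

Lemma ccont_affine (k l z : C) : ccont (fun w => k + l * w)%C z.
Proof.
  apply ccont_plus; [apply ccont_const|]. apply ccont_mult; [apply ccont_const|apply ccont_id].
Qed.

(** The horizontal sides differ by [l Ci (c - d)], the vertical ones by [l (b - a)]. *)
Lemma rectint_affine (k l : C) (a b c d : R) : rectint (fun w => k + l * w)%C a b c d = RtoC 0.
Proof.
  set (f := fun w => (k + l * w)%C).
  assert (Hf : forall z, ccont f z) by (intros; apply ccont_affine).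
  unfold rectint.
  rewrite (CInt_ext (fun t => f (t, c)) (fun t => f (t, d) + l * (Ci * RtoC (c - d)))%C).
  2: { intros t _. unfold f. destruct k, l; apply injective_projections; simpl; ring. }
  rewrite (CInt_ext (fun t => f (b, t)) (fun t => f (a, t) + l * RtoC (b - a))%C).
  2: { intros t _. unfold f. destruct k, l; apply injective_projections; simpl; ring. }
  assert (CC : forall q : C, forall u v, pcont_on (fun _ => q) u v).
  { intros q u v t _ e He. exists 1. split; [lra|]. intros. rewrite Cmod_sub_self. auto. }
  rewrite !CInt_plus; auto; try (intros t _; first [apply pcont_hline|apply pcont_vline]; auto).
  rewrite !CInt_const.
  replace (c - d) with (- (d - c)) by ring. rewrite RtoC_opp. ring.
Qed.

Lemma Cmod_rectint_le (f : C -> C) (a b c d M : R) : (forall z, ccont f z) ->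
  a <= b -> c <= d ->
  (forall z : C, a <= fst z <= b -> c <= snd z <= d -> Cmod (f z) <= M) ->
  Cmod (rectint f a b c d) <= 4 * M * ((b - a) + (d - c)).
Proof.
  intros Hf Hab Hcd HM. unfold rectint.
  assert (H1 : forall y, c <= y <= d -> Cmod (CInt (fun t => f (t, y)) a b) <= 2 * M * (b - a)).
  { intros y Hy. apply Cmod_CInt_le; [auto|intros t _; apply pcont_hline; auto|].
    intros t Ht. apply HM; simpl; lra. }
  assert (H2 : forall x, a <= x <= b -> Cmod (CInt (fun t => f (x, t)) c d) <= 2 * M * (d - c)).
  { intros x Hx. apply Cmod_CInt_le; [auto|intros t _; apply pcont_vline; auto|].
    intros t Ht. apply HM; simpl; lra. }
  eapply Rle_trans; [apply Cmod_triangle|]. rewrite Cmod_mult, Cmod_Ci.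
  pose proof (Cmod_triangle_sub (CInt (fun t => f (t, c)) a b) (CInt (fun t => f (t, d)) a b)).
  pose proof (Cmod_triangle_sub (CInt (fun t => f (b, t)) c d) (CInt (fun t => f (a, t)) c d)).
  pose proof (H1 c ltac:(lra)). pose proof (H1 d ltac:(lra)).
  pose proof (H2 a ltac:(lra)). pose proof (H2 b ltac:(lra)). lra.
Qed.

Lemma rectint_near_affine (f : C -> C) (k l : C) (a b c d M : R) : (forall z, ccont f z) ->
  a <= b -> c <= d ->
  (forall z : C, a <= fst z <= b -> c <= snd z <= d -> Cmod (f z - (k + l * z)) <= M) ->
  Cmod (rectint f a b c d) <= 4 * M * ((b - a) + (d - c)).
Proof.
  intros Hf Hab Hcd HM.
  set (g := fun z => (f z - (k + l * z))%C).
  assert (Hg : forall z, ccont g z).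
  { intros z. apply ccont_minus; auto. apply ccont_affine. }
  replace (rectint f a b c d) with (rectint g a b c d).
  - apply Cmod_rectint_le; auto.
  - assert (E := rectint_plus g (fun z => k + l * z)%C a b c d Hg (ccont_affine k l)).
    rewrite rectint_affine in E.
    replace (rectint g a b c d) with (rectint g a b c d + RtoC 0)%C by ring. rewrite <- E.
    apply rectint_ext. intros z. unfold g. ring.
Qed.

Definition sgnsqrt (u : R) : R := sqrt u - sqrt (- u).

Lemma sgnsqrt_mono (u v : R) : u <= v -> sgnsqrt u <= sgnsqrt v.
Proof.
  intros H. unfold sgnsqrt. assert (sqrt u <= sqrt v) by (apply sqrt_le_1_alt; lra).
  assert (sqrt (- v) <= sqrt (- u)) by (apply sqrt_le_1_alt; lra). lra.
Qed.

Lemma sgnsqrt_jump (u v : R) : u <= 0 <= v -> sqrt (v - u) <= sgnsqrt v - sgnsqrt u.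
Proof.
  intros [Hu Hv]. unfold sgnsqrt. rewrite (sqrt_neg_0 u), (sqrt_neg_0 (- v)) by lra.
  pose proof (sqrt_pos v). pose proof (sqrt_pos (- u)).
  apply Rsqr_incr_0_var; [|lra]. unfold Rsqr.
  rewrite sqrt_sqrt by lra.
  pose proof (sqrt_sqrt v Hv). pose proof (sqrt_sqrt (- u) ltac:(lra)). nra.
Qed.

(** Goursat's theorem with one exceptional point.  The bisection compares the
    integral with an additive set function: the area handles the points of
    differentiability, and the second term, the integral of
    [1 / (4 sqrt (|x - p1| |y - p2|))], makes every square around [p] count as much
    as its side. *)
Lemma goursat (f : C -> C) (p : C) (x1 x2 y1 y2 : R) : (forall z, ccont f z) ->
  x1 <= x2 -> y1 <= y2 ->
  (forall z : C, x1 <= fst z <= x2 -> y1 <= snd z <= y2 -> z <> p -> hol f z) ->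
  rectint f x1 x2 y1 y2 = RtoC 0.
Proof.
  intros Hf Hx Hy Hh.
  destruct (Rle_lt_or_eq_dec _ _ Hx) as [Lx|Ex].
  2: { subst x2. unfold rectint. rewrite !CInt_point. ring. }
  destruct (Rle_lt_or_eq_dec _ _ Hy) as [Ly|Ey].
  2: { subst y2. unfold rectint. rewrite !CInt_point. ring. }
  set (G := fun x => sgnsqrt (x - fst p)). set (H := fun y => sgnsqrt (y - snd p)).
  assert (MG : forall x x', x <= x' -> G x <= G x') by (intros; apply sgnsqrt_mono; lra).
  assert (MH : forall x x', x <= x' -> H x <= H x') by (intros; apply sgnsqrt_mono; lra).
  set (mu := fun a b c d => (b - a) * (d - c) + (G b - G a) * (H d - H c)).
  set (lx := x2 - x1). set (ly := y2 - y1). set (L := lx + ly).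
  assert (Plx : 0 < lx) by (unfold lx; lra). assert (Ply : 0 < ly) by (unfold ly; lra).
  assert (PL : 0 < L) by (unfold L; lra).
  assert (Main : forall eta, 0 < eta -> Cmod (rectint f x1 x2 y1 y2) <= eta * mu x1 x2 y1 y2).
  { intros eta He.
    apply (rectangle_bisection (fun a b c d => Cmod (rectint f a b c d) <= eta * mu a b c d)); auto.
    - intros a b c d Hab Hcd H1 H2 H3 H4.
      rewrite (rectint_split f a ((a + b) / 2) b c ((c + d) / 2) d Hf).
      pose proof (Cmod_triangle
        (rectint f a ((a + b) / 2) c ((c + d) / 2) + rectint f ((a + b) / 2) b c ((c + d) / 2))%C
        (rectint f a ((a + b) / 2) ((c + d) / 2) d + rectint f ((a + b) / 2) b ((c + d) / 2) d)%C).
      pose proof (Cmod_triangle (rectint f a ((a + b) / 2) c ((c + d) / 2)) (rectint f ((a + b) / 2) b c ((c + d) / 2))).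
      pose proof (Cmod_triangle (rectint f a ((a + b) / 2) ((c + d) / 2) d) (rectint f ((a + b) / 2) b ((c + d) / 2) d)).
      assert (E : mu a b c d = mu a ((a + b) / 2) c ((c + d) / 2) + mu ((a + b) / 2) b c ((c + d) / 2)
         + (mu a ((a + b) / 2) ((c + d) / 2) d + mu ((a + b) / 2) b ((c + d) / 2) d)).
      { unfold mu. generalize (G ((a + b) / 2)) (H ((c + d) / 2)). intros. field. }
      rewrite E. lra.
    - intros x y Bx By.
      assert (Near : forall (a b c d t del : R) (z : C), a <= x <= b -> c <= y <= d ->
         0 < t < del / L -> b - a = t * (x2 - x1) -> d - c = t * (y2 - y1) ->
         a <= fst z <= b -> c <= snd z <= d ->
         Cmod (z - (x, y)) <= t * L /\ t * L < del).
      { intros a b c d t del z Ha Hc [Ht Ht'] Eab Ecd Hz1 Hz2.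
        fold lx in Eab. fold ly in Ecd.
        split.
        - eapply Rle_trans; [apply Cmod_le_Re_Im|]. simpl.
          assert (Rabs (fst z + - x) <= t * lx) by (apply Rabs_le; lra).
          assert (Rabs (snd z + - y) <= t * ly) by (apply Rabs_le; lra).
          unfold L. lra.
        - apply (Rmult_lt_compat_r L) in Ht'; auto.
          replace (del / L * L) with del in Ht' by (field; lra). lra. }
      assert (Shape : forall a b c d t, a <= b -> c <= d -> b - a = t * (x2 - x1) -> d - c = t * (y2 - y1) ->
         (b - a) + (d - c) = t * L /\ (b - a) * (d - c) = t * t * (lx * ly)).
      { intros. fold lx in H2. fold ly in H3. unfold L. rewrite H2, H3. split; ring. }
      destruct (classic ((x, y) = p)) as [Ep|Np].
      + assert (Psq : 0 < sqrt lx * sqrt ly) by (apply Rmult_lt_0_compat; apply sqrt_lt_R0; auto).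
        set (eps := eta * (sqrt lx * sqrt ly) / (4 * L)).
        assert (Heps : 0 < eps) by (apply Rdiv_lt_0_compat; [apply Rmult_lt_0_compat|]; lra).
        destruct (Hf (x, y) eps Heps) as [del [Hdel Hd]].
        exists (del / L). split; [apply Rdiv_lt_0_compat; auto|].
        intros a b c d t Ha Hc _ _ _ _ Ht Eab Ecd.
        assert (Hr : Cmod (rectint f a b c d) <= 4 * eps * ((b - a) + (d - c))).
        { apply (rectint_near_affine f (f (x, y)) 0); auto; try lra.
          intros z Hz1 Hz2. destruct (Near a b c d t del z) as [N1 N2]; auto.
          replace (f z - (f (x, y) + 0 * z))%C with (f z - f (x, y))%C by ring.
          left. apply Hd. lra. }
        destruct (Shape a b c d t) as [S1 S2]; try lra. rewrite S1 in Hr.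
        replace (4 * eps * (t * L)) with (eta * (t * (sqrt lx * sqrt ly))) in Hr by (unfold eps; field; lra).
        eapply Rle_trans; [exact Hr|]. apply Rmult_le_compat_l; [lra|]. unfold mu.
        assert (JG : sqrt (b - a) <= G b - G a).
        { unfold G. rewrite <- Ep; simpl. replace (b - a) with ((b - x) - (a - x)) by ring.
          apply sgnsqrt_jump. lra. }
        assert (JH : sqrt (d - c) <= H d - H c).
        { unfold H. rewrite <- Ep; simpl. replace (d - c) with ((d - y) - (c - y)) by ring.
          apply sgnsqrt_jump. lra. }
        assert (Eq : t * (sqrt lx * sqrt ly) = sqrt (b - a) * sqrt (d - c)).
        { rewrite Eab, Ecd. fold lx ly. rewrite !sqrt_mult by lra.
          replace (t * (sqrt lx * sqrt ly)) with (sqrt t * sqrt t * (sqrt lx * sqrt ly)).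
          - ring.
          - rewrite sqrt_sqrt by lra. ring. }
        rewrite Eq. pose proof (sqrt_pos (b - a)). pose proof (sqrt_pos (d - c)).
        assert (0 <= (b - a) * (d - c)) by (apply Rmult_le_pos; lra).
        assert (sqrt (b - a) * sqrt (d - c) <= (G b - G a) * (H d - H c)).
        { apply Rmult_le_compat; auto. }
        lra.
      + destruct (Hh (x, y)) as [l Hl]; simpl; auto.
        set (eps := eta * (lx * ly) / (4 * (L * L))).
        assert (PLL : 0 < L * L) by nra.
        assert (Pxy : 0 < lx * ly) by nra.
        assert (Heps : 0 < eps) by (apply Rdiv_lt_0_compat; [apply Rmult_lt_0_compat|]; lra).
        destruct (Hl eps Heps) as [del [Hdel Hd]].
        exists (del / L). split; [apply Rdiv_lt_0_compat; auto|].
        intros a b c d t Ha Hc _ _ _ _ Ht Eab Ecd.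
        assert (Hr : Cmod (rectint f a b c d) <= 4 * (eps * (t * L)) * ((b - a) + (d - c))).
        { apply (rectint_near_affine f (f (x, y) - l * (x, y))%C l); auto; try lra.
          intros z Hz1 Hz2. destruct (Near a b c d t del z) as [N1 N2]; auto.
          replace (f z - (f (x, y) - l * (x, y) + l * z))%C
            with (f z - f (x, y) - l * (z - (x, y)))%C by ring.
          eapply Rle_trans; [apply Hd; lra|]. apply Rmult_le_compat_l; lra. }
        destruct (Shape a b c d t) as [S1 S2]; try lra. rewrite S1 in Hr.
        replace (4 * (eps * (t * L)) * (t * L)) with (eta * (t * t * (lx * ly))) in Hr
          by (unfold eps; field; lra).
        eapply Rle_trans; [exact Hr|]. apply Rmult_le_compat_l; [lra|]. unfold mu. rewrite S2.
        pose proof (MG a b ltac:(lra)). pose proof (MH c d ltac:(lra)).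
        assert (0 <= (G b - G a) * (H d - H c)) by (apply Rmult_le_pos; lra). lra. }
  apply Cmod_eq_0. apply Rle_antisym; [|apply Cmod_ge_0].
  apply Rnot_lt_le. intros Hpos.
  assert (Pmu : 0 < mu x1 x2 y1 y2).
  { unfold mu. pose proof (MG x1 x2 Hx). pose proof (MH y1 y2 Hy).
    assert (0 <= (G x2 - G x1) * (H y2 - H y1)) by (apply Rmult_le_pos; lra).
    assert (0 < lx * ly) by nra. unfold lx, ly in *. lra. }
  specialize (Main (Cmod (rectint f x1 x2 y1 y2) / (2 * mu x1 x2 y1 y2))).
  assert (Q : 0 < Cmod (rectint f x1 x2 y1 y2) / (2 * mu x1 x2 y1 y2)) by (apply Rdiv_lt_0_compat; lra).
  specialize (Main Q).
  replace (Cmod (rectint f x1 x2 y1 y2) / (2 * mu x1 x2 y1 y2) * mu x1 x2 y1 y2)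
    with (Cmod (rectint f x1 x2 y1 y2) / 2) in Main by (field; lra). lra.
Qed.

Lemma rectint_swap_x (f : C -> C) (a b c d : R) : (forall z, ccont f z) ->
  (rectint f b a c d = - rectint f a b c d)%C.
Proof.
  intros Hf. unfold rectint.
  rewrite !(CInt_swap _ a b) by (intros t _; apply pcont_hline; auto). ring.
Qed.

Lemma rectint_swap_y (f : C -> C) (a b c d : R) : (forall z, ccont f z) ->
  (rectint f a b d c = - rectint f a b c d)%C.
Proof.
  intros Hf. unfold rectint.
  rewrite !(CInt_swap _ c d) by (intros t _; apply pcont_vline; auto). ring.
Qed.

Definition square (z0 : C) (h : R) (z : C) : Prop :=
  Rabs (fst z - fst z0) < h /\ Rabs (snd z - snd z0) < h.

Lemma goursat_square (f : C -> C) (z0 p : C) (h a b c d : R) : (forall z, ccont f z) ->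
  (forall z, square z0 h z -> z <> p -> hol f z) ->
  square z0 h (a, c) -> square z0 h (b, d) -> rectint f a b c d = RtoC 0.
Proof.
  intros Hf Hh [H1 H2] [H3 H4]. simpl in *.
  apply Rabs_def2 in H1. apply Rabs_def2 in H2. apply Rabs_def2 in H3. apply Rabs_def2 in H4.
  assert (Q : forall a b c d, a <= b -> c <= d -> - h < a - fst z0 -> b - fst z0 < h ->
     - h < c - snd z0 -> d - snd z0 < h -> rectint f a b c d = RtoC 0).
  { intros. apply (goursat f p); auto. intros z Hz1 Hz2 Hz. apply Hh; auto.
    split; apply Rabs_def1; lra. }
  destruct (Rle_dec a b), (Rle_dec c d).
  - apply Q; lra.
  - rewrite rectint_swap_y by auto. rewrite Q by lra. ring.
  - rewrite rectint_swap_x by auto. rewrite Q by lra. ring.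
  - rewrite rectint_swap_x, rectint_swap_y by auto. rewrite Q by lra. ring.
Qed.

Lemma square_open (z0 : C) (h : R) (z : C) : square z0 h z ->
  exists del, 0 < del /\ forall w, Cmod (w - z) < del -> square z0 h w.
Proof.
  intros [H1 H2].
  exists (Rmin (h - Rabs (fst z - fst z0)) (h - Rabs (snd z - snd z0))).
  split; [apply Rmin_pos; lra|]. intros w Hw.
  pose proof (Rmin_l (h - Rabs (fst z - fst z0)) (h - Rabs (snd z - snd z0))).
  pose proof (Rmin_r (h - Rabs (fst z - fst z0)) (h - Rabs (snd z - snd z0))).
  pose proof (Re_le_Cmod (w - z)%C) as A. pose proof (Im_le_Cmod (w - z)%C) as B. simpl in A, B.
  split.
  - replace (fst w - fst z0) with ((fst w + - fst z) + (fst z - fst z0)) by ring.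
    eapply Rle_lt_trans; [apply Rabs_triang|]. lra.
  - replace (snd w - snd z0) with ((snd w + - snd z) + (snd z - snd z0)) by ring.
    eapply Rle_lt_trans; [apply Rabs_triang|]. lra.
Qed.

Lemma primitive_on_square (f : C -> C) (z0 p : C) (h : R) : (forall z, ccont f z) ->
  (forall z, square z0 h z -> z <> p -> hol f z) ->
  exists F, forall z, square z0 h z -> cder F z (f z).
Proof.
  intros Hf Hh.
  set (F := fun z : C => (CInt (fun t => f (t, snd z0)) (fst z0) (fst z) +
                          Ci * CInt (fun t => f (fst z, t)) (snd z0) (snd z))%C).
  exists F. intros z Hz e He.
  destruct (Hf z (e / 4)) as [d1 [Hd1 H1]]; [lra|].
  destruct (square_open z0 h z Hz) as [d2 [Hd2 H2]].
  use_min (d1 / 2) d2. intros w Hw.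
  specialize (H2 w ltac:(lra)).
  assert (Hh0 : 0 < h) by (destruct Hz as [Hz _]; pose proof (Rabs_pos (fst z - fst z0)); lra).
  (* the rectangle between the two paths to [w] has zero integral *)
  assert (E0 : rectint f (fst z) (fst w) (snd z0) (snd z) = RtoC 0).
  { apply (goursat_square f z0 p h); auto; split; simpl; try apply Hz; try apply H2.
    rewrite Rminus_diag_eq by auto. rewrite Rabs_R0. auto. }
  assert (E : (F w - F z - f z * (w - z) =
     CInt (fun t => f (t, snd z) + - f z)%C (fst z) (fst w) +
     Ci * CInt (fun t => f (fst w, t) + - f z)%C (snd z) (snd w))%C).
  { assert (CC : forall (q : C) u v, pcont_on (fun _ => q) u v).
    { intros q u v t _ ee Hee. exists 1. split; [lra|]. intros. rewrite Cmod_sub_self. auto. }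
    rewrite !CInt_plus; auto; try (intros t _; first [apply pcont_hline|apply pcont_vline]; auto).
    rewrite !CInt_const.
    assert (C1 := CInt_Chasles (fun t => f (t, snd z0)) (fst z0) (fst z) (fst w)
      (fun t _ => pcont_hline f _ t Hf) (fun t _ => pcont_hline f _ t Hf)).
    assert (C2 := CInt_Chasles (fun t => f (fst w, t)) (snd z0) (snd z) (snd w)
      (fun t _ => pcont_vline f _ t Hf) (fun t _ => pcont_vline f _ t Hf)).
    unfold F. rewrite <- C1, <- C2. unfold rectint in E0.
    assert (Ew : (w - z = RtoC (fst w - fst z) + Ci * RtoC (snd w - snd z))%C).
    { destruct w, z; apply injective_projections; simpl; ring. }
    rewrite Ew.
    match goal with |- ?l = ?r => replace l with (r + (l - r))%C by ring end.
    match type of E0 with ?l = _ =>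
      match goal with |- (?r + ?d)%C = _ => replace d with l by ring end end.
    rewrite E0. ring. }
  rewrite E.
  pose proof (Re_le_Cmod (w - z)%C) as Rz. pose proof (Im_le_Cmod (w - z)%C) as Iz. simpl in Rz, Iz.
  assert (B : forall s, Rmin (fst z) (fst w) <= s <= Rmax (fst z) (fst w) -> Rabs (s - fst z) <= Rabs (fst w + - fst z)).
  { intros s. unfold Rmin, Rmax. destruct Rle_dec; intros; unfold Rabs; repeat destruct Rcase_abs; lra. }
  assert (B' : forall s, Rmin (snd z) (snd w) <= s <= Rmax (snd z) (snd w) -> Rabs (s - snd z) <= Rabs (snd w + - snd z)).
  { intros s. unfold Rmin, Rmax. destruct Rle_dec; intros; unfold Rabs; repeat destruct Rcase_abs; lra. }
  assert (Hc : forall z', ccont (fun v => f v + - f z)%C z').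
  { intros z'. apply ccont_plus; auto. apply ccont_const. }
  assert (M1 : Cmod (CInt (fun t => f (t, snd z) + - f z)%C (fst z) (fst w)) <= 2 * (e / 4) * Rabs (fst w - fst z)).
  { apply Cmod_CInt_le_abs; [intros t _; apply (pcont_hline (fun v => f v + - f z)%C); auto|].
    intros t Ht. left. apply H1. eapply Rle_lt_trans; [apply Cmod_le_Re_Im|]. simpl.
    specialize (B t Ht). replace (snd z + - snd z) with 0 by ring. rewrite Rabs_R0.
    unfold Rminus in B. lra. }
  assert (M2 : Cmod (CInt (fun t => f (fst w, t) + - f z)%C (snd z) (snd w)) <= 2 * (e / 4) * Rabs (snd w - snd z)).
  { apply Cmod_CInt_le_abs; [intros t _; apply (pcont_vline (fun v => f v + - f z)%C); auto|].
    intros t Ht. left. apply H1. eapply Rle_lt_trans; [apply Cmod_le_Re_Im|]. simpl.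
    specialize (B' t Ht). unfold Rminus in B'. lra. }
  eapply Rle_trans; [apply Cmod_triangle|]. rewrite Cmod_mult, Cmod_Ci.
  unfold Rminus in M1, M2.
  apply (Rmult_le_compat_l e) in Rz; [|lra]. apply (Rmult_le_compat_l e) in Iz; [|lra]. lra.
Qed.

(** * Cauchy's formula, regularity and removable singularities *)

(** Composition with [clamp] extends a function continuous on a closed square to the whole
    plane, where integrals along segments need no condition on the domain. *)
Definition clamp (z0 : C) (h : R) (z : C) : C :=
  (Rmax (fst z0 - h) (Rmin (fst z0 + h) (fst z)), Rmax (snd z0 - h) (Rmin (snd z0 + h) (snd z))).

Lemma clamp_ccont (z0 : C) (h : R) (z : C) : ccont (clamp z0 h) z.
Proof.
  intros e He. exists (e / 2). split; [lra|]. intros w Hw.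
  assert (L : forall c x y, Rabs (Rmax (c - h) (Rmin (c + h) x) - Rmax (c - h) (Rmin (c + h) y)) <= Rabs (x - y)).
  { intros c x y. unfold Rmax, Rmin. repeat destruct Rle_dec; unfold Rabs; repeat destruct Rcase_abs; lra. }
  pose proof (Re_le_Cmod (w - z)%C) as A. pose proof (Im_le_Cmod (w - z)%C) as B. simpl in A, B.
  apply Cmod_lt_box; unfold clamp; simpl; (eapply Rle_lt_trans; [apply L|]); unfold Rminus in *; lra.
Qed.

Lemma clamp_square (z0 : C) (h : R) (z : C) : square z0 h z -> clamp z0 h z = z.
Proof.
  intros [H1 H2]. apply Rabs_def2 in H1. apply Rabs_def2 in H2.
  unfold clamp. destruct z as [x y]; simpl in *.
  rewrite !Rmin_right, !Rmax_right by lra. reflexivity.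
Qed.

Lemma clamp_near (z0 : C) (h : R) (z : C) : 0 < h -> Cmod (clamp z0 h z - z0) <= 2 * h.
Proof.
  intros Hh. eapply Rle_trans; [apply Cmod_le_Re_Im|]. unfold clamp; simpl.
  assert (L : forall c x, Rabs (Rmax (c - h) (Rmin (c + h) x) + - c) <= h).
  { intros c x. unfold Rmax, Rmin. repeat destruct Rle_dec; unfold Rabs; destruct Rcase_abs; lra. }
  pose proof (L (fst z0) (fst z)). pose proof (L (snd z0) (snd z)). lra.
Qed.

Lemma square_of_disc (z0 : C) (h : R) (z : C) : Cmod (z - z0) < h -> square z0 h z.
Proof.
  intros H. pose proof (Re_le_Cmod (z - z0)%C). pose proof (Im_le_Cmod (z - z0)%C).
  simpl in *. split; unfold Rminus; lra.
Qed.

Lemma local_primitive (f : C -> C) (z0 p : C) (r : R) : 0 < r ->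
  (forall z, Cmod (z - z0) < r -> ccont f z) ->
  (forall z, Cmod (z - z0) < r -> z <> p -> hol f z) ->
  exists F, forall z, Cmod (z - z0) < r / 3 -> cder F z (f z).
Proof.
  intros Hr Hc Hh. set (h := r / 3).
  set (g := fun z => f (clamp z0 h z)).
  assert (Hg : forall z, square z0 h z -> g z = f z) by (intros z Hz; unfold g; rewrite clamp_square; auto).
  assert (In : forall z, square z0 h z -> Cmod (z - z0) < r).
  { intros z Hz. rewrite <- (clamp_square z0 h z Hz).
    eapply Rle_lt_trans; [apply clamp_near; unfold h; lra|]. unfold h; lra. }
  destruct (primitive_on_square g z0 p h) as [F HF].
  - intros z. apply (ccont_comp f (clamp z0 h)); [apply clamp_ccont|].
    apply Hc. eapply Rle_lt_trans; [apply clamp_near; unfold h; lra|]. unfold h; lra.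
  - intros z Hz Np. destruct (Hh z (In z Hz) Np) as [l Hl]. exists l.
    destruct (square_open z0 h z Hz) as [d [Hd H]].
    apply (cder_ext_loc f g z l d); auto. intros w Hw. symmetry. auto.
  - exists F. intros z Hz. assert (Hs := square_of_disc z0 h z Hz).
    rewrite <- (Hg z Hs). apply HF. exact Hs.
Qed.

Definition pder (g : R -> C) (t : R) (v : C) : Prop :=
  forall eps, 0 < eps -> exists del, 0 < del /\ forall s, Rabs (s - t) < del ->
    Cmod (g s - g t - RtoC (s - t) * v) <= eps * Rabs (s - t).

Lemma pder_component (g : R -> C) (pr : C -> R) (t : R) (v : C) :
  (forall z w k, pr (z - w - RtoC k * v)%C = pr z - pr w - k * pr v) ->
  (forall z, Rabs (pr z) <= Cmod z) ->
  pder g t v -> is_derive (fun s => pr (g s)) t (pr v).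
Proof.
  intros Hl Hb H. apply is_derive_Reals. intros e He.
  destruct (H (e / 2)) as [d [Hd H']]; [lra|]. exists (mkposreal d Hd). intros h Hh Hhd. simpl in Hhd.
  specialize (H' (t + h)). replace (t + h - t) with h in H' by ring. specialize (H' Hhd).
  pose proof (Hb (g (t + h)%R - g t - RtoC h * v)%C) as B. rewrite Hl in B.
  replace ((pr (g (t + h)) - pr (g t)) / h - pr v) with ((pr (g (t + h)) - pr (g t) - h * pr v) / h) by (field; auto).
  assert (0 < Rabs h) by (apply Rabs_pos_lt; auto).
  unfold Rdiv. rewrite Rabs_mult, Rabs_inv.
  apply (Rmult_lt_reg_r (Rabs h)); auto. rewrite Rmult_assoc, Rinv_l by lra. nra.
Qed.

Lemma pder_fst (g : R -> C) (t : R) (v : C) : pder g t v -> is_derive (fun s => fst (g s)) t (fst v).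
Proof.
  apply (pder_component g fst); [|apply Re_le_Cmod]. intros. simpl. ring.
Qed.

Lemma pder_snd (g : R -> C) (t : R) (v : C) : pder g t v -> is_derive (fun s => snd (g s)) t (snd v).
Proof.
  apply (pder_component g snd); [|apply Im_le_Cmod]. intros. simpl. ring.
Qed.

Lemma is_derive_eps (u : R -> R) (t v : R) : is_derive u t v ->
  forall eps, 0 < eps -> exists del, 0 < del /\ forall s, Rabs (s - t) < del ->
    Rabs (u s - u t - (s - t) * v) <= eps * Rabs (s - t).
Proof.
  intros H e He. apply is_derive_Reals in H. destruct (H e He) as [[d Hd] H']. simpl in H'.
  exists d. split; auto. intros s Hs. destruct (Req_dec s t) as [->|N].
  - replace (u t - u t - (t - t) * v) with 0 by ring. rewrite Rminus_diag, Rabs_R0. lra.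
  - specialize (H' (s - t) ltac:(lra) Hs). replace (t + (s - t)) with s in H' by ring.
    replace (u s - u t - (s - t) * v) with (((u s - u t) / (s - t) - v) * (s - t)) by (field; lra).
    rewrite Rabs_mult. apply Rmult_le_compat_r; [apply Rabs_pos|lra].
Qed.

Lemma pder_intro (g : R -> C) (t : R) (v : C) :
  is_derive (fun s => fst (g s)) t (fst v) -> is_derive (fun s => snd (g s)) t (snd v) -> pder g t v.
Proof.
  intros H1 H2 e He.
  destruct (is_derive_eps _ _ _ H1 (e / 2)) as [d1 [D1 H1']]; [lra|].
  destruct (is_derive_eps _ _ _ H2 (e / 2)) as [d2 [D2 H2']]; [lra|].
  use_min d1 d2. intros s Hs.
  specialize (H1' s ltac:(lra)). specialize (H2' s ltac:(lra)).
  eapply Rle_trans; [apply Cmod_le_Re_Im|]. simpl.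
  replace (fst (g s) + - fst (g t) + - ((s - t) * fst v - 0 * snd v))
    with (fst (g s) - fst (g t) - (s - t) * fst v) by ring.
  replace (snd (g s) + - snd (g t) + - ((s - t) * snd v + 0 * fst v))
    with (snd (g s) - snd (g t) - (s - t) * snd v) by ring.
  lra.
Qed.

Lemma pder_pcont (g : R -> C) (t : R) (v : C) : pder g t v -> pcont g t.
Proof.
  intros H. apply pcont_intro.
  - apply (ex_derive_continuous (fun s => fst (g s))). eexists. apply pder_fst; eauto.
  - apply (ex_derive_continuous (fun s => snd (g s))). eexists. apply pder_snd; eauto.
Qed.

Lemma pder_comp (F : C -> C) (g : R -> C) (t : R) (l v : C) :
  cder F (g t) l -> pder g t v -> pder (fun s => F (g s)) t (l * v)%C.
Proof.
  intros HF Hg e He. pose proof (pder_pcont g t v Hg) as Cg.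
  pose proof (Cmod_ge_0 l) as Pl. pose proof (Cmod_ge_0 v) as Pv.
  set (e1 := Rmin 1 (e / 2 / (Cmod l + 1))).
  assert (He1 : 0 < e1) by (apply Rmin_pos; [lra|apply Rdiv_lt_0_compat; lra]).
  assert (E1 : e1 * Cmod l <= e / 2).
  { assert (e1 <= e / 2 / (Cmod l + 1)) by apply Rmin_r.
    apply (Rmult_le_compat_r (Cmod l + 1)) in H; [|lra].
    replace (e / 2 / (Cmod l + 1) * (Cmod l + 1)) with (e / 2) in H by (field; lra). nra. }
  assert (E2 : e1 <= 1) by apply Rmin_l.
  destruct (HF (e / 2 / (Cmod v + 1))) as [d0 [D0 H0]]; [apply Rdiv_lt_0_compat; lra|].
  destruct (Cg d0 D0) as [d1 [D1 H1]].
  destruct (Hg e1 He1) as [d2 [D2 H2]].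
  use_min d1 d2. intros s Hs.
  specialize (H2 s ltac:(lra)). specialize (H0 (g s) (H1 s ltac:(lra))).
  pose proof (Rabs_pos (s - t)) as Ps.
  assert (G : Cmod (g s - g t) <= (Cmod v + 1) * Rabs (s - t)).
  { replace (g s - g t)%C with ((g s - g t - RtoC (s - t) * v) + RtoC (s - t) * v)%C by ring.
    eapply Rle_trans; [apply Cmod_triangle|]. rewrite Cmod_mult, Cmod_R. nra. }
  replace (F (g s) - F (g t) - RtoC (s - t) * (l * v))%C
    with ((F (g s) - F (g t) - l * (g s - g t)) + l * (g s - g t - RtoC (s - t) * v))%C by ring.
  eapply Rle_trans; [apply Cmod_triangle|]. rewrite Cmod_mult.
  assert (T1 : e / 2 / (Cmod v + 1) * Cmod (g s - g t) <= e / 2 * Rabs (s - t)).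
  { replace (e / 2 * Rabs (s - t)) with (e / 2 / (Cmod v + 1) * ((Cmod v + 1) * Rabs (s - t))) by (field; lra).
    apply Rmult_le_compat_l; auto. left. apply Rdiv_lt_0_compat; lra. }
  assert (T2 : Cmod l * Cmod (g s - g t - RtoC (s - t) * v) <= e / 2 * Rabs (s - t)).
  { eapply Rle_trans; [apply Rmult_le_compat_l; [auto|apply H2]|].
    rewrite <- Rmult_assoc. apply Rmult_le_compat_r; auto. lra. }
  lra.
Qed.

Definition circ (z0 : C) (r t : R) : C := (z0 + ((r * cos t)%R, (r * sin t)%R))%C.

Definition circint (f : C -> C) (z0 : C) (r : R) : C :=
  CInt (fun t => f (circ z0 r t) * (Ci * (circ z0 r t - z0)))%C 0 (2 * PI).

Lemma Cmod_circ (z0 : C) (r t : R) : 0 <= r -> Cmod (circ z0 r t - z0) = r.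
Proof.
  intros Hr. assert (E : (circ z0 r t - z0)%C = (r * cos t, r * sin t)).
  { apply injective_projections; unfold circ; simpl; ring. }
  rewrite E.
  unfold Cmod; simpl. replace (r * cos t * (r * cos t * 1) + r * sin t * (r * sin t * 1))
    with (r * r * (Rsqr (sin t) + Rsqr (cos t))) by (unfold Rsqr; ring).
  rewrite sin2_cos2, Rmult_1_r. apply sqrt_square; auto.
Qed.

Lemma circ_pder (z0 : C) (r t : R) : pder (circ z0 r) t (Ci * (circ z0 r t - z0))%C.
Proof.
  apply pder_intro; unfold circ; simpl; auto_derive; auto; ring.
Qed.

Definition ccont_circle (f : C -> C) (z0 : C) (r : R) : Prop :=
  forall z, Cmod (z - z0) = r -> ccont f z.

Lemma circint_pcont (f : C -> C) (z0 : C) (r a b : R) : 0 <= r -> ccont_circle f z0 r ->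
  pcont_on (fun t => f (circ z0 r t) * (Ci * (circ z0 r t - z0)))%C a b.
Proof.
  intros Hr Hf t _. apply (pcont_comp (fun z => f z * (Ci * (z - z0)))%C (circ z0 r)).
  - apply ccont_mult.
    + apply Hf. apply Cmod_circ; auto.
    + apply ccont_mult; [apply ccont_const|]. apply ccont_minus; [apply ccont_id|apply ccont_const].
  - eapply pder_pcont. apply circ_pder.
Qed.

Lemma circint_ext (f g : C -> C) (z0 : C) (r : R) : 0 <= r ->
  (forall z, Cmod (z - z0) = r -> f z = g z) -> circint f z0 r = circint g z0 r.
Proof.
  intros Hr H. apply CInt_ext. intros t _. rewrite H; auto. apply Cmod_circ; auto.
Qed.

Lemma circint_plus (f g : C -> C) (z0 : C) (r : R) : 0 <= r ->
  ccont_circle f z0 r -> ccont_circle g z0 r ->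
  (circint (fun z => f z + g z) z0 r = circint f z0 r + circint g z0 r)%C.
Proof.
  intros Hr Hf Hg. unfold circint. rewrite <- CInt_plus; try (apply circint_pcont; auto).
  apply CInt_ext. intros; ring.
Qed.

Lemma circint_Cmult (f : C -> C) (k z0 : C) (r : R) : 0 <= r -> ccont_circle f z0 r ->
  (circint (fun z => k * f z) z0 r = k * circint f z0 r)%C.
Proof.
  intros Hr Hf. unfold circint. rewrite <- CInt_Cmult; try (apply circint_pcont; auto).
  apply CInt_ext. intros; ring.
Qed.

Lemma circint_bound (f : C -> C) (z0 : C) (r M : R) : 0 <= r -> ccont_circle f z0 r ->
  (forall z, Cmod (z - z0) = r -> Cmod (f z) <= M) ->
  Cmod (circint f z0 r) <= 4 * PI * r * M.
Proof.
  intros Hr Hf HM. pose proof PI_RGT_0.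
  replace (4 * PI * r * M) with (2 * (M * r) * (2 * PI - 0)) by ring.
  apply Cmod_CInt_le; [lra|apply circint_pcont; auto|].
  intros t _. rewrite !Cmod_mult, Cmod_Ci, Cmod_circ, Rmult_1_l by auto.
  apply Rmult_le_compat_r; auto. apply HM. apply Cmod_circ; auto.
Qed.

Lemma circint_primitive (F f : C -> C) (z0 : C) (r : R) : 0 <= r -> ccont_circle f z0 r ->
  (forall z, Cmod (z - z0) = r -> cder F z (f z)) -> circint f z0 r = RtoC 0.
Proof.
  intros Hr Hf HF.
  assert (D : forall t, pder (fun s => F (circ z0 r s)) t (f (circ z0 r t) * (Ci * (circ z0 r t - z0)))%C).
  { intros t. apply pder_comp; [|apply circ_pder]. apply HF, Cmod_circ; auto. }
  assert (Per : circ z0 r (2 * PI) = circ z0 r 0).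
  { unfold circ. rewrite cos_2PI, sin_2PI, cos_0, sin_0. reflexivity. }
  assert (Cn := circint_pcont f z0 r 0 (2 * PI) Hr Hf).
  apply injective_projections.
  - etransitivity; [exact (is_RInt_unique (V := R_CompleteNormedModule) _ _ _ _
      (is_RInt_derive (V := R_CompleteNormedModule) (fun s => fst (F (circ z0 r s))) _ 0 (2 * PI)
        (fun t _ => pder_fst _ _ _ (D t)) (fun t Ht => pcont_fst _ t (Cn t Ht))))|].
    simpl. rewrite Per. apply Rminus_diag.
  - etransitivity; [exact (is_RInt_unique (V := R_CompleteNormedModule) _ _ _ _
      (is_RInt_derive (V := R_CompleteNormedModule) (fun s => snd (F (circ z0 r s))) _ 0 (2 * PI)
        (fun t _ => pder_snd _ _ _ (D t)) (fun t Ht => pcont_snd _ t (Cn t Ht))))|].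
    simpl. rewrite Per. apply Rminus_diag.
Qed.

Lemma circint_center (z0 : C) (r : R) : 0 < r ->
  circint (fun z => / (z - z0))%C z0 r = (RtoC (2 * PI) * Ci)%C.
Proof.
  intros Hr. unfold circint. rewrite (CInt_ext _ (fun _ => Ci)).
  - rewrite CInt_const. f_equal. f_equal. ring.
  - intros t _. field. apply Cmod_gt_0. rewrite Cmod_circ; lra.
Qed.

(** Differentiation under the integral sign, from a second order bound. *)
Lemma circint_cder (K : C -> C -> C) (K' : C -> C) (z0 z : C) (r A del : R) :
  0 <= r -> 0 < del -> 0 <= A -> ccont_circle K' z0 r ->
  (forall w, Cmod (w - z) < del -> ccont_circle (K w) z0 r) ->
  (forall w, Cmod (w - z) < del -> forall x, Cmod (x - z0) = r ->
     Cmod (K w x - K z x - K' x * (w - z)) <= A * (Cmod (w - z) * Cmod (w - z))) ->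
  cder (fun w => circint (K w) z0 r) z (circint K' z0 r).
Proof.
  intros Hr Hdel HA HK' HK HB e He. pose proof PI_RGT_0 as HPI.
  set (B := 4 * PI * r * A).
  assert (PB : 0 <= B) by (unfold B; apply Rmult_le_pos; [apply Rmult_le_pos; lra|lra]).
  exists (Rmin del (e / (B + 1))).
  split; [apply Rmin_pos; auto; apply Rdiv_lt_0_compat; lra|]. intros w Hw.
  pose proof (Rmin_l del (e / (B + 1))). pose proof (Rmin_r del (e / (B + 1))).
  assert (Hz : Cmod (z - z) < del) by (rewrite Cmod_sub_self; auto).
  assert (HKw := HK w ltac:(lra)). assert (HKz := HK z Hz).
  assert (E : (circint (K w) z0 r - circint (K z) z0 r - circint K' z0 r * (w - z) =
     circint (fun x => (K w x + (-(1)) * K z x) + (-(w - z)) * K' x) z0 r)%C).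
  { rewrite (circint_plus (fun x => K w x + (-(1)) * K z x)%C (fun x => (-(w - z)) * K' x)%C); auto.
    - rewrite (circint_plus (K w) (fun x => (-(1)) * K z x)%C); auto.
      + rewrite !circint_Cmult; auto. ring.
      + intros x Hx. apply ccont_mult; auto. apply ccont_const.
    - intros x Hx. apply ccont_plus; auto. apply ccont_mult; auto. apply ccont_const.
    - intros x Hx. apply ccont_mult; auto. apply ccont_const. }
  rewrite E. eapply Rle_trans; [apply (circint_bound _ z0 r (A * (Cmod (w - z) * Cmod (w - z)))); auto|].
  - intros x Hx. apply ccont_plus; [apply ccont_plus; auto|]; apply ccont_mult; auto; apply ccont_const.
  - intros x Hx. replace (K w x + - (1) * K z x + - (w - z) * K' x)%C
      with (K w x - K z x - K' x * (w - z))%C by ring. apply HB; auto. lra.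
  - replace (4 * PI * r * (A * (Cmod (w - z) * Cmod (w - z)))) with ((B * Cmod (w - z)) * Cmod (w - z)) by (unfold B; ring).
    apply Rmult_le_compat_r; [apply Cmod_ge_0|].
    assert (Q : Cmod (w - z) <= e / (B + 1)) by lra.
    apply (Rmult_le_compat_r (B + 1)) in Q; [|lra].
    replace (e / (B + 1) * (B + 1)) with e in Q by (field; lra). pose proof (Cmod_ge_0 (w - z)%C). nra.
Qed.

Lemma circle_not_inside (z0 z x : C) (r : R) :
  Cmod (z - z0) < r -> Cmod (x - z0) = r -> r - Cmod (z - z0) <= Cmod (x - z).
Proof.
  intros Hz Hx. pose proof (Cmod_sub_triangle x z z0). lra.
Qed.


Lemma ccont_Cauchy_kernel (z x : C) : x <> z -> ccont (fun y => / (y - z))%C x.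
Proof.
  intros N. apply ccont_inv; [apply ccont_minus; [apply ccont_id|apply ccont_const]|].
  apply Cmod_gt_0, Cmod_sub_pos, N.
Qed.

Lemma rcont_Cmod (f : C -> C) (z : C) : ccont f z -> rcont (fun w => Cmod (f w)) z.
Proof.
  intros H e He. destruct (H e He) as [d [Hd H']]. exists d. split; auto.
  intros w Hw. specialize (H' w Hw).
  pose proof (Cmod_le_add (f w) (f z)). pose proof (Cmod_le_add (f z) (f w)) as T.
  rewrite (Cmod_sub_sym (f z)) in T. apply Rabs_def1; lra.
Qed.

Lemma max_on_circle (f : C -> C) (z0 : C) (r : R) : 0 <= r -> ccont_circle f z0 r ->
  exists z, Cmod (z - z0) = r /\ forall w, Cmod (w - z0) = r -> Cmod (f w) <= Cmod (f z).
Proof.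
  intros Hr Hf.
  apply (max_attained (fun w => Cmod (f w)) (fun z => Cmod (z - z0) = r) (r + Cmod z0)).
  - exists (circ z0 r 0). apply Cmod_circ; auto.
  - intros z Hz. pose proof (Cmod_le_add z z0). lra.
  - intros z Hz. exists (Rabs (Cmod (z - z0) - r)). split; [apply Rabs_pos_lt; lra|].
    intros w Hw E. pose proof (Cmod_sub_triangle w z z0). pose proof (Cmod_sub_triangle z w z0).
    rewrite (Cmod_sub_sym z w) in H0. revert Hw. unfold Rabs; destruct Rcase_abs; lra.
  - intros z Hz. apply rcont_Cmod. auto.
Qed.

Lemma Cauchy_kernel_facts (z0 z w x : C) (r : R) :
  Cmod (z - z0) < r -> Cmod (x - z0) = r -> Cmod (w - z) < (r - Cmod (z - z0)) / 2 ->
  (/ (x - w) - / (x - z) = / (x - w) * / (x - z) * (w - z))%C /\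
  Cmod (/ (x - w)) <= 2 / (r - Cmod (z - z0)) /\
  Cmod (/ (x - z)) <= 2 / (r - Cmod (z - z0)).
Proof.
  intros Hz Hx Hw. set (s := r - Cmod (z - z0)) in *. assert (Hs : 0 < s) by (unfold s; lra).
  pose proof (circle_not_inside z0 z x r Hz Hx) as B1. fold s in B1.
  pose proof (Cmod_sub_triangle x w z) as B2.
  assert (N1 : (x - z <> 0)%C) by (apply Cmod_gt_0; lra).
  assert (N2 : (x - w <> 0)%C) by (apply Cmod_gt_0; lra).
  split; [field; auto|].
  rewrite !Cmod_inv by auto.
  replace (2 / s) with (/ (s / 2)) by (field; lra).
  split; apply Rinv_le_contravar; lra.
Qed.

(** The kernel [k] is a power of [u = 1 / (x - w)]; the hypothesis on [k] is a second
    order Taylor bound, in the form that [u - v = u v h] makes easy to verify. *)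
Lemma circint_kernel_cder (k k' f : C -> C) (z0 z : C) (r : R) : 0 < r ->
  ccont_circle f z0 r -> Cmod (z - z0) < r -> (forall u, ccont k u) -> (forall u, ccont k' u) ->
  (forall b, 0 < b -> exists B, 0 <= B /\ forall u v h, (u - v = u * v * h)%C -> Cmod u <= b ->
     Cmod v <= b -> Cmod (k u - k v - k' v * h) <= B * (Cmod h * Cmod h)) ->
  cder (fun w => circint (fun x => f x * k (/ (x - w)))%C z0 r) z
    (circint (fun x => f x * k' (/ (x - z)))%C z0 r).
Proof.
  intros Hr Hf Hz Hk Hk' HB.
  destruct (max_on_circle f z0 r ltac:(lra) Hf) as [xm [_ HM]].
  assert (PM := Cmod_ge_0 (f xm)).
  set (s := r - Cmod (z - z0)). assert (Hs : 0 < s) by (unfold s; lra).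
  destruct (HB (2 / s)) as [B [PB HB']]; [apply Rdiv_lt_0_compat; lra|].
  assert (Hc : forall h : C -> C, (forall u, ccont h u) -> forall w, Cmod (w - z) < s / 2 ->
     ccont_circle (fun x => f x * h (/ (x - w)))%C z0 r).
  { intros h Hh w Hw x Hx. apply ccont_mult; auto.
    apply (ccont_comp h (fun x => / (x - w))%C); auto. apply ccont_Cauchy_kernel. intros ->.
    pose proof (Cmod_sub_triangle w z z0). unfold s in *. lra. }
  apply (circint_cder (fun w x => f x * k (/ (x - w)))%C _ z0 z r (Cmod (f xm) * B) (s / 2)); try lra.
  - apply Rmult_le_pos; lra.
  - apply Hc; auto. rewrite Cmod_sub_self. lra.
  - intros w Hw. apply Hc; auto.
  - intros w Hw x Hx.
    destruct (Cauchy_kernel_facts z0 z w x r Hz Hx Hw) as [E [B1 B2]].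
    specialize (HB' _ _ _ E B1 B2).
    match goal with |- Cmod ?e <= _ => replace e with
      (f x * (k (/ (x - w)) - k (/ (x - z)) - k' (/ (x - z)) * (w - z)))%C by ring end.
    rewrite Cmod_mult, Rmult_assoc. apply Rmult_le_compat; auto; apply Cmod_ge_0.
Qed.

Definition Cauchy_int (f : C -> C) (z0 : C) (r : R) (w : C) : C :=
  circint (fun x => f x * / (x - w))%C z0 r.

Definition Cauchy_int2 (f : C -> C) (z0 : C) (r : R) (w : C) : C :=
  circint (fun x => f x * (/ (x - w) * / (x - w)))%C z0 r.

Lemma Cauchy_int_cder (f : C -> C) (z0 z : C) (r : R) : 0 < r ->
  ccont_circle f z0 r -> Cmod (z - z0) < r ->
  cder (Cauchy_int f z0 r) z (Cauchy_int2 f z0 r z).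
Proof.
  intros Hr Hf Hz. apply (circint_kernel_cder (fun u => u) (fun u => u * u)%C); auto.
  - intros u. apply ccont_id.
  - intros u. apply ccont_mult; apply ccont_id.
  - intros b Hb. exists (b * (b * b)). split; [left; repeat apply Rmult_lt_0_compat; auto|].
    intros u v h E Bu Bv.
    replace (u - v - v * v * h)%C with (v * (u - v) * h)%C by
      (replace (u - v - v * v * h)%C with (u * v * h - v * v * h)%C by (rewrite <- E; ring); ring).
    rewrite E. replace (v * (u * v * h) * h)%C with (v * (u * v) * (h * h))%C by ring.
    rewrite !Cmod_mult. apply Rmult_le_compat_r; [apply Rmult_le_pos; apply Cmod_ge_0|].
    pose proof (Cmod_ge_0 u). pose proof (Cmod_ge_0 v).
    apply Rmult_le_compat; auto; [apply Rmult_le_pos; auto|]. apply Rmult_le_compat; auto.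
Qed.

Lemma Cauchy_int2_hol (f : C -> C) (z0 z : C) (r : R) : 0 < r ->
  ccont_circle f z0 r -> Cmod (z - z0) < r -> hol (Cauchy_int2 f z0 r) z.
Proof.
  intros Hr Hf Hz. eexists.
  apply (circint_kernel_cder (fun u => u * u)%C (fun u => 2 * (u * (u * u)))%C); auto.
  - intros u. apply ccont_mult; apply ccont_id.
  - intros u. repeat apply ccont_mult; apply ccont_id || apply ccont_const.
  - intros b Hb. exists (b * (b * b) * (3 * b)).
    split; [left; repeat apply Rmult_lt_0_compat; lra|]. intros u v h E Bu Bv.
    replace (u * u - v * v - 2 * (v * (v * v)) * h)%C
      with ((u - v) * (u + v) - 2 * (v * (v * v)) * h)%C by ring.
    rewrite E.
    replace (u * v * h * (u + v) - 2 * (v * (v * v)) * h)%C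
      with (v * (u - v) * (u + 2 * v) * h)%C by ring.
    rewrite E.
    replace (v * (u * v * h) * (u + 2 * v) * h)%C
      with (v * (u * v) * (u + 2 * v) * (h * h))%C by ring.
    rewrite !Cmod_mult. apply Rmult_le_compat_r; [apply Rmult_le_pos; apply Cmod_ge_0|].
    pose proof (Cmod_ge_0 u). pose proof (Cmod_ge_0 v).
    assert (B3 : Cmod (u + 2 * v) <= 3 * b).
    { eapply Rle_trans; [apply Cmod_triangle|]. rewrite Cmod_mult, Cmod_R, Rabs_right by lra. lra. }
    apply Rmult_le_compat; auto; [repeat apply Rmult_le_pos; auto|apply Cmod_ge_0|].
    apply Rmult_le_compat; auto; [apply Rmult_le_pos; auto|]. apply Rmult_le_compat; auto.
Qed.

Definition dC (f : C -> C) (z : C) : C := epsilon (inhabits (RtoC 0)) (cder f z).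

Lemma dC_cder (f : C -> C) (z : C) : hol f z -> cder f z (dC f z).
Proof. intros H. unfold dC. apply epsilon_spec. exact H. Qed.

Lemma dC_eq (f : C -> C) (z l : C) : cder f z l -> dC f z = l.
Proof. intros H. apply (cder_unique f z); auto. apply dC_cder. exists l. auto. Qed.

(** Cauchy's formula, up to the value of the winding integral: the difference
    quotient [(f x - f z) / (x - z)] has a primitive. *)
Lemma Cauchy_formula (f : C -> C) (z0 z : C) (r0 r : R) : 0 < r < r0 / 3 ->
  (forall w, Cmod (w - z0) < r0 -> hol f w) -> Cmod (z - z0) < r ->
  (Cauchy_int f z0 r z = f z * circint (fun x => / (x - z)) z0 r)%C.
Proof.
  intros Hr Hf Hz.
  assert (Hfz : hol f z) by (apply Hf; lra). destruct Hfz as [l Hl].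
  destruct (proj1 (cder_slope f z l) Hl) as [q [Cq [Eq Hq]]].
  assert (Qd : forall w, w <> z -> q w = ((f w - f z) * / (w - z))%C).
  { intros w N. rewrite Hq. field. apply Cmod_gt_0, Cmod_sub_pos, N. }
  assert (Hqh : forall w, Cmod (w - z0) < r0 -> w <> z -> hol q w).
  { intros w Hw N. destruct (Hf w Hw) as [m Hm].
    assert (P := Cmod_sub_pos w z N).
    eexists. apply (cder_ext_loc (fun v => (f v - f z) * / (v - z))%C q w _ (Cmod (w - z))); auto.
    - intros v Hv. symmetry. apply Qd. intros ->. rewrite (Cmod_sub_sym z w) in Hv. lra.
    - apply cder_mult; [apply cder_minus; [apply Hm|apply cder_const]|].
      apply (cder_inv (fun v => v - z)%C); [apply cder_minus; [apply cder_id|apply cder_const]|].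
      apply Cmod_gt_0. auto. }
  assert (Hqc : forall w, Cmod (w - z0) < r0 -> ccont q w).
  { intros w Hw. destruct (classic (w = z)) as [->|N]; auto. apply hol_ccont. auto. }
  destruct (local_primitive q z0 z r0) as [F HF]; auto; [lra|].
  assert (Z : circint q z0 r = RtoC 0).
  { apply (circint_primitive F); [lra|intros x Hx; apply Hqc; lra|]. intros x Hx. apply HF. lra. }
  assert (Nx : forall x, Cmod (x - z0) = r -> x <> z) by (intros x Hx ->; lra).
  assert (Cf : ccont_circle f z0 r) by (intros x Hx; apply hol_ccont, Hf; lra).
  assert (Ck : ccont_circle (fun x => / (x - z))%C z0 r).
  { intros x Hx. apply ccont_Cauchy_kernel. auto. }
  unfold Cauchy_int. rewrite (circint_ext q (fun x => f x * / (x - z) + (- f z) * / (x - z))%C) in Z.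
  - rewrite circint_plus, circint_Cmult in Z; auto; try lra.
    + match type of Z with (?a + - ?k * ?b)%C = _ => replace a with ((a + - k * b) + k * b)%C by ring end.
      rewrite Z. ring.
    + intros x Hx. apply ccont_mult; auto.
    + intros x Hx. apply ccont_mult; auto. apply ccont_const.
  - lra.
  - intros x Hx. rewrite Qd by auto. ring.
Qed.

Lemma Cauchy_int_1 (z0 w : C) (r : R) : 0 <= r ->
  Cauchy_int (fun _ => RtoC 1) z0 r w = circint (fun x => / (x - w))%C z0 r.
Proof. intros Hr. apply circint_ext; auto. intros; ring. Qed.

(** [f] is the quotient of the two integrals in Cauchy's formula, and
    both can be differentiated twice under the integral sign. *)
Theorem hol_derivative (f : C -> C) (z0 : C) (r0 : R) : 0 < r0 ->
  (forall w, Cmod (w - z0) < r0 -> hol f w) -> hol (dC f) z0.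
Proof.
  intros Hr0 Hf. set (r := r0 / 4). assert (Hr : 0 < r < r0 / 3) by (unfold r; lra).
  assert (Cf : ccont_circle f z0 r) by (intros x Hx; apply hol_ccont, Hf; unfold r in *; lra).
  assert (C1 : ccont_circle (fun _ => RtoC 1) z0 r) by (intros x Hx; apply ccont_const).
  pose (I := fun g => Cauchy_int g z0 r). pose (I' := fun g => Cauchy_int2 g z0 r).
  pose (one := fun _ : C => RtoC 1).
  assert (DI : forall g w, ccont_circle g z0 r -> Cmod (w - z0) < r -> cder (I g) w (I' g w)).
  { intros g w Hg Hw. exact (Cauchy_int_cder g z0 w r (proj1 Hr) Hg Hw). }
  assert (DI' : forall g w, ccont_circle g z0 r -> Cmod (w - z0) < r -> hol (I' g) w).
  { intros g w Hg Hw. exact (Cauchy_int2_hol g z0 w r (proj1 Hr) Hg Hw). }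
  assert (Hz0 : Cmod (z0 - z0) < r) by (rewrite Cmod_sub_self; lra).
  assert (Jz0 : I one z0 <> 0%C).
  { unfold I, one. rewrite Cauchy_int_1, circint_center by lra. apply Cmult_neq_0.
    - intros E. apply RtoC_inj in E. pose proof PI_RGT_0. lra.
    - intros E. apply (f_equal snd) in E. simpl in E. lra. }
  destruct (ccont_away (I one) z0) as [d [Hd HJ]]; auto.
  { eapply cder_ccont. apply DI; auto. }
  assert (HJ0 : forall w, Cmod (w - z0) < d -> I one w <> 0%C).
  { intros w Hw. apply Cmod_gt_0. pose proof (Cmod_ge_0 (I one z0)). specialize (HJ w Hw). lra. }
  set (dd := Rmin d r). assert (Hdd : 0 < dd) by (apply Rmin_pos; lra).
  assert (Ld : dd <= d) by apply Rmin_l. assert (Lr : dd <= r) by apply Rmin_r.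
  assert (Ef : forall w, Cmod (w - z0) < dd -> f w = (I f w * / I one w)%C).
  { intros w Hw. assert (E := Cauchy_formula f z0 w r0 r Hr Hf ltac:(lra)).
    assert (E1 : I one w = circint (fun x => / (x - w))%C z0 r).
    { unfold I, one. rewrite Cauchy_int_1; [reflexivity|apply Rlt_le, Hr]. }
    rewrite <- E1 in E. change (I f w = f w * I one w)%C in E. rewrite E.
    assert (N := HJ0 w ltac:(lra)). revert N. generalize (I one w). intros j N. field. exact N. }
  set (D := fun w => (I' f w * / I one w + I f w * (- I' one w / (I one w * I one w)))%C).
  assert (Df : forall w, Cmod (w - z0) < dd -> dC f w = D w).
  { intros w Hw. apply dC_eq.
    apply (cder_ext_loc (fun v => I f v * / I one v)%C f w _ (dd - Cmod (w - z0))); [lra| |].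
    - intros v Hv. symmetry. apply Ef. pose proof (Cmod_sub_triangle v w z0). lra.
    - apply (cder_mult (I f) (fun v => / I one v)%C); [apply DI; auto; lra|].
      apply (cder_inv (I one)); [apply DI; auto; lra|].
      exact (HJ0 w ltac:(lra)). }
  destruct (DI' f z0 Cf Hz0) as [m1 M1]. destruct (DI' one z0 C1 Hz0) as [m2 M2].
  eexists. apply (cder_ext_loc D _ z0 _ dd); auto.
  { intros w Hw. symmetry. auto. }
  apply (cder_plus (fun w => I' f w * / I one w)%C
    (fun w => I f w * (- I' one w / (I one w * I one w)))%C).
  - apply (cder_mult (I' f) (fun w => / I one w)%C); [exact M1|].
    apply (cder_inv (I one)); [apply DI; auto|auto].
  - apply (cder_mult (I f) (fun w => - I' one w / (I one w * I one w))%C); [apply DI; auto|].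
    apply (cder_mult (fun w => - I' one w)%C (fun w => / (I one w * I one w))%C).
    + apply (cder_opp (I' one)); exact M2.
    + apply (cder_inv (fun w => I one w * I one w)%C).
      * apply (cder_mult (I one) (I one)); apply DI; auto.
      * apply Cmult_neq_0; auto.
Qed.

(** A continuous function that is holomorphic off a point is the derivative of a
    holomorphic function around that point. *)
Lemma removable_singularity (f : C -> C) (p : C) (r : R) : 0 < r -> ccont f p ->
  (forall z, Cmod (z - p) < r -> z <> p -> hol f z) -> hol f p.
Proof.
  intros Hr Hc Hh.
  destruct (local_primitive f p p r) as [F HF]; auto.
  { intros z Hz. destruct (classic (z = p)) as [->|N]; auto. apply hol_ccont; auto. }
  destruct (hol_derivative F p (r / 3)) as [l Hl]; [lra| |].
  { intros w Hw. exists (f w). auto. }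
  exists l. apply (cder_ext_loc (dC F) f p l (r / 3)); [lra| |exact Hl].
  intros w Hw. apply dC_eq. auto.
Qed.

(** * Laplacians and the maximum modulus principle *)

Definition hol_disc (f : C -> C) (z0 : C) (r : R) : Prop :=
  forall z, Cmod (z - z0) < r -> hol f z.

Lemma hol_disc_sub (f : C -> C) (z0 z : C) (r : R) : hol_disc f z0 r ->
  hol_disc f z (r - Cmod (z - z0)).
Proof.
  intros H w Hw. apply H. pose proof (Cmod_sub_triangle w z z0). lra.
Qed.

Lemma hol_disc_dC (f : C -> C) (z0 : C) (r : R) : hol_disc f z0 r -> hol_disc (dC f) z0 r.
Proof.
  intros H z Hz. apply (hol_derivative f z (r - Cmod (z - z0))); [lra|].
  apply hol_disc_sub. exact H.
Qed.

(** [p] and [l] are the first and the second derivative of [u] at [z] in the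
    direction [e]. *)
Definition line2 (u : C -> R) (z e : C) (p l : R) : Prop :=
  exists v : R -> R, v 0 = p /\
    (exists del, 0 < del /\ forall t, Rabs t < del ->
       is_derive (fun s => u (z + RtoC s * e)%C) t (v t)) /\
    is_derive v 0 l.

(** [(p, q)] is the gradient of [u] at [z] and [L] its Laplacian.  The gradient is recorded
    because the Laplacian of [phi (u x)] involves its square. *)
Definition has_lap (u : C -> R) (z : C) (p q L : R) : Prop :=
  exists l m, line2 u z 1 p l /\ line2 u z Ci q m /\ L = l + m.

Lemma line_zero (z e : C) : (z + RtoC 0 * e)%C = z.
Proof. ring. Qed.

Lemma is_derive_plus_R (f g : R -> R) (x l m : R) :
  is_derive f x l -> is_derive g x m -> is_derive (fun t => f t + g t) x (l + m).
Proof. intros Hf Hg. exact (is_derive_plus (V := R_NormedModule) f g x l m Hf Hg). Qed.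

Lemma is_derive_mult_R (f g : R -> R) (x l m : R) :
  is_derive f x l -> is_derive g x m -> is_derive (fun t => f t * g t) x (l * g x + f x * m).
Proof. intros Hf Hg. exact (is_derive_mult f g x l m Hf Hg Rmult_comm). Qed.

Lemma is_derive_scal_R (f : R -> R) (k x l : R) :
  is_derive f x l -> is_derive (fun t => k * f t) x (k * l).
Proof. intros Hf. exact (is_derive_scal f x k l Hf). Qed.

Lemma is_derive_comp_R (f g : R -> R) (x l m : R) :
  is_derive f (g x) l -> is_derive g x m -> is_derive (fun t => f (g t)) x (m * l).
Proof. intros Hf Hg. exact (is_derive_comp (V := R_NormedModule) f g x l m Hf Hg). Qed.

Lemma is_derive_continuous_R (f : R -> R) (x l : R) : is_derive f x l ->
  forall eps, 0 < eps -> exists del, 0 < del /\ forall t, Rabs (t - x) < del -> Rabs (f t - f x) < eps.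
Proof.
  intros H e He.
  assert (Cn : continuous f x) by exact (ex_derive_continuous (V := R_NormedModule) f x (ex_intro _ l H)).
  destruct (proj1 (filterlim_locally _ _) Cn (mkposreal e He)) as [[d Hd] D].
  exists d. split; [exact Hd|]. intros t Ht. exact (D t Ht).
Qed.

Lemma line2_plus (u w : C -> R) (z e : C) (p l p' l' : R) :
  line2 u z e p l -> line2 w z e p' l' -> line2 (fun x => u x + w x) z e (p + p') (l + l').
Proof.
  intros [v [V0 [[d [Hd V1]] V2]]] [v' [V0' [[d' [Hd' V1']] V2']]].
  exists (fun t => v t + v' t). split; [congruence|]. split; [|apply is_derive_plus_R; auto].
  exists (Rmin d d'). split; [apply Rmin_pos; auto|]. intros t Ht.
  pose proof (Rmin_l d d'). pose proof (Rmin_r d d').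
  apply is_derive_plus_R; [apply V1|apply V1']; lra.
Qed.

Lemma line2_scal (k : R) (u : C -> R) (z e : C) (p l : R) :
  line2 u z e p l -> line2 (fun x => k * u x) z e (k * p) (k * l).
Proof.
  intros [v [V0 [[d [Hd V1]] V2]]].
  exists (fun t => k * v t). split; [congruence|]. split; [|apply is_derive_scal_R; auto].
  exists d. split; auto. intros t Ht. apply is_derive_scal_R. auto.
Qed.

Lemma line2_comp (phi phi' : R -> R) (phi2 eps : R) (u : C -> R) (z e : C) (p l : R) :
  0 < eps -> (forall x, Rabs (x - u z) < eps -> is_derive phi x (phi' x)) ->
  is_derive phi' (u z) phi2 ->
  line2 u z e p l ->
  line2 (fun x => phi (u x)) z e (phi' (u z) * p) (phi2 * (p * p) + phi' (u z) * l).
Proof.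
  intros He H1 H2 [v [V0 [[d [Hd V1]] V2]]].
  assert (D0 : is_derive (fun s => u (z + RtoC s * e)%C) 0 (v 0)).
  { apply V1. rewrite Rabs_R0. auto. }
  exists (fun t => v t * phi' (u (z + RtoC t * e)%C)).
  split; [|split].
  - rewrite line_zero, V0. ring.
  - destruct (is_derive_continuous_R _ _ _ D0 eps He) as [d' [Hd' C']].
    exists (Rmin d d'). split; [apply Rmin_pos; auto|]. intros t Ht.
    pose proof (Rmin_l d d'). pose proof (Rmin_r d d').
    apply (is_derive_comp_R phi (fun s => u (z + RtoC s * e)%C)); [|apply V1; lra].
    apply H1. specialize (C' t). rewrite line_zero in C'. apply C'. rewrite Rminus_0_r. lra.
  - replace (phi2 * (p * p) + phi' (u z) * l)
      with (l * phi' (u (z + RtoC 0 * e)%C) + v 0 * (v 0 * phi2))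
      by (rewrite line_zero, V0; ring).
    apply (is_derive_mult_R v (fun t => phi' (u (z + RtoC t * e)%C))); auto.
    apply (is_derive_comp_R phi' (fun s => u (z + RtoC s * e)%C)); auto.
    rewrite line_zero. exact H2.
Qed.

(** Second derivative test: were [l] positive, [g t + g (- t)] would
    increase for small [t > 0]. *)
Lemma line2_max (u : C -> R) (z e : C) (p l del : R) : 0 < del ->
  line2 u z e p l -> (forall t, Rabs t < del -> u (z + RtoC t * e)%C <= u z) -> l <= 0.
Proof.
  intros Hdel [v [V0 [[d [Hd V1]] V2]]] Hmax.
  set (g := fun s => u (z + RtoC s * e)%C) in *.
  apply Rnot_lt_le. intros Hl.
  destruct (is_derive_eps v 0 l V2 (l / 2)) as [d1 [Hd1 D1]]; [lra|].
  set (t := Rmin (Rmin d del) d1 / 2).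
  assert (Ht : 0 < t /\ t < d /\ t < del /\ t < d1).
  { pose proof (Rmin_l (Rmin d del) d1). pose proof (Rmin_r (Rmin d del) d1).
    pose proof (Rmin_l d del). pose proof (Rmin_r d del).
    assert (0 < Rmin (Rmin d del) d1) by (repeat apply Rmin_pos; auto). unfold t. lra. }
  destruct (MVT_cor2 (fun s => g s + g (-1 * s)) (fun s => v s + -1 * v (-1 * s)) 0 t) as [s [E Hs]]; [lra| |].
  { intros s Hs. apply is_derive_Reals. apply is_derive_plus_R; [apply V1; rewrite Rabs_right; lra|].
    apply (is_derive_comp_R g (fun x => -1 * x)); [apply V1; apply Rabs_def1; lra|].
    auto_derive; auto. ring. }
  assert (A1 := D1 s ltac:(rewrite Rminus_0_r, Rabs_right; lra)).
  assert (A2 := D1 (-1 * s) ltac:(rewrite Rminus_0_r, Rabs_left; lra)).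
  rewrite Rminus_0_r, (Rabs_right s) in A1 by lra. rewrite Rminus_0_r, (Rabs_left (-1 * s)) in A2 by lra.
  apply Rabs_le_between in A1. apply Rabs_le_between in A2.
  assert (0 < s * l) by (apply Rmult_lt_0_compat; lra).
  assert (0 < (v s + -1 * v (-1 * s)) * (t - 0)) by (apply Rmult_lt_0_compat; lra).
  pose proof (Hmax t ltac:(rewrite Rabs_right; lra)) as M1.
  pose proof (Hmax (-1 * t) ltac:(apply Rabs_def1; lra)) as M2.
  fold (g t) in M1. fold (g (-1 * t)) in M2.
  assert (G0 : g 0 = u z) by (unfold g; rewrite line_zero; auto).
  rewrite Rmult_0_r, G0 in E. lra.
Qed.

Lemma has_lap_plus (u w : C -> R) (z : C) (p q L p' q' L' : R) :
  has_lap u z p q L -> has_lap w z p' q' L' ->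
  has_lap (fun x => u x + w x) z (p + p') (q + q') (L + L').
Proof.
  intros [l [m [H1 [H2 E]]]] [l' [m' [H1' [H2' E']]]].
  exists (l + l'), (m + m'). split; [|split].
  - apply line2_plus; auto.
  - apply line2_plus; auto.
  - rewrite E, E'. ring.
Qed.

Lemma has_lap_scal (k : R) (u : C -> R) (z : C) (p q L : R) :
  has_lap u z p q L -> has_lap (fun x => k * u x) z (k * p) (k * q) (k * L).
Proof.
  intros [l [m [H1 [H2 E]]]]. exists (k * l), (k * m). split; [|split].
  - apply line2_scal; auto.
  - apply line2_scal; auto.
  - rewrite E. ring.
Qed.

Lemma has_lap_comp (phi phi' : R -> R) (phi2 eps : R) (u : C -> R) (z : C) (p q L : R) :
  0 < eps -> (forall x, Rabs (x - u z) < eps -> is_derive phi x (phi' x)) ->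
  is_derive phi' (u z) phi2 -> has_lap u z p q L ->
  has_lap (fun x => phi (u x)) z (phi' (u z) * p) (phi' (u z) * q)
    (phi2 * (p * p + q * q) + phi' (u z) * L).
Proof.
  intros He H H' [l [m [H1 [H2 E]]]].
  exists (phi2 * (p * p) + phi' (u z) * l), (phi2 * (q * q) + phi' (u z) * m). split; [|split].
  - apply (line2_comp _ _ _ eps); auto.
  - apply (line2_comp _ _ _ eps); auto.
  - rewrite E. ring.
Qed.

Lemma has_lap_max (u : C -> R) (z : C) (p q L del : R) : 0 < del ->
  has_lap u z p q L -> (forall w, Cmod (w - z) < del -> u w <= u z) -> L <= 0.
Proof.
  intros Hd [l [m [H1 [H2 E]]]] Hmax.
  assert (A1 : l <= 0).
  { apply (line2_max u z 1 p l del); auto. intros t Ht. apply Hmax.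
    replace (z + RtoC t * 1 - z)%C with (RtoC t) by ring. rewrite Cmod_R. auto. }
  assert (A2 : m <= 0).
  { apply (line2_max u z Ci q m del); auto. intros t Ht. apply Hmax.
    replace (z + RtoC t * Ci - z)%C with (RtoC t * Ci)%C by ring.
    rewrite Cmod_mult, Cmod_Ci, Cmod_R. lra. }
  lra.
Qed.

Lemma line_pder (z e : C) (t : R) : pder (fun s => z + RtoC s * e)%C t e.
Proof.
  intros eps He. exists 1. split; [lra|]. intros s _.
  replace (z + RtoC s * e - (z + RtoC t * e) - RtoC (s - t) * e)%C with (RtoC 0).
  - rewrite Cmod_0. apply Rmult_le_pos; [lra|apply Rabs_pos].
  - rewrite RtoC_minus. ring.
Qed.

Lemma Cmod_line (z e : C) (t : R) : Cmod (z + RtoC t * e - z) = Rabs t * Cmod e.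
Proof. replace (z + RtoC t * e - z)%C with (RtoC t * e)%C by ring. rewrite Cmod_mult, Cmod_R. auto. Qed.

Lemma hol_line_pder (h : C -> C) (z e : C) (t : R) : hol h (z + RtoC t * e)%C ->
  pder (fun s => h (z + RtoC s * e)%C) t (dC h (z + RtoC t * e) * e)%C.
Proof. intros H. apply (pder_comp h); [apply dC_cder; auto|apply line_pder]. Qed.

Lemma is_derive_ln_Cmod (g : R -> C) (t : R) (v : C) : pder g t v -> g t <> 0%C ->
  is_derive (fun s => ln (Cmod (g s))) t (fst (v / g t)%C).
Proof.
  intros Hg Hn. pose proof (pder_fst _ _ _ Hg) as D1. pose proof (pder_snd _ _ _ Hg) as D2.
  assert (Pm : 0 < Cmod (g t)) by (apply Cmod_gt_0; auto).
  assert (P2 : 0 < fst (g t) * fst (g t) + snd (g t) * snd (g t)).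
  { pose proof (Cmod_sqr (g t)). nra. }
  assert (D3 : is_derive (fun s => fst (g s) * fst (g s) + snd (g s) * snd (g s)) t
     (fst v * fst (g t) + fst (g t) * fst v + (snd v * snd (g t) + snd (g t) * snd v))).
  { apply is_derive_plus_R; apply is_derive_mult_R; auto. }
  assert (D4 : is_derive (fun x => ln (sqrt x)) (fst (g t) * fst (g t) + snd (g t) * snd (g t))
     (/ (2 * (fst (g t) * fst (g t) + snd (g t) * snd (g t))))).
  { auto_derive.
    - repeat split; auto. apply sqrt_lt_R0; auto.
    - rewrite <- (sqrt_sqrt (fst (g t) * fst (g t) + snd (g t) * snd (g t))) at 3 by lra.
      assert (0 < sqrt (fst (g t) * fst (g t) + snd (g t) * snd (g t))) by (apply sqrt_lt_R0; auto).
      field. lra. }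
  assert (D5 := is_derive_comp_R (fun x => ln (sqrt x)) _ t _ _ D4 D3).
  match type of D5 with is_derive _ _ ?l => replace (fst (v / g t)%C) with l end.
  - refine (is_derive_ext _ _ _ _ _ D5). intros s. unfold Cmod. do 2 f_equal. ring.
  - destruct v as [a b], (g t) as [x y]. unfold Cdiv, Cinv, Cmult; simpl in *.
    field. nra.
Qed.

(** The Laplacian of [ln |h|] is the sum of the real parts of [k'] and
    [Ci ^ 2 k'], with [k = h' / h]. *)
Lemma lap_ln_Cmod (h : C -> C) (z : C) (r : R) : 0 < r -> hol_disc h z r -> h z <> 0%C ->
  has_lap (fun w => ln (Cmod (h w))) z (fst (dC h z / h z)%C) (- snd (dC h z / h z)%C) 0.
Proof.
  intros Hr Hh Hz. assert (Hz0 : Cmod (z - z) < r) by (rewrite Cmod_sub_self; auto).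
  pose proof (hol_disc_dC h z r Hh) as Hh'.
  destruct (ccont_away h z (hol_ccont _ _ (Hh z Hz0)) Hz) as [d [Hd Hd']].
  assert (Hn : forall w, Cmod (w - z) < d -> h w <> 0%C).
  { intros w Hw. apply Cmod_gt_0. specialize (Hd' w Hw). pose proof (Cmod_ge_0 (h z)). lra. }
  set (k := fun w => (dC h w * / h w)%C).
  assert (Hk : hol k z).
  { destruct (Hh' z Hz0) as [m M]. eexists. unfold k.
    apply (cder_mult (dC h) (fun w => / h w)%C); [exact M|].
    apply (cder_inv h); [apply dC_cder, Hh; auto|auto]. }
  destruct Hk as [k1 Hk1].
  assert (Line : forall e, Cmod e = 1 -> line2 (fun w => ln (Cmod (h w))) z e (fst (e * k z)%C) (fst (e * (k1 * e))%C)).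
  { intros e He. exists (fun t => fst (e * k (z + RtoC t * e))%C). split; [|split].
    - rewrite line_zero. auto.
    - use_min d r. intros t Ht.
      assert (Hm : Cmod (z + RtoC t * e - z) < Rmin d r) by (rewrite Cmod_line, He; lra).
      replace (e * k (z + RtoC t * e))%C with (dC h (z + RtoC t * e) * e / h (z + RtoC t * e))%C
        by (unfold k, Cdiv; ring).
      apply (is_derive_ln_Cmod (fun s => h (z + RtoC s * e)%C)).
      + apply hol_line_pder. apply Hh. lra.
      + apply Hn. lra.
    - apply (pder_fst (fun t => e * k (z + RtoC t * e))%C).
      assert (P : pder (fun s => k (z + RtoC s * e)%C) 0 (k1 * e)%C).
      { apply (pder_comp k); [rewrite line_zero; exact Hk1|apply line_pder]. }
      apply (pder_comp (fun w => e * w)%C); [|exact P].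
      apply (cder_eq _ _ (0 * k (z + RtoC 0 * e) + e * 1)%C); [|ring].
      apply (cder_mult (fun _ => e) (fun w => w)); [apply cder_const|apply cder_id]. }
  assert (E1 : (dC h z / h z)%C = k z) by reflexivity. rewrite E1.
  exists (fst (1 * (k1 * 1))%C), (fst (Ci * (k1 * Ci))%C). split; [|split].
  - replace (fst (k z)) with (fst (1 * k z)%C) by (f_equal; ring). apply Line. apply Cmod_1.
  - replace (- snd (k z)) with (fst (Ci * k z)%C) by (simpl; ring). apply Line. apply Cmod_Ci.
  - simpl. ring.
Qed.

Lemma lap_Cmod_sqr (h : C -> C) (z : C) (r : R) : 0 < r -> hol_disc h z r ->
  has_lap (fun w => Cmod (h w) ^ 2) z
    (2 * (fst (h z) * fst (dC h z) + snd (h z) * snd (dC h z)))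
    (2 * (snd (h z) * fst (dC h z) - fst (h z) * snd (dC h z)))
    (4 * Cmod (dC h z) ^ 2).
Proof.
  intros Hr Hh. assert (Hz0 : Cmod (z - z) < r) by (rewrite Cmod_sub_self; auto).
  pose proof (hol_disc_dC h z r Hh) as Hh'.
  destruct (Hh' z Hz0) as [m M].
  assert (Line : forall e, Cmod e = 1 -> line2 (fun w => Cmod (h w) ^ 2) z e
     (2 * (fst (h z) * fst (dC h z * e)%C + snd (h z) * snd (dC h z * e)%C))
     (2 * ((fst (dC h z * e)%C * fst (dC h z * e)%C + fst (h z) * fst (e * (m * e))%C) +
           (snd (dC h z * e)%C * snd (dC h z * e)%C + snd (h z) * snd (e * (m * e))%C)))).
  { intros e He.
    assert (P1 : forall t, Rabs t < r -> pder (fun s => h (z + RtoC s * e)%C) t (dC h (z + RtoC t * e) * e)%C).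
    { intros t Ht. apply hol_line_pder. apply Hh. rewrite Cmod_line, He. lra. }
    exists (fun t => 2 * (fst (h (z + RtoC t * e)%C) * fst (dC h (z + RtoC t * e) * e)%C +
                     snd (h (z + RtoC t * e)%C) * snd (dC h (z + RtoC t * e) * e)%C)). split; [|split].
    - rewrite line_zero. auto.
    - exists r. split; auto. intros t Ht. specialize (P1 t Ht).
      pose proof (pder_fst _ _ _ P1) as D1. pose proof (pder_snd _ _ _ P1) as D2.
      assert (D3 := is_derive_plus_R _ _ _ _ _ (is_derive_mult_R _ _ _ _ _ D1 D1) (is_derive_mult_R _ _ _ _ _ D2 D2)).
      match type of D3 with is_derive _ _ ?l => match goal with |- is_derive _ _ ?l' => replace l' with l by ring end end.
      refine (is_derive_ext _ _ _ _ _ D3). intros s. rewrite Cmod_sqr. simpl. ring.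
    - assert (P2 : pder (fun s => dC h (z + RtoC s * e) * e)%C 0 (e * (m * e))%C).
      { apply (pder_comp (fun w => w * e)%C (fun s => dC h (z + RtoC s * e)%C)).
        - apply (cder_eq _ _ (1 * e + dC h (z + RtoC 0 * e) * 0)%C); [|ring].
          apply (cder_mult (fun w => w) (fun _ => e)); [apply cder_id|apply cder_const].
        - apply (pder_comp (dC h)); [rewrite line_zero; exact M|apply line_pder]. }
      specialize (P1 0 ltac:(rewrite Rabs_R0; auto)). rewrite line_zero in P1.
      apply is_derive_scal_R.
      pose proof (is_derive_plus_R _ _ _ _ _
        (is_derive_mult_R _ _ _ _ _ (pder_fst _ _ _ P1) (pder_fst _ _ _ P2))
        (is_derive_mult_R _ _ _ _ _ (pder_snd _ _ _ P1) (pder_snd _ _ _ P2))) as D.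
      cbv beta in D. rewrite line_zero in D. exact D. }
  assert (L1 := Line (RtoC 1) Cmod_1). assert (L2 := Line Ci Cmod_Ci).
  eexists. eexists. split; [|split].
  - replace (2 * (fst (h z) * fst (dC h z) + snd (h z) * snd (dC h z)))
      with (2 * (fst (h z) * fst (dC h z * 1)%C + snd (h z) * snd (dC h z * 1)%C)) by (simpl; ring).
    exact L1.
  - replace (2 * (snd (h z) * fst (dC h z) - fst (h z) * snd (dC h z)))
      with (2 * (fst (h z) * fst (dC h z * Ci)%C + snd (h z) * snd (dC h z * Ci)%C)) by (simpl; ring).
    exact L2.
  - rewrite Cmod_sqr. simpl. ring.
Qed.

Lemma rcont_ccont (u : C -> R) (z : C) : rcont u z <-> ccont (fun w => RtoC (u w)) z.
Proof.
  split; intros H e He; destruct (H e He) as [d [Hd H']]; exists d; (split; [exact Hd|]);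
    intros w Hw; specialize (H' w Hw).
  - rewrite <- RtoC_minus, Cmod_R. exact H'.
  - rewrite <- RtoC_minus, Cmod_R in H'. exact H'.
Qed.

Lemma rcont_plus (u w : C -> R) (z : C) : rcont u z -> rcont w z -> rcont (fun x => u x + w x) z.
Proof.
  intros Hu Hw. apply rcont_ccont in Hu. apply rcont_ccont in Hw. apply rcont_ccont.
  refine (ccont_ext_loc _ _ z 1 Rlt_0_1 _ (ccont_plus _ _ z Hu Hw)). intros x _. symmetry. apply RtoC_plus.
Qed.

Lemma rcont_mult (u w : C -> R) (z : C) : rcont u z -> rcont w z -> rcont (fun x => u x * w x) z.
Proof.
  intros Hu Hw. apply rcont_ccont in Hu. apply rcont_ccont in Hw. apply rcont_ccont.
  refine (ccont_ext_loc _ _ z 1 Rlt_0_1 _ (ccont_mult _ _ z Hu Hw)). intros x _. symmetry. apply RtoC_mult.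
Qed.

Lemma rcont_comp (phi : R -> R) (u : C -> R) (z : C) :
  continuous phi (u z) -> rcont u z -> rcont (fun x => phi (u x)) z.
Proof.
  intros Hp Hu e He. destruct (proj1 (filterlim_locally _ _) Hp (mkposreal e He)) as [[d Hd] D].
  destruct (Hu d Hd) as [d' [Hd' D']]. exists d'. split; auto. intros w Hw.
  apply (D (u w)). apply (D' w Hw).
Qed.

Lemma rcont_const (k : R) (z : C) : rcont (fun _ => k) z.
Proof. intros e He. exists 1. split; [lra|]. intros. rewrite Rminus_diag, Rabs_R0. auto. Qed.

Lemma rcont_pow (u : C -> R) (n : nat) (z : C) : rcont u z -> rcont (fun x => u x ^ n) z.
Proof. intros H. induction n; simpl; [apply rcont_const|apply rcont_mult; auto]. Qed.

Lemma disc_complement_open (z0 : C) (r : R) (z : C) : ~ Cmod (z - z0) <= r ->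
  exists del, 0 < del /\ forall w, Cmod (w - z) < del -> ~ Cmod (w - z0) <= r.
Proof.
  intros H. exists (Cmod (z - z0) - r). split; [lra|]. intros w Hw H'.
  pose proof (Cmod_sub_triangle z w z0). rewrite (Cmod_sub_sym z w) in H0. lra.
Qed.

(** [|f|^2 + eps |z - z0|^2] has positive Laplacian, hence no interior maximum. *)
Lemma max_modulus_principle (f : C -> C) (z0 : C) (r : R) : 0 < r ->
  (forall z, Cmod (z - z0) <= r -> exists del, 0 < del /\ hol_disc f z del) ->
  exists x, Cmod (x - z0) = r /\ forall z, Cmod (z - z0) <= r -> Cmod (f z) <= Cmod (f x).
Proof.
  intros Hr Hh.
  assert (Hc : forall z, Cmod (z - z0) <= r -> ccont f z).
  { intros z Hz. destruct (Hh z Hz) as [d [Hd H]]. apply hol_ccont, H. rewrite Cmod_sub_self; auto. }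
  destruct (max_on_circle f z0 r) as [x [Hx HM]]; [lra|intros z Hz; apply Hc; lra|].
  exists x. split; auto. intros z Hz.
  assert (Key : forall eps, 0 < eps -> Cmod (f z) ^ 2 <= Cmod (f x) ^ 2 + eps * r ^ 2).
  { intros eps He.
    set (u := fun w => Cmod (f w) ^ 2 + eps * Cmod (w - z0) ^ 2).
    destruct (max_attained u (fun w => Cmod (w - z0) <= r) (r + Cmod z0)) as [y [Hy Hmax]].
    - exists z0. rewrite Cmod_sub_self. lra.
    - intros w Hw. pose proof (Cmod_le_add w z0). lra.
    - intros w Hw. apply disc_complement_open. exact Hw.
    - intros w Hw. apply rcont_plus; [apply rcont_pow, rcont_Cmod; auto|].
      apply rcont_mult; [apply rcont_const|]. apply rcont_pow.
      apply (rcont_Cmod (fun v => v - z0)%C). apply ccont_minus; [apply ccont_id|apply ccont_const].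
    - assert (Ey : Cmod (y - z0) = r).
      { apply Rle_antisym; auto. apply Rnot_lt_le. intros Hlt.
        destruct (Hh y Hy) as [d [Hd H]].
        assert (Id : hol_disc (fun v => v - z0)%C y d).
        { intros w _. eexists. apply cder_minus; [apply cder_id|apply cder_const]. }
        assert (L := has_lap_plus _ _ _ _ _ _ _ _ _ (lap_Cmod_sqr f y d Hd H)
          (has_lap_scal eps _ _ _ _ _ (lap_Cmod_sqr _ y d Hd Id))).
        assert (D1 : dC (fun v => v - z0)%C y = RtoC 1).
        { apply dC_eq. apply (cder_eq _ _ (1 - 0)%C); [|ring]. apply cder_minus; [apply cder_id|apply cder_const]. }
        apply (has_lap_max _ _ _ _ _ (r - Cmod (y - z0))) in L; [|lra|].
        - rewrite D1, Cmod_1 in L. pose proof (pow2_ge_0 (Cmod (dC f y))). lra.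
        - intros w Hw. apply Hmax. pose proof (Cmod_sub_triangle w y z0). lra. }
      specialize (Hmax z Hz). unfold u in Hmax. rewrite Ey in Hmax.
      pose proof (pow2_ge_0 (Cmod (z - z0))).
      assert (Cmod (f y) ^ 2 <= Cmod (f x) ^ 2) by (apply pow_incr; split; [apply Cmod_ge_0|auto]).
      nra. }
  apply Rnot_lt_le. intros Hlt. pose proof (Cmod_ge_0 (f x)) as P.
  specialize (Key ((Cmod (f z) ^ 2 - Cmod (f x) ^ 2) / (2 * r ^ 2))).
  assert (Pr : 0 < r ^ 2) by (apply pow_lt; auto).
  assert (Q : 0 < Cmod (f z) ^ 2 - Cmod (f x) ^ 2) by nra.
  specialize (Key ltac:(apply Rdiv_lt_0_compat; lra)).
  replace ((Cmod (f z) ^ 2 - Cmod (f x) ^ 2) / (2 * r ^ 2) * r ^ 2)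
    with ((Cmod (f z) ^ 2 - Cmod (f x) ^ 2) / 2) in Key by (field; lra). lra.
Qed.

(** * Poles and growth *)

Lemma hol_const (k z : C) : hol (fun _ => k) z.
Proof. eexists. apply cder_const. Qed.

Lemma hol_id (z : C) : hol (fun w => w) z.
Proof. eexists. apply cder_id. Qed.

Lemma hol_minus (f g : C -> C) (z : C) : hol f z -> hol g z -> hol (fun w => f w - g w)%C z.
Proof. intros [l Hl] [m Hm]. eexists. apply cder_minus; eauto. Qed.

Lemma hol_mult (f g : C -> C) (z : C) : hol f z -> hol g z -> hol (fun w => f w * g w)%C z.
Proof. intros [l Hl] [m Hm]. eexists. apply cder_mult; eauto. Qed.

Lemma hol_inv (f : C -> C) (z : C) : hol f z -> f z <> 0%C -> hol (fun w => / f w)%C z.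
Proof. intros [l Hl] N. eexists. apply cder_inv; eauto. Qed.

Lemma hol_pow (f : C -> C) (n : nat) (z : C) : hol f z -> hol (fun w => Cpow (f w) n) z.
Proof.
  intros H. induction n; simpl; [apply hol_const|]. apply (hol_mult f (fun w => Cpow (f w) n)); auto.
Qed.

Lemma hol_sub_const (p z : C) : hol (fun w => w - p)%C z.
Proof. apply hol_minus; [apply hol_id|apply hol_const]. Qed.

Lemma hol_ext_loc (f g : C -> C) (z : C) (r : R) : 0 < r ->
  (forall w, Cmod (w - z) < r -> f w = g w) -> hol f z -> hol g z.
Proof. intros Hr E [l Hl]. exists l. apply (cder_ext_loc f g z l r); auto. Qed.

Lemma Csub_neq (w p : C) : w <> p -> (w - p <> 0)%C.
Proof. intros N. apply Cmod_gt_0, Cmod_sub_pos, N. Qed.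

(** The singularity of the difference quotient at [p] is removable. *)
Lemma factor_root (f : C -> C) (p : C) (r : R) : 0 < r -> hol_disc f p r -> f p = 0%C ->
  exists q, (forall w, f w = ((w - p) * q w)%C) /\ hol q p /\ forall w, w <> p -> hol f w -> hol q w.
Proof.
  intros Hr Hf H0.
  assert (Hp : hol f p) by (apply Hf; rewrite Cmod_sub_self; auto). destruct Hp as [l Hl].
  destruct (proj1 (cder_slope f p l) Hl) as [q [Cq [Eq Hq]]].
  assert (Qe : forall w, f w = ((w - p) * q w)%C).
  { intros w. replace (f w) with (f w - f p)%C by (rewrite H0; ring). rewrite Hq. ring. }
  assert (Off : forall w, w <> p -> hol f w -> hol q w).
  { intros w N Hw.
    apply (hol_ext_loc (fun v => f v * / (v - p))%C q w (Cmod (w - p))); [apply Cmod_sub_pos; auto| |].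
    - intros v Hv. rewrite Qe. field. apply Csub_neq. intros ->. rewrite (Cmod_sub_sym p w) in Hv. lra.
    - apply hol_mult; auto. apply (hol_inv (fun v => v - p)%C); [apply hol_sub_const|apply Csub_neq; auto]. }
  exists q. split; [auto|split; auto].
  apply (removable_singularity q p r); auto.
Qed.

(** If every division by [w - p] succeeds, the maximum principle bounds
    [f w] by [(|w - p| / s) ^ m] times a constant, for every [m]. *)
Lemma zero_order (f : C -> C) (p w0 : C) (r : R) : 0 < r -> hol_disc f p r ->
  Cmod (w0 - p) < r -> f w0 <> 0%C ->
  exists m h, hol_disc h p r /\ h p <> 0%C /\ forall w, f w = (Cpow (w - p) m * h w)%C.
Proof.
  intros Hr Hf Hw0 N. apply NNPP. intros HN.
  assert (All : forall m, exists h, hol_disc h p r /\ forall w, f w = (Cpow (w - p) m * h w)%C).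
  { induction m as [|m [h [Hh E]]].
    - exists f. split; auto. intros w. simpl. ring.
    - destruct (classic (h p = 0%C)) as [Z|NZ].
      + destruct (factor_root h p r Hr Hh Z) as [q [Eq [Hp Hoff]]].
        exists q. split.
        * intros w Hw. destruct (classic (w = p)) as [->|Nw]; auto.
        * intros w. rewrite E, Eq. simpl. ring.
      + exfalso. apply HN. exists m, h. auto. }
  set (t := Cmod (w0 - p)) in *. set (s := (t + r) / 2).
  assert (Ht : 0 <= t) by apply Cmod_ge_0. assert (Hs : t < s < r) by (unfold s; lra).
  destruct (max_on_circle f p s) as [xm [_ HM]]; [lra|intros x Hx; apply hol_ccont, Hf; lra|].
  set (B := Cmod (f xm)) in *.
  assert (Bd : forall m, Cmod (f w0) <= B * (t / s) ^ m).
  { intros m. destruct (All m) as [h [Hh E]].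
    destruct (max_modulus_principle h p s) as [x [Hx Hmax]]; [lra| |].
    - intros z Hz. exists (r - Cmod (z - p)). split; [lra|]. apply hol_disc_sub. auto.
    - specialize (Hmax w0 ltac:(fold t; lra)). specialize (HM x Hx).
      rewrite E, Cmod_mult, Cmod_pow in HM. rewrite Hx in HM.
      rewrite E, Cmod_mult, Cmod_pow. fold t.
      assert (Ps : 0 < s ^ m) by (apply pow_lt; lra). assert (Pt : 0 <= t ^ m) by (apply pow_le; lra).
      unfold Rdiv. rewrite Rpow_mult_distr, pow_inv.
      apply (Rmult_le_reg_r (s ^ m)); auto.
      replace (B * (t ^ m * / s ^ m) * s ^ m) with (t ^ m * B) by (field; lra).
      rewrite Rmult_assoc. apply Rmult_le_compat_l; auto. nra. }
  assert (P : 0 < Cmod (f w0)) by (apply Cmod_gt_0; auto).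
  assert (PB : 0 <= B) by apply Cmod_ge_0.
  destruct (pow_lt_1_zero (t / s)) with (y := Cmod (f w0) / (B + 1)) as [m Hm].
  { rewrite Rabs_right. - apply (Rmult_lt_reg_r s); [lra|]. unfold Rdiv. rewrite Rmult_assoc, Rinv_l; lra.
    - apply Rle_ge. apply Rmult_le_pos; [lra|]. left. apply Rinv_0_lt_compat. lra. }
  { apply Rdiv_lt_0_compat; lra. }
  specialize (Hm m (le_n m)). specialize (Bd m).
  assert (Q : (t / s) ^ m < Cmod (f w0) / (B + 1)) by (eapply Rle_lt_trans; [apply Rle_abs|exact Hm]).
  apply (Rmult_lt_compat_r (B + 1)) in Q; [|lra].
  replace (Cmod (f w0) / (B + 1) * (B + 1)) with (Cmod (f w0)) in Q by (field; lra).
  assert (0 <= (t / s) ^ m) by (apply pow_le; apply Rmult_le_pos; [lra|left; apply Rinv_0_lt_compat; lra]). nra.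
Qed.

(** [1 / g] extends by [0] across [p]; the order of this zero is the order of the pole. *)
Lemma pole_order (g : C -> C) (p : C) (r : R) : 0 < r ->
  (forall w, 0 < Cmod (w - p) < r -> hol g w) ->
  (forall M, exists del, 0 < del /\ forall w, 0 < Cmod (w - p) < del -> M < Cmod (g w)) ->
  exists m h d, 0 < d /\ hol_disc h p d /\
    forall w, 0 < Cmod (w - p) < d -> (Cpow (w - p) m * g w)%C = h w.
Proof.
  intros Hr Hg Hinf.
  destruct (Hinf 1) as [d1 [Hd1 H1]].
  set (d := Rmin r d1). assert (Hd : 0 < d) by (apply Rmin_pos; auto).
  assert (Ldr : d <= r) by apply Rmin_l. assert (Ld1 : d <= d1) by apply Rmin_r.
  assert (Gn : forall w, 0 < Cmod (w - p) < d -> g w <> 0%C).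
  { intros w Hw. apply Cmod_gt_0. specialize (H1 w ltac:(lra)). lra. }
  set (u := fun w => if excluded_middle_informative (w = p) then RtoC 0 else (/ g w)%C).
  assert (Up : u p = RtoC 0) by (unfold u; destruct excluded_middle_informative; congruence).
  assert (Uo : forall w, w <> p -> u w = (/ g w)%C).
  { intros w N. unfold u; destruct excluded_middle_informative; congruence. }
  assert (Hoff : forall w, Cmod (w - p) < d -> w <> p -> hol u w).
  { intros w Hw N. pose proof (Cmod_sub_pos w p N).
    apply (hol_ext_loc (fun v => / g v)%C u w (Cmod (w - p))); auto.
    - intros v Hv. symmetry. apply Uo. intros ->. rewrite (Cmod_sub_sym p w) in Hv. lra.
    - apply hol_inv; [apply Hg; lra|apply Gn; lra]. }
  assert (Cp : ccont u p).
  { intros e He. destruct (Hinf (/ e)) as [d2 [Hd2 H2]].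
    use_min d d2. intros w Hw. rewrite Up.
    destruct (classic (w = p)) as [->|N]; [rewrite Up, Cmod_sub_self; auto|].
    pose proof (Cmod_sub_pos w p N). rewrite Uo by auto.
    replace (/ g w - 0)%C with (/ g w)%C by ring. rewrite Cmod_inv by (apply Gn; lra).
    specialize (H2 w ltac:(lra)). rewrite <- (Rinv_inv e). apply Rinv_lt_contravar; auto.
    apply Rmult_lt_0_compat; [apply Rinv_0_lt_compat; auto|].
    apply Cmod_gt_0, Gn. lra. }
  assert (Hu : hol_disc u p d).
  { intros w Hw. destruct (classic (w = p)) as [->|N]; auto.
    apply (removable_singularity u p d); auto. }
  assert (Hw0 : Cmod (p + RtoC (d / 2) - p) = d / 2).
  { replace (p + RtoC (d / 2) - p)%C with (RtoC (d / 2)) by ring. rewrite Cmod_R. apply Rabs_right. lra. }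
  assert (Nw0 : (p + RtoC (d / 2))%C <> p).
  { intros E. rewrite E, Cmod_sub_self in Hw0. lra. }
  destruct (zero_order u p (p + RtoC (d / 2))%C d) as [m [h [Hh [Np E]]]]; auto; [lra| |].
  { rewrite Uo by auto. intros Z. apply (Gn (p + RtoC (d / 2))%C); [lra|].
    assert (N := Gn (p + RtoC (d / 2))%C ltac:(lra)).
    replace (g (p + RtoC (d / 2)))%C with (g (p + RtoC (d / 2)) * g (p + RtoC (d / 2)) * / g (p + RtoC (d / 2)))%C by (field; auto).
    rewrite Z. ring. }
  destruct (ccont_away h p) as [d3 [Hd3 H3]]; auto.
  { apply hol_ccont, Hh. rewrite Cmod_sub_self; auto. }
  pose proof (Rmin_l d d3). pose proof (Rmin_r d d3).
  assert (Hn : forall w, Cmod (w - p) < Rmin d d3 -> h w <> 0%C).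
  { intros w Hw. apply Cmod_gt_0. specialize (H3 w ltac:(lra)). pose proof (Cmod_ge_0 (h p)). lra. }
  exists m, (fun w => / h w)%C, (Rmin d d3). split; [apply Rmin_pos; auto|]. split.
  - intros w Hw. apply hol_inv; [apply Hh; lra|auto].
  - intros w Hw. assert (Nw : w <> p) by (intros ->; rewrite Cmod_sub_self in Hw; lra).
    specialize (E w). rewrite Uo in E by auto.
    assert (Ng := Gn w ltac:(lra)). assert (Nh := Hn w ltac:(lra)).
    assert (Npow : Cpow (w - p) m <> 0%C).
    { intros Z. rewrite Z in E. apply Ng.
      replace (g w) with (g w * g w * / g w)%C by (field; auto). rewrite E. ring. }
    replace (g w) with (/ (/ g w))%C by (field; auto). rewrite E. field. auto.
Qed.

Definition root_prod (rs : list C) (z : C) : C := fold_right (fun p acc => (z - p) * acc)%C (RtoC 1) rs.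

Lemma root_prod_repeat (p z : C) (m : nat) (rs : list C) :
  root_prod (repeat p m ++ rs) z = (Cpow (z - p) m * root_prod rs z)%C.
Proof. induction m; simpl; [ring|]. rewrite IHm. ring. Qed.

(** The poles are cleared one at a time; the hypothesis at [p] has a form that survives
    multiplication by powers of [w - q]. *)
Lemma clear_poles (l : list C) : forall g : C -> C,
  (forall z, ~ In z l -> hol g z) ->
  (forall p, In p l -> exists m h d, 0 < d /\ hol_disc h p d /\
     forall w, 0 < Cmod (w - p) < d -> (Cpow (w - p) m * g w)%C = h w) ->
  exists (rs : list C) (F : C -> C), (forall z, hol F z) /\
    (forall p, In p rs -> In p l) /\
    forall z, ~ In z l -> F z = (root_prod rs z * g z)%C.
Proof.
  induction l as [|p l IH]; intros g Hg Hp.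
  - exists nil, g. split; [intros; apply Hg; auto|]. split; [intros q []|]. intros. simpl. ring.
  - destruct (Hp p (or_introl eq_refl)) as [m [h [d [Hd [Hh E]]]]].
    set (g1 := fun w => if excluded_middle_informative (w = p) then h p else (Cpow (w - p) m * g w)%C).
    assert (G1 : forall w, w <> p -> g1 w = (Cpow (w - p) m * g w)%C).
    { intros w N. unfold g1. destruct excluded_middle_informative; congruence. }
    assert (G1p : forall w, Cmod (w - p) < d -> g1 w = h w).
    { intros w Hw. unfold g1. destruct excluded_middle_informative as [->|N]; auto.
      apply E. split; auto. apply Cmod_sub_pos; auto. }
    assert (Far : forall w q v, Cmod (v - q) < Cmod (q - w) -> v <> w).
    { intros w q v H ->. rewrite (Cmod_sub_sym w q) in H. lra. }
    destruct (IH g1) as [rs [F [HF [Hrs HFE]]]].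
    + intros z Hz. destruct (classic (z = p)) as [->|N].
      * apply (hol_ext_loc h g1 p d Hd); [intros w Hw; symmetry; auto|].
        apply Hh. rewrite Cmod_sub_self; auto.
      * apply (hol_ext_loc (fun w => Cpow (w - p) m * g w)%C g1 z (Cmod (z - p))); [apply Cmod_sub_pos; auto| |].
        -- intros w Hw. symmetry. apply G1. eapply Far; eauto.
        -- apply hol_mult; [apply (hol_pow (fun w => w - p)%C), hol_sub_const|].
           apply Hg. intros [->|H]; auto.
    + intros q Hq. destruct (classic (q = p)) as [->|N].
      * exists O, h, d. split; auto. split; auto. intros w Hw. rewrite G1p by lra. simpl. ring.
      * destruct (Hp q (or_intror Hq)) as [n [k [e [He [Hk Ek]]]]].
        pose proof (Cmod_sub_pos q p N).
        pose proof (Rmin_l e (Cmod (q - p))). pose proof (Rmin_r e (Cmod (q - p))).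
        exists n, (fun w => Cpow (w - p) m * k w)%C, (Rmin e (Cmod (q - p))).
        split; [apply Rmin_pos; auto|]. split.
        -- intros w Hw. apply hol_mult; [apply (hol_pow (fun v => v - p)%C), hol_sub_const|]. apply Hk. lra.
        -- intros w Hw. rewrite G1 by (apply (Far p q); lra). rewrite <- Ek by lra. ring.
    + exists (repeat p m ++ rs), F. split; auto. split.
      * intros q Hq. apply in_app_or in Hq. destruct Hq as [Hq|Hq]; [left|right; auto].
        symmetry. eapply repeat_spec; eauto.
      * intros z Hz. rewrite root_prod_repeat, HFE by (intros H; apply Hz; right; auto).
        rewrite G1; [ring|]. intros ->. apply Hz. left. auto.
Qed.

Lemma Cpoly_S (n : nat) (a : nat -> C) (z : C) :
  Cpoly (S n) a z = (Cpoly n a z + a (S n) * Cpow z (S n))%C.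
Proof. unfold Cpoly. rewrite sum_Sn. reflexivity. Qed.

Lemma Cpoly_0 (a : nat -> C) (z : C) : Cpoly 0 a z = a O.
Proof. unfold Cpoly. rewrite sum_O. simpl. ring. Qed.

Lemma Cpoly_ext (n : nat) (a b : nat -> C) (z : C) :
  (forall k, (k <= n)%nat -> a k = b k) -> Cpoly n a z = Cpoly n b z.
Proof. intros H. apply sum_n_ext_loc. intros k Hk. rewrite H; auto. Qed.

Lemma Cpoly_times_linear (n : nat) (a : nat -> C) (p : C) :
  exists b, forall z, ((z - p) * Cpoly n a z)%C = Cpoly (S n) b z.
Proof.
  exists (fun k => ((match k with O => RtoC 0 | S j => a j end) -
                    p * (if Nat.leb k n then a k else RtoC 0))%C).
  intros z.
  assert (E : forall m, (m <= n)%nat ->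
    ((z - p) * Cpoly m a z = Cpoly m (fun k => ((match k with O => RtoC 0 | S j => a j end) -
                    p * (if Nat.leb k n then a k else RtoC 0))%C) z + a m * Cpow z (S m))%C).
  { induction m; intros Hm.
    - rewrite !Cpoly_0. rewrite (proj2 (Nat.leb_le 0 n)) by lia. simpl. ring.
    - rewrite !Cpoly_S, Cmult_plus_distr_l, IHm by lia.
      rewrite (proj2 (Nat.leb_le (S m) n)) by lia. simpl. ring. }
  rewrite E, Cpoly_S by lia. rewrite (proj2 (Nat.leb_gt (S n) n)) by lia. simpl. ring.
Qed.

Lemma root_prod_Cpoly (rs : list C) :
  exists a, forall z, root_prod rs z = Cpoly (length rs) a z.
Proof.
  induction rs as [|p rs [a IH]].
  - exists (fun _ => RtoC 1). intros z. simpl. rewrite Cpoly_0. auto.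
  - destruct (Cpoly_times_linear (length rs) a p) as [b Hb]. exists b. intros z. simpl.
    rewrite IH. apply Hb.
Qed.

Lemma Cpoly_bound (n : nat) (a : nat -> C) :
  exists A, 0 <= A /\ forall z, 1 <= Cmod z -> Cmod (Cpoly n a z) <= A * Cmod z ^ n.
Proof.
  induction n as [|n [A [PA IH]]].
  - exists (Cmod (a O)). split; [apply Cmod_ge_0|]. intros z Hz. rewrite Cpoly_0. simpl. lra.
  - exists (A + Cmod (a (S n))). split; [pose proof (Cmod_ge_0 (a (S n))); lra|].
    intros z Hz. rewrite Cpoly_S. eapply Rle_trans; [apply Cmod_triangle|].
    rewrite Cmod_mult, Cmod_pow. specialize (IH z Hz).
    assert (0 <= Cmod z ^ n) by (apply pow_le; lra).
    assert (A * Cmod z ^ n <= A * Cmod z ^ S n).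
    { apply Rmult_le_compat_l; auto. simpl. nra. }
    lra.
Qed.

Lemma root_prod_size (rs : list C) :
  exists R, 1 <= R /\ forall z, R <= Cmod z ->
    (Cmod z / 2) ^ length rs <= Cmod (root_prod rs z) <= (2 * Cmod z) ^ length rs.
Proof.
  induction rs as [|p rs [R [HR IH]]].
  - exists 1. split; [lra|]. intros z Hz. simpl. rewrite Cmod_1. lra.
  - exists (Rmax R (2 * Cmod p)). split; [pose proof (Rmax_l R (2 * Cmod p)); lra|].
    intros z Hz. pose proof (Rmax_l R (2 * Cmod p)). pose proof (Rmax_r R (2 * Cmod p)).
    specialize (IH z ltac:(lra)). simpl. rewrite Cmod_mult.
    pose proof (Cmod_triangle_sub z p). pose proof (Cmod_le_add z p).
    assert (0 <= (Cmod z / 2) ^ length rs) by (apply pow_le; lra).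
    pose proof (Cmod_ge_0 (z - p)%C).
    split; apply Rmult_le_compat; lra.
Qed.

Lemma Taylor_split (F : C -> C) (k : nat) : (forall z, hol F z) ->
  exists a G, (forall z, hol G z) /\ forall z, F z = (Cpoly k a z + Cpow z (S k) * G z)%C.
Proof.
  assert (Step : forall F, (forall z, hol F z) -> exists G, (forall z, hol G z) /\ forall z, F z = (F 0 + z * G z)%C).
  { intros H HH. destruct (factor_root (fun z => H z - H 0)%C (RtoC 0) 1) as [q [E [H0 Hoff]]].
    - lra.
    - intros z _. apply hol_minus; [apply HH|apply hol_const].
    - simpl. ring.
    - exists q. split.
      + intros z. destruct (classic (z = RtoC 0)) as [->|N]; auto. apply Hoff; auto.
        apply hol_minus; [apply HH|apply hol_const].
      + intros z. replace (H z) with (H 0 + (H z - H 0))%C by ring. rewrite E. ring. }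
  intros HF. induction k as [|k [a [G [HG E]]]].
  - destruct (Step F HF) as [G [HG E]]. exists (fun _ => F 0), G. split; auto.
    intros z. rewrite Cpoly_0, E at 1. simpl. ring.
  - destruct (Step G HG) as [G' [HG' E']].
    exists (fun j => if Nat.leb j k then a j else G 0), G'. split; auto. intros z.
    rewrite E, E', Cpoly_S, (Cpoly_ext k (fun j => if Nat.leb j k then a j else G 0) a).
    + rewrite (proj2 (Nat.leb_gt (S k) k)) by lia. simpl. ring.
    + intros j Hj. rewrite (proj2 (Nat.leb_le j k)) by lia. auto.
Qed.

(** Where [F] is a transcendental entire function, [z ^ (k + 1) G] dominates in
    [F = (polynomial of degree k) + z ^ (k + 1) G], and its maximum
    modulus grows at least like [r ^ (k + 1)]; [k] is at our disposal. *)
Lemma transcendental_growth (g F : C -> C) (rs : list C) (R0 L : R) :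
  (forall z, hol F z) ->
  (forall k a, ~ forall z, F z = Cpoly k a z) ->
  (forall z, R0 <= Cmod z -> F z = (root_prod rs z * g z)%C) -> 0 < L ->
  exists R1 gam, 1 <= R1 /\ 0 < gam /\ R0 <= R1 /\
   (forall rho, R1 <= rho -> exists w, Cmod w = rho /\ gam * rho <= Cmod (g w)) /\
   (forall z rho, R1 <= Cmod z -> 2 * Cmod z <= rho ->
      exists w, Cmod w = rho /\ L * Cmod (g z) <= Cmod (g w)).
Proof.
  intros HF Hnp HE HL. set (m := length rs).
  assert (Hj : exists j, (1 <= j)%nat /\ L * 4 * 4 ^ m <= 2 ^ j).
  { destruct (Pow_x_infinity 2 ltac:(rewrite Rabs_right; lra) (L * 4 * 4 ^ m)) as [N HN].
    exists (S N). split; [lia|]. specialize (HN (S N) ltac:(lia)).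
    rewrite Rabs_right in HN; [lra|]. apply Rle_ge, pow_le. lra. }
  destruct Hj as [j [Hj1 Hj]].
  set (k := (m + j - 1)%nat). assert (Ek : S k = (m + j)%nat) by (unfold k; lia).
  destruct (Taylor_split F k HF) as [a [G [HG E]]].
  assert (Hz : exists zs, G zs <> 0%C).
  { apply NNPP. intros H. apply (Hnp k a). intros z. rewrite E.
    assert (Z : G z = 0%C) by (apply NNPP; intros N; apply H; exists z; auto). rewrite Z. ring. }
  destruct Hz as [zs Hzs]. set (c := Cmod (G zs)). assert (Pc : 0 < c) by (apply Cmod_gt_0; auto).
  destruct (Cpoly_bound k a) as [A [PA HA]].
  destruct (root_prod_size rs) as [R2 [HR2 Hsize]]. fold m in Hsize.
  set (R1 := Rmax (Rmax R0 R2) (Rmax (Cmod zs) (2 * A / c))).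
  assert (B0 : R0 <= R1) by (eapply Rle_trans; [|apply Rmax_l]; apply Rmax_l).
  assert (B2 : R2 <= R1) by (eapply Rle_trans; [|apply Rmax_l]; apply Rmax_r).
  assert (B3 : Cmod zs <= R1) by (eapply Rle_trans; [|apply Rmax_r]; apply Rmax_l).
  assert (B4 : forall r, R1 <= r -> 2 * A <= c * r).
  { intros r Hr. assert (2 * A / c <= r).
    { eapply Rle_trans; [|exact Hr]. eapply Rle_trans; [|apply Rmax_r]. apply Rmax_r. }
    apply (Rmult_le_compat_r c) in H; [|lra].
    replace (2 * A / c * c) with (2 * A) in H by (field; lra). lra. }
  clearbody R1.
  assert (Pw2 : 0 < 2 ^ m) by (apply pow_lt; lra).
  (* [w] is a maximum point of [|G|] on the circle: there the polynomial is at most half of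
     [w ^ (k + 1) G w] *)
  assert (Up : forall rho, R1 <= rho -> exists w, Cmod w = rho /\ c <= Cmod (G w) /\
     (forall z, Cmod z <= rho -> Cmod (G z) <= Cmod (G w)) /\
     rho ^ j * Cmod (G w) <= 2 * 2 ^ m * Cmod (g w)).
  { intros rho Hrho.
    destruct (max_modulus_principle G (RtoC 0) rho) as [w [Hw Hmax]]; [lra| |].
    { intros z _. exists 1. split; [lra|]. intros v _. apply HG. }
    assert (S0 : forall z, (z - 0)%C = z) by (intros; ring).
    rewrite S0 in Hw. exists w. split; auto.
    assert (Hmax' : forall z, Cmod z <= rho -> Cmod (G z) <= Cmod (G w)).
    { intros z Hz. apply Hmax. rewrite S0. auto. }
    assert (Hc : c <= Cmod (G w)) by (apply Hmax'; lra).
    split; auto. split; auto.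
    assert (X1 : Cmod (Cpow w (S k) * G w) <= Cmod (F w) + Cmod (Cpoly k a w)).
    { replace (Cpow w (S k) * G w)%C with (F w - Cpoly k a w)%C by (rewrite E; ring).
      apply Cmod_triangle_sub. }
    rewrite Cmod_mult, Cmod_pow, Hw in X1.
    specialize (HA w ltac:(lra)). rewrite Hw in HA.
    destruct (Hsize w ltac:(lra)) as [_ Hs]. rewrite Hw in Hs.
    assert (X2 : Cmod (F w) <= (2 * rho) ^ m * Cmod (g w)).
    { rewrite HE by lra. rewrite Cmod_mult. apply Rmult_le_compat_r; auto. apply Cmod_ge_0. }
    specialize (B4 rho Hrho).
    assert (Pk : 0 < rho ^ k) by (apply pow_lt; lra).
    assert (X3 : A * rho ^ k <= rho ^ S k * Cmod (G w) / 2).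
    { simpl. assert (c * rho <= rho * Cmod (G w)) by nra. nra. }
    rewrite Rpow_mult_distr in X2. rewrite Ek, pow_add in X1, X3.
    assert (Pm : 0 < rho ^ m) by (apply pow_lt; lra).
    apply (Rmult_le_reg_l (rho ^ m)); auto. lra. }
  exists R1, (c / (2 * 2 ^ m)).
  split; [lra|]. split; [apply Rdiv_lt_0_compat; lra|]. split; [auto|]. split.
  - intros rho Hrho. destruct (Up rho Hrho) as [w [Hw [Hc [_ Hg]]]]. exists w. split; auto.
    apply (Rmult_le_reg_r (2 * 2 ^ m)); [lra|].
    replace (c / (2 * 2 ^ m) * rho * (2 * 2 ^ m)) with (rho * c) by (field; lra).
    assert (rho <= rho ^ j).
    { destruct j; [lia|]. simpl. assert (1 <= rho ^ j) by (apply pow_R1_Rle; lra). nra. }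
    assert (rho * c <= rho ^ j * Cmod (G w)) by (apply Rmult_le_compat; lra). lra.
  - intros z rho Hz Hrho. destruct (Up rho ltac:(lra)) as [w [Hw [Hc [Hmax Hg]]]].
    exists w. split; auto. set (r := Cmod z) in *.
    specialize (Hmax z ltac:(fold r; lra)).
    assert (X1 : Cmod (F z) <= A * r ^ k + r ^ S k * Cmod (G w)).
    { rewrite E. eapply Rle_trans; [apply Cmod_triangle|]. apply Rplus_le_compat; [apply HA; fold r; lra|].
      rewrite Cmod_mult, Cmod_pow. fold r. apply Rmult_le_compat_l; auto. apply pow_le; lra. }
    specialize (B4 r Hz).
    assert (Pk : 0 < r ^ k) by (apply pow_lt; lra).
    assert (X3 : A * r ^ k <= r ^ S k * Cmod (G w)).
    { simpl. assert (c * r <= r * Cmod (G w)) by nra. nra. }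
    destruct (Hsize z ltac:(fold r; lra)) as [Hs _]. fold r in Hs.
    assert (X2 : (r / 2) ^ m * Cmod (g z) <= Cmod (F z)).
    { rewrite HE by (fold r; lra). rewrite Cmod_mult. apply Rmult_le_compat_r; auto. apply Cmod_ge_0. }
    rewrite Ek, pow_add in X1, X3. unfold Rdiv in X2. rewrite Rpow_mult_distr, pow_inv in X2.
    assert (Pm : 0 < r ^ m) by (apply pow_lt; lra).
    assert (X4 : Cmod (g z) <= 2 * 2 ^ m * (r ^ j * Cmod (G w))).
    { apply (Rmult_le_reg_l (r ^ m * / 2 ^ m)).
      - apply Rmult_lt_0_compat; auto. apply Rinv_0_lt_compat; auto.
      - replace (r ^ m * / 2 ^ m * (2 * 2 ^ m * (r ^ j * Cmod (G w)))) with (2 * (r ^ m * r ^ j * Cmod (G w))) by (field; lra).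
        lra. }
    assert (X5 : (2 * r) ^ j <= rho ^ j) by (apply pow_incr; lra).
    rewrite Rpow_mult_distr in X5.
    assert (Pj : 0 < r ^ j) by (apply pow_lt; lra).
    replace (4 ^ m) with (2 ^ m * 2 ^ m) in Hj.
    2: { rewrite <- Rpow_mult_distr. replace (2 * 2) with 4 by ring. reflexivity. }
    set (X := Cmod (G w)) in *. assert (PX : 0 < X) by lra.
    assert (PrX : 0 < r ^ j * X) by (apply Rmult_lt_0_compat; auto).
    apply (Rmult_le_reg_l (2 * 2 ^ m)); [lra|].
    apply Rle_trans with (rho ^ j * X); [|exact Hg].
    apply Rle_trans with (2 ^ j * r ^ j * X); [|apply Rmult_le_compat_r; lra].
    apply Rle_trans with (L * 4 * (2 ^ m * 2 ^ m) * (r ^ j * X)); [|nra].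
    replace (L * 4 * (2 ^ m * 2 ^ m) * (r ^ j * X)) with (2 * 2 ^ m * (L * (2 * 2 ^ m * (r ^ j * X)))) by ring.
    apply Rmult_le_compat_l; [lra|]. apply Rmult_le_compat_l; lra.
Qed.

(** * The Ahlfors-Schwarz lemma for six omitted values *)

(** For [xs] the distances from [g z] to the omitted values, [density xs] is the fourth power of
    the conformal factor of a metric, and [|g'| ^ 2 * curv xs] is the Laplacian of
    [ln (density xs)]. *)
Definition density (xs : list R) : R := fold_right (fun x acc => (1 + x) / (x * x) * acc) 1 xs.
Definition curv (xs : list R) : R := fold_right (fun x acc => / (x * (1 + x) ^ 2) + acc) 0 xs.

Lemma density_app (xs ys : list R) : density (xs ++ ys) = density xs * density ys.
Proof. induction xs; simpl; [ring|]. rewrite IHxs. ring. Qed.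

Lemma curv_app (xs ys : list R) : curv (xs ++ ys) = curv xs + curv ys.
Proof. induction xs; simpl; [ring|]. rewrite IHxs. ring. Qed.

Lemma density_pos (xs : list R) : (forall x, In x xs -> 0 < x) -> 0 < density xs.
Proof.
  induction xs; simpl; intros H; [lra|]. apply Rmult_lt_0_compat; [|auto].
  specialize (H a (or_introl eq_refl)). apply Rdiv_lt_0_compat; nra.
Qed.

Lemma curv_nonneg (xs : list R) : (forall x, In x xs -> 0 < x) -> 0 <= curv xs.
Proof.
  induction xs; simpl; intros H; [lra|]. apply Rplus_le_le_0_compat; [|auto].
  specialize (H a (or_introl eq_refl)). left. apply Rinv_0_lt_compat. nra.
Qed.

Lemma density_le (xs : list R) (B : R) : 0 <= B ->
  (forall x, In x xs -> 0 < x /\ (1 + x) / (x * x) <= B) -> density xs <= B ^ length xs.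
Proof.
  intros HB. induction xs; simpl; intros H; [lra|].
  destruct (H a (or_introl eq_refl)) as [Pa Ba].
  apply Rmult_le_compat; auto.
  - left. apply Rdiv_lt_0_compat; nra.
  - left. apply density_pos. intros x Hx. apply H. auto.
Qed.

Lemma density_ge (xs : list R) (B : R) : 0 <= B ->
  (forall x, In x xs -> B <= (1 + x) / (x * x)) -> B ^ length xs <= density xs.
Proof.
  intros HB. induction xs; simpl; intros H; [lra|].
  apply Rmult_le_compat; auto. apply pow_le; auto.
Qed.

Lemma list_min (xs : list R) : xs <> nil ->
  exists l1 x l2, xs = l1 ++ x :: l2 /\ forall y, In y xs -> x <= y.
Proof.
  intros N. assert (Hm : exists x, In x xs /\ forall y, In y xs -> x <= y).
  { induction xs as [|a xs IH]; [congruence|]. destruct xs as [|b xs].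
    - exists a. split; [left; auto|]. intros y [->|[]]. lra.
    - destruct IH as [x [Hx H]]; [discriminate|]. destruct (Rle_dec a x).
      + exists a. split; [left; auto|]. intros y [->|Hy]; [lra|]. specialize (H y Hy). lra.
      + exists x. split; [right; auto|]. intros y [->|Hy]; [lra|]. auto. }
  destruct Hm as [x [Hx H]]. destruct (in_split x xs Hx) as [l1 [l2 E]].
  exists l1, x, l2. auto.
Qed.

(** Six points make both sides decay like [x ^ (-6)] at infinity, and near one of
    the points both blow up like [x ^ (-2)]. *)
Lemma density_le_curv (xs : list R) : length xs = 6%nat -> (forall x, In x xs -> 0 < x) ->
  (forall l1 x l2, xs = l1 ++ x :: l2 -> x < / 2 -> forall y, In y (l1 ++ l2) -> / 2 <= y) ->
  density xs <= (243 * curv xs) ^ 2.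
Proof.
  intros Hlen Hpos Hsep.
  destruct (list_min xs) as [l1 [x [l2 [E Hmin]]]]; [intros ->; discriminate|].
  assert (Px : 0 < x) by (apply Hpos; rewrite E; apply in_elt).
  assert (Hin : forall y, In y (l1 ++ l2) -> In y xs).
  { intros y Hy. rewrite E. apply in_app_iff. apply in_app_iff in Hy. simpl. tauto. }
  assert (C1 : / (x * (1 + x) ^ 2) <= curv xs).
  { rewrite E, curv_app. simpl curv.
    pose proof (curv_nonneg l1 (fun y Hy => Hpos y (Hin y (proj2 (in_app_iff _ _ _) (or_introl Hy))))).
    pose proof (curv_nonneg l2 (fun y Hy => Hpos y (Hin y (proj2 (in_app_iff _ _ _) (or_intror Hy))))).
    simpl. lra. }
  assert (Pq : 0 < / (x * (1 + x) ^ 2)) by (apply Rinv_0_lt_compat; nra).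
  apply Rle_trans with ((243 * / (x * (1 + x) ^ 2)) ^ 2).
  2: { apply pow_incr. nra. }
  assert (Hl : length (l1 ++ l2) = 5%nat).
  { rewrite E, length_app in Hlen. simpl in Hlen. rewrite length_app. lia. }
  destruct (Rlt_dec x (/ 2)) as [Hx|Hx].
  - assert (D : density xs = (1 + x) / (x * x) * density (l1 ++ l2)).
    { rewrite E, !density_app. simpl. ring. }
    assert (B : density (l1 ++ l2) <= 6 ^ 5).
    { rewrite <- Hl. apply density_le; [lra|]. intros y Hy.
      pose proof (Hsep l1 x l2 E Hx y Hy). split; [lra|].
      apply (Rmult_le_reg_r (y * y)); [nra|]. unfold Rdiv. rewrite Rmult_assoc, Rinv_l by nra. nra. }
    rewrite D. apply Rle_trans with ((1 + x) / (x * x) * 6 ^ 5).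
    { apply Rmult_le_compat_l; auto. left. apply Rdiv_lt_0_compat; nra. }
    apply (Rmult_le_reg_r (x ^ 2 * (1 + x) ^ 4)).
    { apply Rmult_lt_0_compat; apply pow_lt; lra. }
    replace ((1 + x) / (x * x) * 6 ^ 5 * (x ^ 2 * (1 + x) ^ 4)) with (7776 * (1 + x) ^ 5) by (field; lra).
    replace ((243 * / (x * (1 + x) ^ 2)) ^ 2 * (x ^ 2 * (1 + x) ^ 4)) with 59049 by (field; lra).
    assert ((1 + x) ^ 5 <= (3 / 2) ^ 5) by (apply pow_incr; lra). lra.
  - assert (B : density xs <= (3 / x) ^ 6).
    { rewrite <- Hlen. apply density_le; [left; apply Rdiv_lt_0_compat; lra|].
      intros y Hy. pose proof (Hmin y Hy). split; [lra|].
      apply Rle_trans with (3 / y).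
      - apply (Rmult_le_reg_r (y * y)); [nra|]. unfold Rdiv. rewrite Rmult_assoc, Rinv_l by nra.
        rewrite Rmult_assoc. replace (/ y * (y * y)) with y by (field; lra). lra.
      - apply Rmult_le_compat_l; [lra|]. apply Rinv_le_contravar; lra. }
    eapply Rle_trans; [exact B|].
    apply (Rmult_le_reg_r (x ^ 6 * (1 + x) ^ 4)).
    { apply Rmult_lt_0_compat; apply pow_lt; lra. }
    replace ((3 / x) ^ 6 * (x ^ 6 * (1 + x) ^ 4)) with (729 * (1 + x) ^ 4) by (field; lra).
    replace ((243 * / (x * (1 + x) ^ 2)) ^ 2 * (x ^ 6 * (1 + x) ^ 4)) with (59049 * x ^ 4) by (field; lra).
    assert ((1 + x) ^ 4 <= (3 * x) ^ 4) by (apply pow_incr; lra).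
    rewrite Rpow_mult_distr in H. lra.
Qed.

Definition separated (s : R) : list C -> Prop := ForallOrdPairs (fun v w => s <= Cmod (v - w)).

Lemma separated_split (s : R) (l1 l2 : list C) (w v : C) :
  separated s (l1 ++ w :: l2) -> In v (l1 ++ l2) -> s <= Cmod (v - w).
Proof.
  induction l1 as [|a l1 IH]; simpl; intros H Hv.
  - inversion H; subst. rewrite Cmod_sub_sym. eapply Forall_forall in H2; eauto.
  - inversion H; subst. destruct Hv as [->|Hv]; auto.
    eapply Forall_forall in H2; [exact H2|]. apply in_elt.
Qed.

Lemma map_split {T U : Type} (f : T -> U) (l : list T) : forall (l1 : list U) (x : U) (l2 : list U),
  map f l = l1 ++ x :: l2 -> exists k1 w k2, l = k1 ++ w :: k2 /\ l1 = map f k1 /\ x = f w /\ l2 = map f k2.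
Proof.
  induction l as [|a l IH]; intros [|b l1] x l2 E; simpl in E; try discriminate.
  - injection E as E1 E2. exists nil, a, l. auto.
  - injection E as E1 E2. destruct (IH _ _ _ E2) as [k1 [w [k2 [H1 [H2 [H3 H4]]]]]].
    exists (a :: k1), w, k2. subst. auto.
Qed.

Definition dists (ws : list C) (v : C) : list R := map (fun w => Cmod (v - w)) ws.

Lemma dists_pos (ws : list C) (v : C) : ~ In v ws -> forall x, In x (dists ws v) -> 0 < x.
Proof.
  intros Hv x Hx. apply in_map_iff in Hx. destruct Hx as [w [<- Hw]]. apply Cmod_sub_pos. congruence.
Qed.

Lemma density_le_curv_dists (ws : list C) (v : C) : length ws = 6%nat -> separated 1 ws -> ~ In v ws ->
  density (dists ws v) <= (243 * curv (dists ws v)) ^ 2.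
Proof.
  intros Hlen Hsep Hv. apply density_le_curv.
  - unfold dists. rewrite length_map. auto.
  - apply dists_pos. exact Hv.
  - intros l1 x l2 E Hx y Hy. unfold dists in E. apply map_split in E.
    destruct E as [k1 [w [k2 [E [-> [-> ->]]]]]]. rewrite <- map_app in Hy.
    apply in_map_iff in Hy. destruct Hy as [u [<- Hu]].
    rewrite E in Hsep. pose proof (separated_split 1 k1 k2 w u Hsep Hu).
    pose proof (Cmod_sub_triangle u v w). rewrite (Cmod_sub_sym u v) in H0. lra.
Qed.

Lemma is_derive_ln1exp (x : R) : is_derive (fun t => ln (1 + exp t)) x (exp x / (1 + exp x)).
Proof.
  assert (0 < exp x) by apply exp_pos. auto_derive; [lra|]. field. lra.
Qed.

Lemma is_derive_ln1exp2 (x : R) : is_derive (fun t => exp t / (1 + exp t)) x (exp x / (1 + exp x) ^ 2).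
Proof.
  assert (0 < exp x) by apply exp_pos. auto_derive; [lra|]. field. lra.
Qed.

Lemma dC_minus_const (g : C -> C) (w z : C) : hol g z -> dC (fun v => g v - w)%C z = dC g z.
Proof.
  intros H. apply dC_eq. apply (cder_eq _ _ (dC g z - 0)%C); [|ring].
  apply cder_minus; [apply dC_cder; auto|apply cder_const].
Qed.

Lemma Cmod_sqr_div (a b : C) : b <> 0%C ->
  fst (a / b)%C * fst (a / b)%C + - snd (a / b)%C * - snd (a / b)%C = Cmod a ^ 2 / Cmod b ^ 2.
Proof.
  intros N. assert (P : 0 < Cmod b) by (apply Cmod_gt_0; auto).
  replace (Cmod a ^ 2 / Cmod b ^ 2) with (Cmod (a / b) ^ 2).
  - rewrite Cmod_sqr. ring.
  - rewrite Cmod_div by auto. field. lra.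
Qed.

(** [x] is written as [exp (ln x)] because [ln x] is harmonic and [ln (1 + exp t)] is a
    convex function of [t]. *)
Lemma lap_density_factor (g : C -> C) (w z : C) (r : R) : 0 < r -> hol_disc g z r -> g z <> w ->
  exists p q, has_lap (fun v => ln (1 + exp (ln (Cmod (g v - w)))) + (-2) * ln (Cmod (g v - w))) z p q
    (Cmod (dC g z) ^ 2 * / (Cmod (g z - w) * (1 + Cmod (g z - w)) ^ 2)).
Proof.
  intros Hr Hg N.
  assert (Hz : hol g z) by (apply Hg; rewrite Cmod_sub_self; auto).
  assert (Hh : hol_disc (fun v => g v - w)%C z r).
  { intros v Hv. apply hol_minus; [apply Hg; auto|apply hol_const]. }
  assert (L := lap_ln_Cmod _ z r Hr Hh (Csub_neq _ _ N)). cbv beta in L.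
  rewrite dC_minus_const in L by auto.
  assert (L1 := has_lap_comp _ _ _ 1 _ _ _ _ _ Rlt_0_1 (fun x _ => is_derive_ln1exp x) (is_derive_ln1exp2 _) L).
  assert (L2 := has_lap_plus _ _ _ _ _ _ _ _ _ L1 (has_lap_scal (-2) _ _ _ _ _ L)).
  cbv beta in L2. eexists. eexists.
  assert (P : 0 < Cmod (g z - w)) by (apply Cmod_sub_pos; auto).
  match type of L2 with has_lap _ _ _ _ ?X =>
    match goal with |- has_lap _ _ _ _ ?Y => replace Y with X end end; [exact L2|].
  rewrite exp_ln by auto.
  rewrite Cmod_sqr_div by (apply Csub_neq; auto). field. lra.
Qed.

Lemma lap_ln_density (g : C -> C) (ws : list C) (z : C) (r : R) : 0 < r -> hol_disc g z r ->
  (forall v, Cmod (v - z) < r -> ~ In (g v) ws) ->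
  exists u p q, has_lap u z p q (Cmod (dC g z) ^ 2 * curv (dists ws (g z))) /\
    forall v, Cmod (v - z) < r -> u v = ln (density (dists ws (g v))).
Proof.
  intros Hr Hg. induction ws as [|w ws IH]; intros Hws.
  - exists (fun v => 0 * Cmod (g v) ^ 2). eexists. eexists. split.
    + match goal with |- has_lap _ _ _ _ ?Y => replace Y with (0 * (4 * Cmod (dC g z) ^ 2)) by (simpl; ring) end.
      apply has_lap_scal. apply (lap_Cmod_sqr g z r); auto.
    + intros v _. simpl. rewrite ln_1. ring.
  - destruct IH as [u [p [q [Hu E]]]].
    { intros v Hv H. apply (Hws v Hv). right. auto. }
    destruct (lap_density_factor g w z r Hr Hg) as [p' [q' Hw]].
    { intros E'. apply (Hws z); [rewrite Cmod_sub_self; auto|]. left. auto. }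
    eexists. eexists. eexists. split.
    + match goal with |- has_lap _ _ _ _ ?Y => replace Y with
        (Cmod (dC g z) ^ 2 * / (Cmod (g z - w) * (1 + Cmod (g z - w)) ^ 2) +
         Cmod (dC g z) ^ 2 * curv (dists ws (g z))) by (simpl; ring) end.
      apply has_lap_plus; [exact Hw|exact Hu].
    + intros v Hv. cbv beta. rewrite E by auto. simpl.
      assert (N : g v <> w) by (intros E'; apply (Hws v Hv); left; auto).
      assert (P : 0 < Cmod (g v - w)) by (apply Cmod_sub_pos; auto).
      assert (PD : 0 < density (dists ws (g v))).
      { apply density_pos, dists_pos. intros Hi. apply (Hws v Hv). right. exact Hi. }
      rewrite ln_mult; auto; [|apply Rdiv_lt_0_compat; nra].
      assert (PP : 0 < Cmod (g v - w) * Cmod (g v - w)) by (apply Rmult_lt_0_compat; auto).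
      rewrite exp_ln by auto. unfold Rdiv.
      rewrite (ln_mult (1 + Cmod (g v - w))), ln_Rinv, (ln_mult (Cmod (g v - w))); auto; [ring|lra|].
      apply Rinv_0_lt_compat. auto.
Qed.

Lemma rcont_density (g : C -> C) (ws : list C) (z : C) : ccont g z -> ~ In (g z) ws ->
  rcont (fun v => density (dists ws (g v))) z.
Proof.
  intros Hg. induction ws as [|w ws IH]; intros N; simpl; [apply rcont_const|].
  apply rcont_mult; [|apply IH; intros H; apply N; right; auto].
  assert (P : 0 < Cmod (g z - w)) by (apply Cmod_sub_pos; intros E; apply N; left; auto).
  apply (rcont_comp (fun x => (1 + x) / (x * x)) (fun v => Cmod (g v - w))).
  - apply (ex_derive_continuous (V := R_NormedModule)). auto_derive. nra.
  - apply (rcont_Cmod (fun v => g v - w)%C). apply ccont_minus; auto. apply ccont_const.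
Qed.

Lemma lap_ln_disc (z0 z : C) (s : R) : Cmod (z - z0) < s ->
  exists p q, has_lap (fun v => ln (s ^ 2 + (-1) * Cmod (v - z0) ^ 2)) z p q
    (- (4 * s ^ 2) / (s ^ 2 - Cmod (z - z0) ^ 2) ^ 2).
Proof.
  intros Hz. pose proof (Cmod_ge_0 (z - z0)%C) as P.
  assert (T : 0 < s ^ 2 - Cmod (z - z0) ^ 2) by nra.
  assert (D1 : dC (fun v => v - z0)%C z = RtoC 1).
  { apply dC_eq. apply (cder_eq _ _ (1 - 0)%C); [|ring]. apply cder_minus; [apply cder_id|apply cder_const]. }
  assert (L := lap_Cmod_sqr (fun v => v - z0)%C z 1 Rlt_0_1 (fun v _ => hol_sub_const z0 v)).
  cbv beta in L. rewrite D1, Cmod_1 in L.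
  assert (H1 : forall x, Rabs (x - Cmod (z - z0) ^ 2) < s ^ 2 - Cmod (z - z0) ^ 2 ->
     is_derive (fun t => ln (s ^ 2 + (-1) * t)) x (- / (s ^ 2 - x))).
  { intros x Hx. apply Rabs_def2 in Hx. auto_derive; [lra|]. field. lra. }
  assert (H2 : is_derive (fun x => - / (s ^ 2 - x)) (Cmod (z - z0) ^ 2) (- / (s ^ 2 - Cmod (z - z0) ^ 2) ^ 2)).
  { auto_derive; [lra|]. field. lra. }
  assert (L' := has_lap_comp _ _ _ _ _ _ _ _ _ T H1 H2 L). cbv beta in L'.
  eexists. eexists.
  match type of L' with has_lap _ _ _ _ ?X =>
    match goal with |- has_lap _ _ _ _ ?Y => replace Y with X end end; [exact L'|].
  assert (E := Cmod_sqr (z - z0)%C). 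
  set (x := fst (z - z0)%C) in *. set (y := snd (z - z0)%C) in *. rewrite E in T |- *.
  simpl fst. simpl snd. field. lra.
Qed.

(** The Ahlfors-Schwarz lemma for the metric [density ^ (1/4) |dw|]: at a
    maximum of [U] the Laplacian of [ln U] bounds the metric. *)
Lemma Ahlfors_estimate (g : C -> C) (ws : list C) (z0 : C) (s : R) : 0 < s ->
  (forall z, Cmod (z - z0) <= s -> exists del, 0 < del /\ hol_disc g z del /\
     forall v, Cmod (v - z) < del -> ~ In (g v) ws) ->
  length ws = 6%nat -> separated 1 ws ->
  Cmod (dC g z0) ^ 4 * density (dists ws (g z0)) * s ^ 4 <= 3888 ^ 2.
Proof.
  intros Hs Hloc Hlen Hsep.
  set (T := fun z => s ^ 2 + (-1) * Cmod (z - z0) ^ 2).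
  set (U := fun z => Cmod (dC g z) ^ 4 * density (dists ws (g z)) * T z ^ 4).
  assert (Hat : forall z, Cmod (z - z0) <= s -> hol g z /\ hol (dC g) z /\ ~ In (g z) ws).
  { intros z Hz. destruct (Hloc z Hz) as [d [Hd [H1 H2]]].
    assert (Hz0 : Cmod (z - z) < d) by (rewrite Cmod_sub_self; auto).
    split; [auto|split; auto]. apply (hol_disc_dC g z d H1 z Hz0). }
  destruct (max_attained U (fun z => Cmod (z - z0) <= s) (s + Cmod z0)) as [y [Hy Hmax]].
  - exists z0. rewrite Cmod_sub_self. lra.
  - intros z Hz. pose proof (Cmod_le_add z z0). lra.
  - intros z Hz. apply disc_complement_open. exact Hz.
  - intros z Hz. destruct (Hat z Hz) as [H1 [H2 H3]].
    apply rcont_mult; [apply rcont_mult|].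
    + apply rcont_pow, rcont_Cmod, hol_ccont. auto.
    + apply rcont_density; auto. apply hol_ccont. auto.
    + apply rcont_pow. apply rcont_plus; [apply rcont_const|]. apply rcont_mult; [apply rcont_const|].
      apply rcont_pow. apply (rcont_Cmod (fun v => v - z0)%C), hol_ccont, hol_sub_const.
  - assert (Dpos : forall z, ~ In (g z) ws -> 0 < density (dists ws (g z))).
    { intros z Hz. apply density_pos, dists_pos. exact Hz. }
    assert (Goal' : U y <= 3888 ^ 2 * s ^ 4).
    { destruct (Hat y Hy) as [_ [_ Ny]]. assert (PD := Dpos y Ny).
      pose proof (Cmod_ge_0 (y - z0)%C) as Py.
      destruct (Req_dec (U y) 0) as [Z|NZ].
      { rewrite Z. apply Rmult_le_pos; apply pow_le; lra. }
      assert (Ng : dC g y <> 0%C).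
      { intros Z. apply NZ. unfold U. rewrite Z, Cmod_0. ring. }
      assert (Hlt : Cmod (y - z0) < s).
      { destruct (Rle_lt_or_eq_dec _ _ Hy) as [H|H]; auto. exfalso. apply NZ. unfold U, T. rewrite H. ring. }
      destruct (Hloc y Hy) as [d [Hd [Hg Hws]]].
      pose proof (hol_disc_dC g y d Hg) as Hg'.
      assert (Cg' : ccont (dC g) y) by (apply hol_ccont, Hg'; rewrite Cmod_sub_self; auto).
      destruct (ccont_away (dC g) y Cg' Ng) as [d1 [Hd1 Haw]].
      assert (L1 := has_lap_scal 4 _ _ _ _ _ (lap_ln_Cmod (dC g) y d Hd Hg' Ng)).
      destruct (lap_ln_density g ws y d Hd Hg Hws) as [u [p [q [L2 Eu]]]].
      destruct (lap_ln_disc z0 y s Hlt) as [p' [q' L3]].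
      assert (L := has_lap_plus _ _ _ _ _ _ _ _ _ (has_lap_plus _ _ _ _ _ _ _ _ _ L1 L2) (has_lap_scal 4 _ _ _ _ _ L3)).
      cbv beta in L.
      set (e := Rmin (Rmin d d1) (s - Cmod (y - z0))).
      assert (He : 0 < e) by (repeat apply Rmin_pos; lra).
      assert (E1 : e <= d) by (eapply Rle_trans; [apply Rmin_l|apply Rmin_l]).
      assert (E2 : e <= d1) by (eapply Rle_trans; [apply Rmin_l|apply Rmin_r]).
      assert (E3 : e <= s - Cmod (y - z0)) by apply Rmin_r.
      assert (Near : forall v, Cmod (v - y) < e ->
        4 * ln (Cmod (dC g v)) + u v + 4 * ln (s ^ 2 + -1 * Cmod (v - z0) ^ 2) = ln (U v) /\ 0 < U v).
      { intros v Hv.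
        assert (Pg : 0 < Cmod (dC g v)).
        { specialize (Haw v ltac:(lra)). pose proof (Cmod_ge_0 (dC g y)). lra. }
        assert (PDv : 0 < density (dists ws (g v))) by (apply Dpos, Hws; lra).
        assert (PT : 0 < T v).
        { unfold T. pose proof (Cmod_sub_triangle v y z0). pose proof (Cmod_ge_0 (v - z0)%C). nra. }
        fold (T v). rewrite Eu by lra. unfold U.
        assert (0 < Cmod (dC g v) ^ 4) by (apply pow_lt; auto).
        assert (0 < T v ^ 4) by (apply pow_lt; auto).
        assert (0 < Cmod (dC g v) ^ 4 * density (dists ws (g v))) by (apply Rmult_lt_0_compat; auto).
        split; [|apply Rmult_lt_0_compat; auto].
        rewrite (ln_mult (Cmod (dC g v) ^ 4 * density (dists ws (g v)))), (ln_mult (Cmod (dC g v) ^ 4)), !ln_pow by auto.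
        simpl INR. ring. }
      apply (has_lap_max _ _ _ _ _ e He) in L.
      2: { intros v Hv. destruct (Near v Hv) as [-> Pv].
           destruct (Near y) as [-> Pyy]; [rewrite Cmod_sub_self; auto|].
           apply Rcomplements.ln_le; auto. apply Hmax.
           pose proof (Cmod_sub_triangle v y z0). lra. }
      assert (PT : 0 < T y) by (unfold T; nra).
      assert (X : Cmod (dC g y) ^ 2 * curv (dists ws (g y)) * T y ^ 2 <= 16 * s ^ 2).
      { replace (s ^ 2 - Cmod (y - z0) ^ 2) with (T y) in L by (unfold T; ring).
        assert (P2 : 0 < T y ^ 2) by (apply pow_lt; auto).
        apply (Rmult_le_compat_r (T y ^ 2)) in L; [|lra].
        replace ((4 * 0 + Cmod (dC g y) ^ 2 * curv (dists ws (g y)) + 4 * (- (4 * s ^ 2) / T y ^ 2)) * T y ^ 2)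
          with (Cmod (dC g y) ^ 2 * curv (dists ws (g y)) * T y ^ 2 - 16 * s ^ 2) in L by (field; lra).
        lra. }
      assert (I := density_le_curv_dists ws (g y) Hlen Hsep Ny).
      unfold U.
      apply Rle_trans with (Cmod (dC g y) ^ 4 * (243 * curv (dists ws (g y))) ^ 2 * T y ^ 4).
      { apply Rmult_le_compat_r; [apply pow_le; lra|]. apply Rmult_le_compat_l; auto.
        apply pow_le, Cmod_ge_0. }
      replace (Cmod (dC g y) ^ 4 * (243 * curv (dists ws (g y))) ^ 2 * T y ^ 4)
        with (243 ^ 2 * (Cmod (dC g y) ^ 2 * curv (dists ws (g y)) * T y ^ 2) ^ 2) by ring.
      replace (3888 ^ 2 * s ^ 4) with (243 ^ 2 * (16 * s ^ 2) ^ 2) by ring.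
      apply Rmult_le_compat_l; [apply pow_le; lra|]. apply pow_incr. split; auto.
      apply Rmult_le_pos; [apply Rmult_le_pos|].
      - apply pow_le, Cmod_ge_0.
      - apply curv_nonneg, dists_pos. exact Ny.
      - apply pow_le. lra. }
    specialize (Hmax z0 ltac:(rewrite Cmod_sub_self; lra)).
    assert (E : U z0 = Cmod (dC g z0) ^ 4 * density (dists ws (g z0)) * s ^ 4 * s ^ 4).
    { unfold U, T. rewrite Cmod_sub_self. ring. }
    rewrite E in Hmax. apply (Rmult_le_reg_r (s ^ 4)); [apply pow_lt; auto|]. lra.
Qed.

(** * Omitted values on a circle *)

Lemma separated_map_scal (k : C) (s t : R) (ws : list C) : t <= Cmod k * s ->
  separated s ws -> separated t (map (fun w => k * w)%C ws).
Proof.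
  intros Ht H. induction H as [|w ws H1 H2 IH]; simpl; constructor; auto.
  apply Forall_forall. intros v Hv. apply in_map_iff in Hv. destruct Hv as [u [<- Hu]].
  eapply Forall_forall in H1; [|exact Hu].
  replace (k * w - k * u)%C with (k * (w - u))%C by ring. rewrite Cmod_mult.
  eapply Rle_trans; [exact Ht|]. apply Rmult_le_compat_l; auto. apply Cmod_ge_0.
Qed.

Lemma separated_map_seq (w : nat -> C) (s : R) (n : nat) : forall i,
  (forall j k, (i <= j)%nat -> (j < k)%nat -> (k < i + n)%nat -> s <= Cmod (w j - w k)) ->
  separated s (map w (seq i n)).
Proof.
  induction n as [|n IH]; intros i Hs; simpl; constructor.
  - apply Forall_forall. intros v Hv. apply in_map_iff in Hv. destruct Hv as [k [<- Hk]].
    apply in_seq in Hk. apply Hs; lia.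
  - apply IH. intros j k Hj Hjk Hk. apply Hs; lia.
Qed.

(** [Ahlfors_estimate] after division by [sig]: where [|g z0| <= T sig] the distances to the six
    values are at most [2 T sig], which bounds [density] from below. *)
Lemma Landau_bound (T : R) : 1 <= T -> exists A, 0 < A /\
  forall (g : C -> C) (ws : list C) (z0 : C) (s sig : R), 0 < s -> 0 < sig ->
    (forall z, Cmod (z - z0) < s -> hol g z /\ ~ In (g z) ws) ->
    length ws = 6%nat -> separated sig ws -> (forall w, In w ws -> Cmod w <= T * sig) ->
    Cmod (g z0) <= T * sig -> Cmod (dC g z0) * s <= A * sig.
Proof.
  intros HT. set (B := 3888 ^ 2 * (4 * T ^ 2) ^ 6).
  assert (T1 : 1 <= T ^ 2) by nra.
  assert (PT : 0 < (4 * T ^ 2) ^ 6) by (apply pow_lt; lra).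
  assert (HB : 1 <= B).
  { unfold B. assert (1 <= (4 * T ^ 2) ^ 6) by (apply pow_R1_Rle; lra). lra. }
  exists (2 * B). split; [lra|]. intros g ws z0 s sig Hs Hsig Hg Hlen Hsep Hw Hz.
  set (k := RtoC (/ sig)). assert (Pi : 0 < / sig) by (apply Rinv_0_lt_compat; auto).
  assert (Mk : Cmod k = / sig) by (unfold k; rewrite Cmod_R, Rabs_right; lra).
  assert (Nk : k <> 0%C) by (apply Cmod_gt_0; lra).
  set (h := fun z => (k * g z)%C). set (ws' := map (fun w => k * w)%C ws).
  assert (Bk : forall v, Cmod v <= T * sig -> Cmod (k * v) <= T).
  { intros v Hv. rewrite Cmod_mult, Mk. apply (Rmult_le_reg_l sig); auto.
    rewrite <- Rmult_assoc, Rinv_r, Rmult_1_l by lra. lra. }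
  assert (Hin : forall z, Cmod (z - z0) < s -> ~ In (h z) ws').
  { intros z Hz' Hi. apply in_map_iff in Hi. destruct Hi as [w [E Hi]].
    apply (proj2 (Hg z Hz')). replace (g z) with w; auto.
    replace w with (/ k * (k * w))%C by (field; auto). rewrite E. unfold h. field. auto. }
  assert (Hh : forall z, Cmod (z - z0) < s -> hol h z).
  { intros z Hz'. apply hol_mult; [apply hol_const|apply Hg; auto]. }
  assert (Dh : dC h z0 = (k * dC g z0)%C).
  { apply dC_eq. apply (cder_eq _ _ (0 * g z0 + k * dC g z0)%C); [|ring].
    apply (cder_mult (fun _ => k) g); [apply cder_const|]. apply dC_cder, Hg.
    rewrite Cmod_sub_self; auto. }
  assert (Est := Ahlfors_estimate h ws' z0 (s / 2) ltac:(lra)).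
  assert (Hs' : separated 1 ws').
  { apply (separated_map_scal k sig); auto. rewrite Mk, Rinv_l; lra. }
  specialize (Est ltac:(intros z Hz'; exists (s / 2); split; [lra|split; intros v Hv;
    pose proof (Cmod_sub_triangle v z z0); [apply Hh|apply Hin]; lra])
    ltac:(unfold ws'; rewrite length_map; auto) Hs').
  assert (Dn : (/ (4 * T ^ 2)) ^ 6 <= density (dists ws' (h z0))).
  { assert (E : length (dists ws' (h z0)) = 6%nat).
    { unfold dists, ws'. rewrite !length_map. auto. }
    rewrite <- E. apply density_ge; [left; apply Rinv_0_lt_compat; lra|].
    intros x Hx. apply in_map_iff in Hx. destruct Hx as [w [<- Hi]].
    assert (P : 0 < Cmod (h z0 - w)).
    { apply Cmod_sub_pos. intros E'. apply (Hin z0); [rewrite Cmod_sub_self; auto|]. rewrite E'. auto. }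
    assert (U : Cmod (h z0 - w) <= 2 * T).
    { pose proof (Cmod_triangle_sub (h z0) w). pose proof (Bk _ Hz).
      assert (Cmod w <= T). { apply in_map_iff in Hi. destruct Hi as [v [<- Hv]]. apply Bk. auto. }
      unfold h in *. lra. }
    set (x := Cmod (h z0 - w)) in *.
    apply Rle_trans with (/ (x * x)).
    - apply Rinv_le_contravar; [apply Rmult_lt_0_compat; auto|]. nra.
    - unfold Rdiv. assert (0 < / (x * x)) by (apply Rinv_0_lt_compat; apply Rmult_lt_0_compat; auto). nra. }
  rewrite Dh, Cmod_mult, Mk in Est. set (D := Cmod (dC g z0)) in *.
  assert (PD : 0 <= D) by apply Cmod_ge_0.
  set (y := / sig * D * (s / 2)).
  assert (Py : 0 <= y) by (unfold y; apply Rmult_le_pos; [apply Rmult_le_pos|]; lra).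
  assert (Y4 : y ^ 4 <= B).
  { apply (Rmult_le_reg_r ((/ (4 * T ^ 2)) ^ 6)); [apply pow_lt, Rinv_0_lt_compat; lra|].
    replace (B * (/ (4 * T ^ 2)) ^ 6) with (3888 ^ 2).
    2: { unfold B. rewrite pow_inv. field. lra. }
    eapply Rle_trans; [|exact Est].
    replace (y ^ 4) with ((/ sig * D) ^ 4 * (s / 2) ^ 4) by (unfold y; ring).
    assert (0 <= (/ sig * D) ^ 4) by (apply pow_le, Rmult_le_pos; lra).
    assert (0 <= (s / 2) ^ 4) by (apply pow_le; lra).
    assert (0 <= (/ sig * D) ^ 4 * (s / 2) ^ 4) by (apply Rmult_le_pos; auto). nra. }
  assert (Yb : y <= B).
  { apply Rnot_lt_le. intros H. assert (1 <= y ^ 3) by (apply pow_R1_Rle; lra).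
    assert (y * 1 <= y * y ^ 3) by (apply Rmult_le_compat_l; lra). simpl in *. lra. }
  unfold y in Yb. apply (Rmult_le_reg_l (/ sig)); auto.
  replace (/ sig * (2 * B * sig)) with (2 * B) by (field; lra). lra.
Qed.

Lemma is_derive_sqr_pos_part (x : R) : is_derive (fun t => Rmax 0 t ^ 2) x (2 * Rmax 0 x).
Proof.
  apply is_derive_Reals. intros e He. exists (mkposreal (e / 2) ltac:(lra)). intros h Hh Hd. simpl in Hd.
  replace ((Rmax 0 (x + h) ^ 2 - Rmax 0 x ^ 2) / h - 2 * Rmax 0 x)
    with ((Rmax 0 (x + h) ^ 2 - Rmax 0 x ^ 2 - 2 * Rmax 0 x * h) / h) by (field; auto).
  assert (B : Rabs (Rmax 0 (x + h) ^ 2 - Rmax 0 x ^ 2 - 2 * Rmax 0 x * h) <= h * h).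
  { unfold Rmax. destruct (Rle_dec 0 (x + h)), (Rle_dec 0 x); apply Rabs_le; split; nra. }
  assert (P : 0 < Rabs h) by (apply Rabs_pos_lt; auto).
  unfold Rdiv. rewrite Rabs_mult, Rabs_inv.
  apply (Rmult_lt_reg_r (Rabs h)); auto. rewrite Rmult_assoc, Rinv_l, Rmult_1_r by lra.
  eapply Rle_lt_trans; [exact B|]. rewrite <- (Rabs_right (h * h)) by nra. rewrite Rabs_mult. nra.
Qed.

(** The square of the positive part of [ln (al + be) - ln (al + phi)] has a
    bounded derivative everywhere, although [phi'] is only controlled below [be]. *)
Lemma slow_variation (phi dphi : R -> R) (al be K len t1 t2 : R) :
  0 < al -> 0 <= be -> 0 <= K -> (forall t, is_derive phi t (dphi t)) -> (forall t, 0 <= phi t) ->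
  (forall t, phi t <= be -> Rabs (dphi t) <= K * (al + phi t)) ->
  phi t1 <= al -> be <= phi t2 -> Rabs (t2 - t1) <= len ->
  ln (al + be) - ln al <= 8 * K * len + 2 * ln 2.
Proof.
  intros Ha Hb HK Hd Hpos Hbd H1 H2 Hlen.
  set (b := ln (al + be)). set (v := fun t => ln (al + phi t)).
  set (W := fun t => Rmax 0 (b - v t) ^ 2). set (D := b - ln al).
  assert (Dv : forall t, is_derive v t (dphi t / (al + phi t))).
  { intros t. specialize (Hpos t).
    assert (D1 : is_derive (fun s => al + phi s) t (0 + dphi t)).
    { apply is_derive_plus_R; auto. exact (is_derive_const (V := R_NormedModule) al t). }
    assert (D2 : is_derive ln (al + phi t) (/ (al + phi t))) by (apply is_derive_ln; lra).
    pose proof (is_derive_comp_R ln (fun s => al + phi s) t _ _ D2 D1) as D3.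
    replace (dphi t / (al + phi t)) with ((0 + dphi t) * / (al + phi t)) by (unfold Rdiv; ring). exact D3. }
  set (dW := fun t => (-1 * (dphi t / (al + phi t))) * (2 * Rmax 0 (b - v t))).
  assert (DW : forall t, is_derive W t (dW t)).
  { intros t. apply (is_derive_comp_R (fun x => Rmax 0 x ^ 2) (fun s => b - v s)); [apply is_derive_sqr_pos_part|].
    assert (D1 : is_derive (fun s => b + -1 * v s) t (0 + -1 * (dphi t / (al + phi t)))).
    { apply is_derive_plus_R; [exact (is_derive_const (V := R_NormedModule) b t)|]. apply is_derive_scal_R. auto. }
    rewrite Rplus_0_l in D1. refine (is_derive_ext _ _ _ _ _ D1). intros s. simpl. ring. }
  assert (D0 : 0 <= D).
  { unfold D, b. assert (ln al <= ln (al + be)) by (apply Rcomplements.ln_le; lra). lra. }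
  assert (BW : forall t, Rabs (dW t) <= 2 * D * K).
  { intros t. specialize (Hpos t). unfold dW.
    assert (Lv : ln al <= v t) by (apply Rcomplements.ln_le; lra).
    unfold Rmax. destruct (Rle_dec 0 (b - v t)) as [H|H].
    - assert (Pb : phi t <= be).
      { assert (al + phi t <= al + be); [|lra]. apply Rnot_lt_le. intros Hl.
        apply ln_increasing in Hl; [|lra]. fold (v t) b in Hl. lra. }
      specialize (Hbd t Pb). rewrite !Rabs_mult. rewrite (Rabs_left (-1)), (Rabs_right 2), (Rabs_right (b - v t)) by lra.
      assert (Q : Rabs (dphi t / (al + phi t)) <= K).
      { unfold Rdiv. rewrite Rabs_mult, (Rabs_right (/ (al + phi t))).
        - apply (Rmult_le_reg_r (al + phi t)); [lra|]. rewrite Rmult_assoc, Rinv_l by lra. lra.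
        - apply Rle_ge. left. apply Rinv_0_lt_compat. lra. }
      pose proof (Rabs_pos (dphi t / (al + phi t))).
      assert (b - v t <= D) by (unfold D; lra). nra.
    - rewrite Rmult_0_r, Rmult_0_r, Rabs_R0. apply Rmult_le_pos; lra. }
  destruct (MVT_gen W t1 t2 dW) as [xi [_ E]].
  { intros; auto. }
  { intros t _. apply derivable_continuous_pt. exists (dW t). apply is_derive_Reals. auto. }
  assert (W2 : W t2 = 0).
  { unfold W. rewrite Rmax_left; [ring|]. assert (b <= v t2) by (apply Rcomplements.ln_le; lra). lra. }
  assert (V1 : v t1 <= ln 2 + ln al).
  { rewrite <- ln_mult by lra. apply Rcomplements.ln_le; [specialize (Hpos t1)|]; lra. }
  assert (L2 : 0 < ln 2) by (rewrite <- ln_1; apply ln_increasing; lra).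
  apply Rnot_lt_le. intros Hlt.
  fold D in Hlt.
  pose proof (Rabs_pos (t2 - t1)) as PL.
  assert (KL : 0 <= K * len) by (apply Rmult_le_pos; lra).
  assert (W1 : (D / 2) ^ 2 <= W t1).
  { unfold W. apply pow_incr. split; [lra|]. eapply Rle_trans; [|apply Rmax_r]. unfold D in *. lra. }
  assert (X : W t1 <= 2 * D * K * len).
  { rewrite W2 in E. replace (W t1) with (- (dW xi * (t2 - t1))) by lra.
    eapply Rle_trans; [apply Rle_abs|]. rewrite Rabs_Ropp, Rabs_mult.
    apply Rmult_le_compat; auto; apply Rabs_pos. }
  assert (D * D <= D * (8 * (K * len))) by nra.
  nra.
Qed.

Lemma polar_form (z : C) (r : R) : 0 < r -> Cmod z = r ->
  exists t, 0 <= t <= 2 * PI /\ circ 0 r t = z.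
Proof.
  intros Hr Hz. pose proof PI_RGT_0.
  pose proof (Cmod_sqr z) as E. rewrite Hz in E. destruct z as [x y]. simpl fst in E; simpl snd in E.
  assert (Hx : -1 <= x / r <= 1).
  { assert (- r <= x <= r) by nra.
    split; apply (Rmult_le_reg_r r); auto; unfold Rdiv; rewrite Rmult_assoc, Rinv_l by lra; lra. }
  set (t := acos (x / r)).
  assert (Ht : 0 <= t <= PI) by apply acos_bound.
  assert (Ct : cos t = x / r) by (apply cos_acos; auto).
  assert (St : sin t = Rabs y / r).
  { unfold t. rewrite sin_acos by auto. apply sqrt_lem_1.
    - unfold Rsqr. nra.
    - apply Rmult_le_pos; [apply Rabs_pos|left; apply Rinv_0_lt_compat; auto].
    - unfold Rsqr. replace (Rabs y / r * (Rabs y / r)) with ((Rabs y * Rabs y) / (r * r)) by (field; lra).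
      rewrite <- Rabs_mult, Rabs_right by nra. replace (y * y) with (r * r - x * x) by lra. field. lra. }
  destruct (Rle_dec 0 y) as [Py|Py].
  - exists t. split; [lra|]. unfold circ. rewrite Ct, St, Rabs_right by lra.
    apply injective_projections; simpl; field; lra.
  - exists (2 * PI - t). split; [lra|].
    assert (C2 : cos (2 * PI - t) = x / r).
    { rewrite <- Ct. replace (2 * PI - t) with (- t + 2 * INR 1 * PI) by (simpl; ring).
      rewrite cos_period. apply cos_neg. }
    assert (S2 : sin (2 * PI - t) = y / r).
    { replace (2 * PI - t) with (- t + 2 * INR 1 * PI) by (simpl; ring).
      rewrite sin_period, sin_neg, St, Rabs_left by lra. field. lra. }
    unfold circ. rewrite C2, S2. apply injective_projections; simpl; field; lra.
Qed.

Lemma circle_modulus_variation (g : C -> C) (rho a b A : R) (z1 z2 : C) :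
  0 < rho -> 0 < a -> 0 <= b -> 0 <= A ->
  (forall z, Cmod z = rho -> hol g z /\ (Cmod (g z) <= b -> Cmod (dC g z) * rho <= A * (a + Cmod (g z)))) ->
  Cmod z1 = rho -> Cmod z2 = rho -> Cmod (g z1) <= a -> b <= Cmod (g z2) ->
  ln (a ^ 2 + b ^ 2) - ln (a ^ 2) <= 48 * A * PI + 2 * ln 2.
Proof.
  intros Hrho Ha Hb HA Hg Hz1 Hz2 H1 H2. pose proof PI_RGT_0.
  destruct (polar_form z1 rho Hrho Hz1) as [t1 [Ht1 E1]].
  destruct (polar_form z2 rho Hrho Hz2) as [t2 [Ht2 E2]].
  assert (Mc : forall t, Cmod (circ 0 rho t) = rho).
  { intros t. rewrite <- (Cmod_circ 0 rho t) at 2 by lra. f_equal. ring. }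
  set (phi := fun t => fst (g (circ 0 rho t)) * fst (g (circ 0 rho t)) + snd (g (circ 0 rho t)) * snd (g (circ 0 rho t))).
  assert (Ephi : forall t, phi t = Cmod (g (circ 0 rho t)) ^ 2).
  { intros t. rewrite Cmod_sqr. unfold phi. ring. }
  set (V := fun t => (dC g (circ 0 rho t) * (Ci * (circ 0 rho t - 0)))%C).
  assert (PV : forall t, pder (fun s => g (circ 0 rho s)) t (V t)).
  { intros t. apply (pder_comp g); [|apply circ_pder]. apply dC_cder. apply Hg. auto. }
  assert (MV : forall t, Cmod (V t) = Cmod (dC g (circ 0 rho t)) * rho).
  { intros t. unfold V. rewrite !Cmod_mult, Cmod_Ci, Cmod_circ by lra. ring. }
  set (dphi := fun t => 2 * (fst (V t) * fst (g (circ 0 rho t)) + snd (V t) * snd (g (circ 0 rho t)))).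
  assert (Hfin := slow_variation phi dphi (a ^ 2) (b ^ 2) (3 * A) (2 * PI) t1 t2).
  replace (48 * A * PI) with (8 * (3 * A) * (2 * PI)) by ring. apply Hfin; clear Hfin.
  - apply pow_lt; auto.
  - apply pow_le; auto.
  - lra.
  - intros t. specialize (PV t).
    pose proof (pder_fst _ _ _ PV) as D1. pose proof (pder_snd _ _ _ PV) as D2.
    pose proof (is_derive_plus_R _ _ _ _ _ (is_derive_mult_R _ _ _ _ _ D1 D1) (is_derive_mult_R _ _ _ _ _ D2 D2)) as D3.
    cbv beta in D3. unfold dphi, phi.
    match type of D3 with is_derive _ _ ?l => match goal with |- is_derive _ _ ?l' => replace l' with l by ring end end.
    exact D3.
  - intros t. rewrite Ephi. apply pow_le, Cmod_ge_0.
  - intros t. rewrite Ephi. intros Hle. unfold dphi.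
    set (u := circ 0 rho t) in *. pose proof (Cmod_ge_0 (g u)) as Pg.
    assert (Hle' : Cmod (g u) <= b) by nra.
    destruct (Hg u) as [_ Hbd]; [apply Mc|]. specialize (Hbd Hle'). fold u in MV.
    specialize (MV t). fold u in MV. rewrite <- MV in Hbd.
    assert (Cs : Rabs (fst (V t) * fst (g u) + snd (V t) * snd (g u)) <= Cmod (V t) * Cmod (g u)).
    { replace (fst (V t) * fst (g u) + snd (V t) * snd (g u)) with (fst (V t * Cconj (g u))%C) by (simpl; ring).
      eapply Rle_trans; [apply Re_le_Cmod|]. rewrite Cmod_mult, Cmod_conj. lra. }
    rewrite Rabs_mult, (Rabs_right 2) by lra.
    assert (Q : Cmod (V t) * Cmod (g u) <= A * (a + Cmod (g u)) * Cmod (g u)) by (apply Rmult_le_compat_r; auto).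
    assert (Sq : 2 * ((a + Cmod (g u)) * Cmod (g u)) <= 3 * (a ^ 2 + Cmod (g u) ^ 2)).
    { pose proof (Rle_0_sqr (a - Cmod (g u))). unfold Rsqr in *. nra. }
    apply (Rmult_le_compat_l A) in Sq; auto. lra.
  - rewrite Ephi, E1. apply pow_incr. split; auto. apply Cmod_ge_0.
  - rewrite Ephi, E2. apply pow_incr. lra.
  - apply Rabs_le. lra.
Qed.

(** Six omitted values in each of [m] consecutive ranges of size bound [g' / g] throughout these
    ranges.  Then [ln |g|] varies along the circle by a bounded amount there, whereas the
    ranges have total logarithmic length [6 m ln H]; so [m] only has to be large. *)
Lemma omitted_values_on_circle (H : R) : 2 <= H -> exists m, (1 <= m)%nat /\
  forall (g : C -> C) (w : nat -> C) (a rho : R), 0 < a -> 0 < rho ->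
    (forall z, rho / 2 <= Cmod z <= 3 * rho / 2 -> hol g z /\ forall i, (i < 6 * m)%nat -> g z <> w i) ->
    (forall i, (i < 6 * m)%nat -> H ^ i * a <= Cmod (w i) <= H / 2 * (H ^ i * a)) ->
    forall z1 z2, Cmod z1 = rho -> Cmod z2 = rho -> Cmod (g z1) <= a -> Cmod (g z2) < H ^ (6 * m) * a.
Proof.
  intros HH. set (T := H ^ 6). assert (HT : 1 <= T) by (apply pow_R1_Rle; lra).
  destruct (Landau_bound T HT) as [A [HA Bd]]. pose proof PI_RGT_0.
  assert (Hm : exists m, (1 <= m)%nat /\ 48 * (2 * A * T) * PI + 2 * ln 2 < ln (T ^ m)).
  { destruct (Pow_x_infinity T) with (b := exp (48 * (2 * A * T) * PI + 2 * ln 2) + 1) as [N HN].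
    { rewrite Rabs_right by lra. unfold T. assert (2 ^ 6 <= H ^ 6) by (apply pow_incr; lra). lra. }
    exists (S N). split; [lia|]. specialize (HN (S N) ltac:(lia)).
    rewrite Rabs_right in HN by (apply Rle_ge, pow_le; lra).
    rewrite <- (ln_exp (48 * (2 * A * T) * PI + 2 * ln 2)). apply ln_increasing; [apply exp_pos|lra]. }
  destruct Hm as [m [Hm1 Hm]]. exists m. split; auto.
  intros g w a rho Ha Hrho Hg Hw z1 z2 Hz1 Hz2 H1. apply Rnot_le_lt. intros H2.
  assert (PH : forall i, 0 < H ^ i) by (intros; apply pow_lt; lra).
  rewrite pow_mult in H2. fold T in H2.
  assert (PTm : 1 <= T ^ m) by (apply pow_R1_Rle; auto).
  (* the omitted values of index [6 q] to [6 q + 5] have moduli between [T ^ q a] and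
     [T ^ (q + 1) a] *)
  assert (Grp : forall q z, (q < m)%nat -> Cmod z = rho -> Cmod (g z) <= T * (T ^ q * a) ->
     Cmod (dC g z) * (rho / 2) <= A * (T ^ q * a)).
  { intros q z Hq Hz Hgz.
    set (sig := T ^ q * a). assert (Psig : 0 < sig) by (apply Rmult_lt_0_compat; auto; apply pow_lt; lra).
    assert (Es : H ^ (6 * q) * a = sig) by (unfold sig, T; rewrite pow_mult; auto).
    set (i := (6 * q)%nat).
    apply (Bd g (map w (seq i 6)) z (rho / 2) sig); auto; try lra.
    - intros y Hy.
      destruct (Hg y) as [Y1 Y2].
      { pose proof (Cmod_le_add y z). pose proof (Cmod_le_add z y) as Y3. rewrite (Cmod_sub_sym z y) in Y3. lra. }
      split; auto. intros Hi. apply in_map_iff in Hi. destruct Hi as [j [Ej Hj]].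
      apply (Y2 j); auto. apply in_seq in Hj. unfold i in Hj. lia.
    - assert (Sp : forall j k, (i <= j)%nat -> (j < k)%nat -> (k < i + 6)%nat -> sig <= Cmod (w j - w k)).
      { intros j k Hij Hjk Hk. unfold i in *.
        destruct (Hw j ltac:(lia)) as [_ W1]. destruct (Hw k ltac:(lia)) as [W2 _].
        pose proof (Cmod_le_add (w k) (w j)) as W3. rewrite Cmod_sub_sym in W3.
        assert (M1 : H ^ S j <= H ^ k) by (apply Rle_pow; [lra|lia]).
        assert (M2 : H ^ (6 * q) <= H ^ j) by (apply Rle_pow; [lra|lia]).
        simpl in M1. rewrite <- Es.
        assert (M3 : H * H ^ j * a <= H ^ k * a) by (apply Rmult_le_compat_r; lra).
        assert (M4 : H ^ (6 * q) * a <= H ^ j * a) by (apply Rmult_le_compat_r; lra).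
        assert (M5 : 2 * (H ^ j * a) <= H * (H ^ j * a)).
        { apply Rmult_le_compat_r; auto. apply Rmult_le_pos; [left; apply PH|lra]. }
        lra. }
      apply separated_map_seq. exact Sp.
    - intros v Hv. apply in_map_iff in Hv. destruct Hv as [j [<- Hj]].
      assert (Hj' : (i <= j < i + 6)%nat) by (apply in_seq in Hj; lia). unfold i in Hj'.
      destruct (Hw j ltac:(lia)) as [_ W1]. eapply Rle_trans; [exact W1|].
      assert (M : H ^ S j <= H ^ (6 * q + 6)) by (apply Rle_pow; [lra|lia]).
      rewrite pow_add in M. fold T in M. change (H ^ S j) with (H * H ^ j) in M. rewrite <- Es.
      apply (Rmult_le_compat_r a) in M; [|lra].
      assert (0 <= H * (H ^ j * a)) by (apply Rmult_le_pos; [lra|apply Rmult_le_pos; [left; apply PH|lra]]).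
      lra. }
  assert (Fin : ln (a ^ 2 + (T ^ m * a) ^ 2) - ln (a ^ 2) <= 48 * (2 * A * T) * PI + 2 * ln 2).
  { apply (circle_modulus_variation g rho a (T ^ m * a) (2 * A * T) z1 z2); auto; try lra.
    - apply Rmult_le_pos; lra.
    - apply Rmult_le_pos; lra.
    - intros z Hz. split; [apply Hg; lra|]. intros Hgz.
      assert (Pg := Cmod_ge_0 (g z)).
      assert (Ex : exists q, (q < m)%nat /\ Cmod (g z) <= T * (T ^ q * a) /\ T ^ q * a <= T * (a + Cmod (g z))).
      { clear - Hm1 Hgz HT Ha Pg. induction m as [|m IH]; [lia|].
        destruct m as [|m].
        - exists O. simpl in *. split; [lia|]. split; nra.
        - destruct (Rle_dec (Cmod (g z)) (T ^ S m * a)) as [L|L].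
          + destruct (IH ltac:(lia) L) as [q [Q1 Q2]]. exists q. split; [lia|auto].
          + exists (S m). split; [lia|]. split; [simpl in *; lra|]. nra. }
      destruct Ex as [q [Q1 [Q2 Q3]]]. specialize (Grp q z Q1 Hz Q2).
      apply (Rmult_le_compat_l A) in Q3; lra. }
  assert (Low : ln (T ^ m) <= ln (a ^ 2 + (T ^ m * a) ^ 2) - ln (a ^ 2)).
  { assert (Pa : 0 < a ^ 2) by (apply pow_lt; auto).
    assert (Lg : ln (T ^ m * a ^ 2) <= ln (a ^ 2 + (T ^ m * a) ^ 2)).
    { apply Rcomplements.ln_le; [apply Rmult_lt_0_compat; lra|].
      rewrite Rpow_mult_distr. assert (T ^ m * 1 <= T ^ m * T ^ m) by (apply Rmult_le_compat_l; lra).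
      simpl in *. nra. }
    rewrite ln_mult in Lg by lra. lra. }
  lra.
Qed.

(** * Preimages in annuli *)

Lemma locally'_punctured (z : C) (P : C -> Prop) : @locally' C_UniformSpace z P ->
  exists del, 0 < del /\ forall w, 0 < Cmod (w - z) < del -> P w.
Proof.
  intros [d Hd]. exists d. split; [apply cond_pos|]. intros w [H1 H2]. apply Hd.
  - apply C_NormedModule_mixin_compat1. exact H2.
  - intros ->. rewrite Cmod_sub_self in H1. lra.
Qed.

Lemma list_bound (l : list C) : exists R, forall p, In p l -> Cmod p < R.
Proof.
  induction l as [|p l [R H]].
  - exists 0. intros p [].
  - exists (Rmax R (Cmod p + 1)). intros q [->|Hq].
    + pose proof (Rmax_r R (Cmod q + 1)). lra.
    + pose proof (Rmax_l R (Cmod p + 1)). specialize (H q Hq). lra.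
Qed.

Definition fin (f : C -> Chat) (z : C) : C := fin_part (f z).

(** Clearing the poles of [f] leaves an entire function [F] that is
    not a polynomial. *)
Lemma transcendental_data (f : C -> Chat) :
  transcendental_meromorphic f -> finitely_many_poles f ->
  exists (F : C -> C) (rs : list C) (R0 : R), (forall z, hol F z) /\
    (forall k a, ~ forall z, F z = Cpoly k a z) /\
    (forall z, R0 <= Cmod z -> f z = Fin (fin f z) /\ hol (fin f) z /\ F z = (root_prod rs z * fin f z)%C).
Proof.
  intros [Hm Hnr] [l Hl].
  assert (Fz : forall z, ~ In z l -> f z = Fin (fin f z)).
  { intros z N. unfold fin. destruct (f z) eqn:E; auto. exfalso. auto. }
  assert (Hh : forall z, ~ In z l -> hol (fin f) z).
  { intros z N. destruct (Hm z) as [_ H2]. rewrite (Fz z N) in H2.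
    apply complex_differentiable_hol. exact H2. }
  assert (Hp : forall p, In p l -> exists m h d, 0 < d /\ hol_disc h p d /\
     forall w, 0 < Cmod (w - p) < d -> (Cpow (w - p) m * fin f w)%C = h w).
  { intros p _. destruct (Hm p) as [H1 H2]. apply locally'_punctured in H1.
    destruct H1 as [d [Hd H1]].
    assert (Hoff : forall w, 0 < Cmod (w - p) < d -> hol (fin f) w).
    { intros w Hw. apply complex_differentiable_hol. apply H1. exact Hw. }
    destruct (f p) eqn:E.
    - exists O, (fin f), d. split; auto. split; [|intros; simpl; ring].
      intros w Hw. destruct (classic (w = p)) as [->|N].
      + apply complex_differentiable_hol. exact H2.
      + apply Hoff. split; auto. apply Cmod_sub_pos. auto.
    - apply (pole_order (fin f) p d Hd Hoff). intros M.
      assert (Q : Rbar_locally p_infty (fun x => M < x)) by (exists M; auto).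
      apply (locally'_punctured p (fun w => M < Cmod (fin f w))). exact (H2 _ Q). }
  destruct (clear_poles l (fin f) Hh Hp) as [rs [F [HF [_ HFE]]]].
  destruct (list_bound l) as [R0 HR0].
  exists F, rs, R0. split; auto. split.
  - (* the factors of [root_prod l] exclude all poles from the domain where [f = p / q] is required *)
    intros k a HE. apply Hnr.
    assert (Hrl : exists n b, forall z, (root_prod l z * F z)%C = Cpoly n b z).
    { clear - HE. induction l as [|p l [n [b IH]]].
      - exists k, a. intros z. simpl. rewrite HE. ring.
      - destruct (Cpoly_times_linear n b p) as [b' Hb']. exists (S n), b'. intros z. rewrite <- Hb', <- IH. simpl. ring. }
    destruct Hrl as [n [b Hb]]. destruct (root_prod_Cpoly (l ++ rs)) as [q Hq].
    assert (Eapp : forall z, root_prod (l ++ rs) z = (root_prod l z * root_prod rs z)%C).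
    { intros z. clear. induction l; simpl; [ring|]. rewrite IHl. ring. }
    exists n, (length (l ++ rs)), b, q. split.
    + destruct (root_prod_size (l ++ rs)) as [R1 [HR1 Hs]]. exists (RtoC R1).
      rewrite <- Hq. apply Cmod_gt_0. specialize (Hs (RtoC R1)). rewrite Cmod_R, Rabs_right in Hs by lra.
      destruct (Hs (Rle_refl _)) as [Hs' _]. eapply Rlt_le_trans; [|exact Hs']. apply pow_lt. lra.
    + intros z Hz. rewrite <- Hq in Hz. rewrite <- Hb, <- Hq.
      assert (Nl : ~ In z l).
      { intros Hi. apply Hz. rewrite Eapp.
        assert (Z : root_prod l z = RtoC 0).
        { clear - Hi. induction l; [contradiction|]. simpl. destruct Hi as [->|Hi]; [ring|]. rewrite IHl; auto. ring. }
        rewrite Z. ring. }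
      rewrite (Fz z Nl). f_equal. rewrite HFE, Eapp by auto. rewrite Eapp in Hz. field.
      split; intros Z; apply Hz; rewrite Z; ring.
  - intros z Hz. assert (Nl : ~ In z l) by (intros Hi; specialize (HR0 z Hi); lra).
    split; [auto|split; [auto|]]. apply HFE. auto.
Qed.

(** A form of [b' <= K M(b, g)] that yields a point of the circle. *)
Definition reaches (K : R) (g : C -> C) (b b' : R) : Prop :=
  exists z, Cmod z = b /\ b' <= K * Cmod (g z).

(** The factor [H / 2], rather than [H], separates the annuli of different index. *)
Definition in_annulus (H b : R) (i : nat) (z : C) : Prop :=
  H ^ i * b <= Cmod z <= H / 2 * (H ^ i * b).

(** A circle inside the annulus carries a small value of [g] by the hypothesis on the minimum
    modulus, and a value of modulus at least [H ^ k b'] because its radius is at least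
    [2 b]; so [omitted_values_on_circle] applies. *)
Lemma preimages_in_annuli (g F : C -> C) (rs : list C) (R0 r0 c d K : R) :
  (forall z, hol F z) -> (forall k a, ~ forall z, F z = Cpoly k a z) ->
  (forall z, R0 <= Cmod z -> hol g z /\ F z = (root_prod rs z * g z)%C) ->
  0 < c -> 1 < d -> 0 < K ->
  (forall r, r0 <= r -> exists rho z, r < rho < d * r /\ Cmod z = rho /\ Cmod (g z) <= c) ->
  exists k R1, (1 <= k)%nat /\ 1 <= R1 /\ R0 <= R1 /\
    (forall b' low, exists b, low <= b /\ reaches K g b b') /\
    (forall b i, R1 <= b -> exists z, in_annulus (6 * d) b i z /\ Cmod (g z) <= c) /\
    (forall b b' (w : nat -> C) i, R1 <= b -> R1 <= b' -> reaches K g b b' ->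
       (forall j, (j < k)%nat -> in_annulus (6 * d) b' j (w j)) ->
       exists z j, (j < k)%nat /\ in_annulus (6 * d) b i z /\ g z = w j).
Proof.
  intros HF Hnp HE Hc Hd HK Hmin. set (H := 6 * d). assert (HH : 6 < H) by (unfold H; lra).
  destruct (omitted_values_on_circle H ltac:(lra)) as [m [Hm Hom]]. set (k := (6 * m)%nat) in *.
  assert (PHk : 0 < H ^ k) by (apply pow_lt; lra).
  destruct (transcendental_growth g F rs R0 (K * H ^ k) HF Hnp (fun z Hz => proj2 (HE z Hz)))
    as [R1 [gam [HR1 [Hgam [HR01 [Hunb Hgrow]]]]]]; [apply Rmult_lt_0_compat; auto|].
  set (R2 := Rmax R1 (Rmax r0 c)).
  assert (B1 : R1 <= R2) by apply Rmax_l.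
  assert (B2 : r0 <= R2) by (eapply Rle_trans; [|apply Rmax_r]; apply Rmax_l).
  assert (B3 : c <= R2) by (eapply Rle_trans; [|apply Rmax_r]; apply Rmax_r).
  assert (HP : forall i b, R2 <= b -> b <= H ^ i * b).
  { intros i b Hb. assert (1 <= H ^ i) by (apply pow_R1_Rle; lra).
    assert (1 * b <= H ^ i * b) by (apply Rmult_le_compat_r; lra). lra. }
  exists k, R2. split; [unfold k; lia|]. split; [lra|]. split; [lra|]. split; [|split].
  - intros b' low. set (b := Rmax R1 (Rmax low (b' / (K * gam)))).
    assert (C1 : R1 <= b) by apply Rmax_l.
    assert (C2 : low <= b) by (eapply Rle_trans; [|apply Rmax_r]; apply Rmax_l).
    assert (C3 : b' / (K * gam) <= b) by (eapply Rle_trans; [|apply Rmax_r]; apply Rmax_r).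
    exists b. split; auto. destruct (Hunb b C1) as [w [Hw Hg]]. exists w. split; auto.
    assert (PKg : 0 < K * gam) by (apply Rmult_lt_0_compat; auto).
    apply (Rmult_le_compat_r (K * gam)) in C3; [|lra].
    replace (b' / (K * gam) * (K * gam)) with b' in C3 by (field; split; lra).
    apply (Rmult_le_compat_l K) in Hg; lra.
  - intros b i Hb. specialize (HP i b Hb).
    destruct (Hmin (2 * (H ^ i * b))) as [rho [z [Hrho [Hz Hg]]]]; [lra|].
    assert (Hup : d * (2 * (H ^ i * b)) * (3 / 2) = H / 2 * (H ^ i * b)) by (unfold H at 2; field).
    exists z. split; auto. split; lra.
  - intros b b' w i Hb Hb' [z0 [Hz0 Hr]] Hw. pose proof (HP i b Hb) as HPb.
    destruct (Hmin (2 * (H ^ i * b))) as [rho [z1 [Hrho [Hz1 Hg1]]]]; [lra|].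
    destruct (Hgrow z0 rho ltac:(lra) ltac:(lra)) as [z2 [Hz2 Hg2]].
    apply NNPP. intros HN.
    assert (Hup : d * (2 * (H ^ i * b)) * (3 / 2) = H / 2 * (H ^ i * b)) by (unfold H at 2; field).
    assert (Lt : Cmod (g z2) < H ^ k * b').
    { apply (Hom g w b' rho) with (z1 := z1); auto; try lra.
      intros z Hz. split; [apply HE; lra|]. intros j Hj E. apply HN. exists z, j.
      split; auto. split; auto. split; lra. }
    apply (Rmult_le_compat_l (H ^ k)) in Hr; lra.
Qed.

(** * Backward orbits *)

Definition orbit (g : C -> C) (n : nat) (z : C) : C := Nat.iter n g z.

Lemma orbit_comm (g : C -> C) (n : nat) (z : C) : orbit g (S n) z = orbit g n (g z).
Proof. unfold orbit. apply Nat.iter_succ_r. Qed.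

(** The induction carries [k] points in disjoint annuli, because
    [g] may omit some of them as values, but never all. *)
Lemma escaping_then_returning (g : C -> C) (H K R1 c : R) (k : nat) (b : nat -> R) :
  (1 <= k)%nat -> 2 <= H -> 1 <= R1 -> (forall n, R1 <= b n) ->
  (forall n, reaches K g (b n) (b (S n))) ->
  (forall b i, R1 <= b -> exists z, in_annulus H b i z /\ Cmod (g z) <= c) ->
  (forall b b' (w : nat -> C) i, R1 <= b -> R1 <= b' -> reaches K g b b' ->
       (forall j, (j < k)%nat -> in_annulus H b' j (w j)) ->
       exists z j, (j < k)%nat /\ in_annulus H b i z /\ g z = w j) ->
  forall len, exists y, (forall j, (j <= len)%nat -> b j <= Cmod (orbit g j y) <= H ^ k * b j) /\
     Cmod (orbit g (S len) y) <= c.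
Proof.
  intros Hk HH HR Hb Hreach Hret Hpre.
  assert (Range : forall n i z, (i < k)%nat -> in_annulus H (b n) i z -> b n <= Cmod z <= H ^ k * b n).
  { intros n i z Hi [A1 A2]. specialize (Hb n).
    assert (P1 : 1 <= H ^ i) by (apply pow_R1_Rle; lra).
    assert (P2 : H ^ S i <= H ^ k) by (apply Rle_pow; [lra|lia]). change (H ^ S i) with (H * H ^ i) in P2.
    apply (Rmult_le_compat_r (b n)) in P1; [|lra]. apply (Rmult_le_compat_r (b n)) in P2; [|lra].
    assert (0 <= H * (H ^ i * b n)) by (apply Rmult_le_pos; lra). lra. }
  assert (Main : forall len n, exists w : nat -> C, forall i, (i < k)%nat -> in_annulus H (b n) i (w i) /\
     (forall j, (j <= len)%nat -> b (n + j)%nat <= Cmod (orbit g j (w i)) <= H ^ k * b (n + j)%nat) /\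
     Cmod (orbit g (S len) (w i)) <= c).
  { induction len as [|len IH]; intros n.
    - set (Q := fun i z => in_annulus H (b n) i z /\ Cmod (g z) <= c).
      exists (fun i => epsilon (inhabits (RtoC 0)) (Q i)). intros i Hi.
      assert (Sp : Q i (epsilon (inhabits (RtoC 0)) (Q i))) by (apply epsilon_spec, Hret, Hb).
      destruct Sp as [S1 S2]. split; auto. split; auto.
      intros j Hj. assert (j = O) by lia. subst j. rewrite Nat.add_0_r. apply (Range n i); auto.
    - destruct (IH (S n)) as [w Hw].
      set (Q := fun i z => exists j, (j < k)%nat /\ in_annulus H (b n) i z /\ g z = w j).
      exists (fun i => epsilon (inhabits (RtoC 0)) (Q i)). intros i Hi.
      assert (Sp : Q i (epsilon (inhabits (RtoC 0)) (Q i))).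
      { apply epsilon_spec. apply (Hpre (b n) (b (S n)) w i); auto. intros j Hj. apply Hw. auto. }
      destruct Sp as [j [Hj [S1 S2]]]. destruct (Hw j Hj) as [_ [W1 W2]]. split; auto. split.
      + intros [|q] Hq.
        * rewrite Nat.add_0_r. apply (Range n i); auto.
        * rewrite orbit_comm, S2, Nat.add_succ_r. apply (W1 q). lia.
      + rewrite orbit_comm, S2. exact W2. }
  intros len. destruct (Main len O) as [w Hw]. destruct (Hw O ltac:(lia)) as [_ [W1 W2]].
  exists (w O). auto.
Qed.

Lemma le_of_approx (x y : R) : (forall e, 0 < e -> x <= y + e) -> x <= y.
Proof. intros H. apply Rnot_lt_le. intros L. specialize (H ((x - y) / 2) ltac:(lra)). lra. Qed.

(** * Non-normality *)

Definition height (v : Chat) : R := chordal v Inf.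

Lemma sqrt_1_sqr_bounds (z : C) : 1 <= sqrt (1 + Cmod z ^ 2) /\ Cmod z <= sqrt (1 + Cmod z ^ 2) <= 1 + Cmod z.
Proof.
  pose proof (Cmod_ge_0 z). split; [|split].
  - rewrite <- sqrt_1 at 1. apply sqrt_le_1_alt. nra.
  - rewrite <- (sqrt_pow2 (Cmod z)) at 1 by auto. apply sqrt_le_1_alt. lra.
  - rewrite <- (sqrt_pow2 (1 + Cmod z)) by lra. apply sqrt_le_1_alt. nra.
Qed.

(** [sqrt (1 + x ^ 2)] is a 1-Lipschitz function of [x]. *)
Lemma height_lipschitz (u v : Chat) : height u <= height v + chordal u v.
Proof.
  unfold height. destruct u as [z|], v as [w|]; simpl; try lra.
  - destruct (sqrt_1_sqr_bounds z) as [P1 _]. destruct (sqrt_1_sqr_bounds w) as [P2 _].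
    simpl in *. set (p := sqrt (1 + Cmod z * (Cmod z * 1))) in *. set (q := sqrt (1 + Cmod w * (Cmod w * 1))) in *.
    assert (Ep : p * p = 1 + Cmod z ^ 2) by (unfold p; rewrite sqrt_sqrt; [ring|pose proof (Cmod_ge_0 z); nra]).
    assert (Eq : q * q = 1 + Cmod w ^ 2) by (unfold q; rewrite sqrt_sqrt; [ring|pose proof (Cmod_ge_0 w); nra]).
    pose proof (Cmod_ge_0 z). pose proof (Cmod_ge_0 w). pose proof (Cmod_ge_0 (z - w)%C).
    assert (T : Cmod w - Cmod z <= Cmod (z - w)).
    { pose proof (Cmod_le_add w z). rewrite (Cmod_sub_sym w z) in H2. lra. }
    assert (Lz : Cmod z <= p) by nra. assert (Lw : Cmod w <= q) by nra.
    assert (D : q - p <= Cmod (z - w)).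
    { apply Rnot_lt_le. intros Hl. assert ((q - p) * (q + p) = (Cmod w - Cmod z) * (Cmod w + Cmod z)) by (ring_simplify; lra).
      destruct (Rle_dec (Cmod w) (Cmod z)).
      - assert (0 < (q - p) * (q + p)) by (apply Rmult_lt_0_compat; lra). nra.
      - assert ((Cmod w - Cmod z) * (Cmod w + Cmod z) <= Cmod (z - w) * (q + p)) by (apply Rmult_le_compat; lra). nra. }
    apply (Rmult_le_reg_r (p * q)); [nra|].
    replace (2 / p * (p * q)) with (2 * q) by (field; lra).
    replace ((2 / q + 2 * Cmod (z - w) / (p * q)) * (p * q)) with (2 * p + 2 * Cmod (z - w)) by (field; lra).
    lra.
  - match goal with |- 0 <= ?a + ?a => assert (0 <= a) end; [|lra].
    destruct (sqrt_1_sqr_bounds w) as [P2 _]. apply Rmult_le_pos; [lra|]. left. apply Rinv_0_lt_compat. simpl in *. lra.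
Qed.

Lemma chordal_sym (u v : Chat) : chordal u v = chordal v u.
Proof.
  destruct u as [z|], v as [w|]; unfold chordal; auto.
  rewrite (Cmod_sub_sym z w), (Rmult_comm (sqrt (1 + Cmod z ^ 2))). reflexivity.
Qed.

Lemma height_ge (z : C) (c : R) : Cmod z <= c -> 2 / (1 + c) <= height (Fin z).
Proof.
  intros Hz. unfold height; simpl. destruct (sqrt_1_sqr_bounds z) as [P1 [P2 P3]].
  simpl in *. pose proof (Cmod_ge_0 z).
  apply Rmult_le_compat_l; [lra|]. apply Rinv_le_contravar; lra.
Qed.

Lemma height_le (z : C) (X : R) : 0 < X -> X <= Cmod z -> height (Fin z) <= 2 / X.
Proof.
  intros HX Hz. unfold height; simpl. destruct (sqrt_1_sqr_bounds z) as [P1 [P2 P3]].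
  simpl in *. apply Rmult_le_compat_l; [lra|]. apply Rinv_le_contravar; lra.
Qed.

Lemma iterate_orbit (f : C -> Chat) (R0 : R) (z : C) (n : nat) :
  (forall w, R0 <= Cmod w -> f w = Fin (fin f w)) ->
  (forall j, (j < n)%nat -> R0 <= Cmod (orbit (fin f) j z)) ->
  iterate f n z = Some (Fin (orbit (fin f) n z)).
Proof.
  intros Hf. induction n as [|n IH]; intros Hz; auto.
  simpl. rewrite IH by (intros; apply Hz; lia). rewrite Hf by (apply Hz; lia). reflexivity.
Qed.

Lemma orbit_ccont (g : C -> C) (z : C) (n : nat) :
  (forall j, (j < n)%nat -> ccont g (orbit g j z)) -> ccont (orbit g n) z.
Proof.
  induction n as [|n IH]; intros H.
  - apply ccont_id.
  - apply (ccont_comp g (orbit g n)); [apply IH; intros; apply H; lia|apply H; lia].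
Qed.

(** A locally uniform limit of iterates with orders tending to infinity is infinite at [q]; by
    uniform convergence the late iterates are then large on a fixed disc around [q], but this
    disc contains points where some of them have modulus at most [c]. *)
Lemma Julia_criterion (f : C -> Chat) (q : C) (R0 c : R) :
  (forall w, R0 <= Cmod w -> f w = Fin (fin f w) /\ hol (fin f) w) ->
  (forall j, R0 + 1 <= Cmod (orbit (fin f) j q)) ->
  (forall M, exists N, forall n, (N <= n)%nat -> M <= Cmod (orbit (fin f) n q)) ->
  0 < c ->
  (forall del N, 0 < del -> exists n y, (N <= n)%nat /\ Cmod (y - q) < del /\
     (forall j, (j <= n)%nat -> R0 <= Cmod (orbit (fin f) j y)) /\ Cmod (orbit (fin f) (S n) y) <= c) ->
  Julia f q.
Proof.
  intros Hf Hq Hesc Hc Hret [r [Hr [Hdef Hnorm]]]. set (g := fin f) in *.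
  set (Q := fun k (p : nat * C) => (k <= fst p)%nat /\ Cmod (snd p - q) < / (INR k + 1) /\
     (forall j, (j <= fst p)%nat -> R0 <= Cmod (orbit g j (snd p))) /\ Cmod (orbit g (S (fst p)) (snd p)) <= c).
  assert (HQ : forall k, exists p, Q k p).
  { intros k. destruct (Hret (/ (INR k + 1)) k) as [n [y Hn]].
    - apply Rinv_0_lt_compat. pose proof (pos_INR k). lra.
    - exists (n, y). exact Hn. }
  set (s := fun k => epsilon (inhabits (O, RtoC 0)) (Q k)).
  assert (Hs : forall k, Q k (s k)) by (intros k; apply epsilon_spec, HQ).
  set (u := fun k w => match iterate f (S (fst (s k))) w with Some v => v | None => Inf end).
  destruct (Hnorm u) as [phi [h [Hphi Hcv]]].
  { intros k. exists (S (fst (s k))). split; [lia|]. intros w Hw. unfold u.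
    destruct (iterate f (S (fst (s k))) w) eqn:E; auto. exfalso. apply (Hdef (S (fst (s k))) w); auto. lia. }
  assert (Hphik : forall k, (k <= phi k)%nat).
  { induction k; [lia|]. specialize (Hphi k (S k) ltac:(lia)). lia. }
  assert (Dq : Defs.disc q r q) by (unfold Defs.disc; rewrite Cmod_sub_self; auto).
  destruct (Hcv q Dq) as [r' [Hr' Hu]].
  set (eta := 2 / (1 + c)). assert (Peta : 0 < eta) by (apply Rdiv_lt_0_compat; lra).
  destruct (Hu (eta / 8) ltac:(lra)) as [N0 HN0].
  (* a modulus of at least [16 / eta] means a height of at most [eta / 8] *)
  set (X := 16 / eta). assert (PX : 0 < X) by (apply Rdiv_lt_0_compat; lra).
  destruct (Hesc (X + 1)) as [N1 HN1]. set (j := (N0 + N1)%nat).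
  set (n := S (fst (s (phi j)))).
  assert (Cg : forall i, ccont (orbit g i) q).
  { intros i. apply orbit_ccont. intros i' _. apply hol_ccont, Hf. specialize (Hq i'). lra. }
  assert (Near : forall i, exists del, 0 < del /\ forall w, Cmod (w - q) < del ->
     forall i', (i' <= i)%nat -> Cmod (orbit g i' q) - 1 <= Cmod (orbit g i' w)).
  { intros i. induction i as [|i [d1 [Hd1 H1]]].
    - exists 1. split; [lra|]. intros w Hw i' Hi'. assert (i' = O) by lia. subst i'. simpl.
      pose proof (Cmod_le_add q w). rewrite (Cmod_sub_sym q w) in H. lra.
    - destruct (Cg (S i) 1 ltac:(lra)) as [d2 [Hd2 H2]]. exists (Rmin d1 d2). split; [apply Rmin_pos; auto|].
      intros w Hw i' Hi'. pose proof (Rmin_l d1 d2). pose proof (Rmin_r d1 d2).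
      destruct (Nat.eq_dec i' (S i)) as [->|Ne]; [|apply H1; [lra|lia]].
      specialize (H2 w ltac:(lra)). pose proof (Cmod_le_add (orbit g (S i) q) (orbit g (S i) w)) as T.
      rewrite (Cmod_sub_sym (orbit g (S i) q)) in T. lra. }
  destruct (Near n) as [del [Hdel Hd]].
  assert (Hn : (N1 <= n)%nat).
  { unfold n. destruct (Hs (phi j)) as [L _]. specialize (Hphik j). unfold j in *. lia. }
  set (e := Rmin (Rmin del r') r). assert (He : 0 < e) by (repeat apply Rmin_pos; auto).
  assert (E1 : e <= del) by (eapply Rle_trans; [apply Rmin_l|apply Rmin_l]).
  assert (E2 : e <= r') by (eapply Rle_trans; [apply Rmin_l|apply Rmin_r]).
  assert (E3 : e <= r) by apply Rmin_r.
  assert (Hlim : forall w, Cmod (w - q) < e -> height (h w) < eta / 4).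
  { intros w Hw. specialize (Hd w ltac:(lra)).
    assert (It : iterate f n w = Some (Fin (orbit g n w))).
    { apply (iterate_orbit f R0); [intros v Hv; apply Hf; auto|]. intros i Hi.
      specialize (Hd i ltac:(lia)). specialize (Hq i). fold g. lra. }
    assert (Uw : u (phi j) w = Fin (orbit g n w)) by (unfold u; fold n; rewrite It; auto).
    assert (Hbig : X <= Cmod (orbit g n w)).
    { specialize (Hd n (le_n n)). specialize (HN1 n Hn). lra. }
    pose proof (height_le _ X PX Hbig) as Hh. rewrite <- Uw in Hh.
    assert (EX : 2 / X = eta / 8) by (unfold X; field; lra).
    specialize (HN0 j ltac:(unfold j; lia) w ltac:(unfold Defs.disc; lra) ltac:(unfold Defs.disc; lra)).
    pose proof (height_lipschitz (h w) (u (phi j) w)) as HL. rewrite chordal_sym in HL. lra. }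
  (* a later member takes a bounded value at a point close to [q] *)
  destruct (archimed_cor1 e He) as [N2 [HN2 HN2']].
  set (m := (N0 + N2)%nat).
  destruct (Hs (phi m)) as [S1 [S2 [S3 S4]]]. set (y := snd (s (phi m))) in *. set (p := fst (s (phi m))) in *.
  assert (Hy : Cmod (y - q) < e).
  { eapply Rlt_trans; [exact S2|]. eapply Rle_lt_trans; [|exact HN2].
    apply Rinv_le_contravar; [apply lt_0_INR; lia|].
    assert (INR N2 <= INR (phi m)) by (apply le_INR; specialize (Hphik m); unfold m in *; lia). lra. }
  assert (It : iterate f (S p) y = Some (Fin (orbit g (S p) y))).
  { apply (iterate_orbit f R0); [intros v Hv; apply Hf; auto|]. intros i Hi. apply S3. lia. }
  assert (Uy : u (phi m) y = Fin (orbit g (S p) y)) by (unfold u; fold p; rewrite It; auto).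
  specialize (HN0 m ltac:(unfold m; lia) y ltac:(unfold Defs.disc; lra) ltac:(unfold Defs.disc; lra)).
  pose proof (height_lipschitz (u (phi m) y) (h y)) as HL. specialize (Hlim y Hy).
  pose proof (height_ge _ c S4) as Hge. rewrite <- Uy in Hge. fold eta in Hge. lra.
Qed.

(** * Moduli and sequences *)

Lemma min_modulus_le (f : C -> Chat) (rho c : R) :
  Rbar_le (min_modulus rho f) (Finite c) ->
  exists z w, Cmod z = rho /\ f z = Fin w /\ Cmod w <= c + 1.
Proof.
  intros Hle. apply NNPP. intros HN.
  assert (L : Rbar_le (Finite (c + 1)) (min_modulus rho f)).
  { unfold min_modulus, Rbar_glb. destruct (Rbar_ex_glb _) as [m [Hb0 Hm]]; unfold proj1_sig.
    apply (Hm (Finite (c + 1))). intros x [z [Hz ->]]. destruct (f z) as [w|] eqn:E; simpl; auto.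
    apply Rnot_lt_le. intros Hlt. apply HN. exists z, w. split; auto. split; auto. lra. }
  assert (Hf := Rbar_le_trans _ _ _ L Hle). simpl in Hf. lra.
Qed.

(** The factor [2] gives room below the supremum, so that a point of the circle exceeds it. *)
Lemma le_max_modulus_reaches (f : C -> Chat) (R0 K b b' : R) :
  (forall w, R0 <= Cmod w -> f w = Fin (fin f w)) -> R0 <= b -> 0 < b' -> 0 < K ->
  Rbar_le (Finite b') (Rbar_mult (Finite K) (max_modulus b f)) -> reaches (2 * K) (fin f) b b'.
Proof.
  intros Hf Hb Hb' HK Hle. apply NNPP. intros HN.
  assert (L : Rbar_le (max_modulus b f) (Finite (b' / (2 * K)))).
  { unfold max_modulus, Rbar_lub. destruct (Rbar_ex_lub _) as [m [Hb0 Hm]]; unfold proj1_sig.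
    apply (Hm (Finite (b' / (2 * K)))). intros x [z [Hz ->]]. rewrite Hf by lra. simpl.
    apply Rnot_lt_le. intros Hlt. apply HN. exists z. split; auto.
    apply (Rmult_lt_compat_r (2 * K)) in Hlt; [|lra].
    replace (b' / (2 * K) * (2 * K)) with b' in Hlt by (field; lra). lra. }
  destruct (max_modulus b f) as [m| |]; simpl in L; auto.
  - simpl in Hle. apply (Rmult_le_compat_l K) in L; [|lra].
    replace (K * (b' / (2 * K))) with (b' / 2) in L by (field; lra). lra.
  - simpl in Hle. unfold Rbar_mult in Hle. simpl in Hle.
    destruct (Rle_dec 0 K) as [P|P]; [|lra]. destruct (Rle_lt_or_eq_dec 0 K P); simpl in Hle; auto. lra.
Qed.

(** Only finitely many terms have to be enlarged, and the last of
    them first: each new term is chosen so that the next one is reached. *)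
Lemma enlarge_initial_terms (Q : R -> R -> Prop) (R1 : R) :
  (forall b' low, exists b, low <= b /\ Q b b') ->
  forall (N : nat) (a : nat -> R), (forall n, (N <= n)%nat -> R1 <= a n /\ Q (a n) (a (S n))) ->
  exists b : nat -> R, (forall n, (N <= n)%nat -> b n = a n) /\
    forall n, a n <= b n /\ R1 <= b n /\ Q (b n) (b (S n)).
Proof.
  intros HQ. induction N as [|N IH]; intros a Ha.
  - exists a. split; auto. intros n. destruct (Ha n ltac:(lia)). split; [lra|auto].
  - destruct (HQ (a (S N)) (Rmax (a N) R1)) as [v [Hv1 Hv2]].
    set (a' := fun n => if Nat.eq_dec n N then v else a n).
    assert (E : forall n, n <> N -> a' n = a n) by (intros n Hn; unfold a'; destruct Nat.eq_dec; congruence).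
    assert (EN : a' N = v) by (unfold a'; destruct Nat.eq_dec; congruence).
    destruct (IH a') as [b [Hb1 Hb2]].
    + intros n Hn. rewrite (E (S n)) by lia. destruct (Nat.eq_dec n N) as [->|Ne].
      * rewrite EN. split; auto. pose proof (Rmax_r (a N) R1). lra.
      * rewrite E by auto. apply Ha. lia.
    + exists b. split.
      * intros n Hn. rewrite Hb1 by lia. apply E. lia.
      * intros n. destruct (Hb2 n) as [P1 P2]. split; auto.
        destruct (Nat.eq_dec n N) as [->|Ne].
        -- rewrite EN in P1. pose proof (Rmax_l (a N) R1). lra.
        -- rewrite E in P1; auto.
Qed.

Lemma bounded_ratio (a b : nat -> R) (N : nat) : (forall n, (1 <= n)%nat -> 0 < a n) ->
  exists A, 1 <= A /\ forall n, (1 <= n < N)%nat -> b n <= A * a n.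
Proof.
  intros Ha. induction N as [|N [A [HA IH]]].
  - exists 1. split; [lra|]. intros; lia.
  - destruct (Nat.eq_dec N 0) as [->|NZ]; [exists 1; split; [lra|intros; lia]|].
    exists (Rmax A (b N / a N)). split; [pose proof (Rmax_l A (b N / a N)); lra|].
    intros n Hn. pose proof (Ha n ltac:(lia)) as Pn. destruct (Nat.eq_dec n N) as [->|Ne].
    + pose proof (Rmax_r A (b N / a N)) as M. apply (Rmult_le_compat_r (a N)) in M; [|lra].
      replace (b N / a N * a N) with (b N) in M by (field; lra). exact M.
    + specialize (IH n ltac:(lia)). pose proof (Rmax_l A (b N / a N)). nra.
Qed.

Theorem theorem2 (f : C -> Chat) (c d r0 : R) (a : nat -> R)
  (f_trans : transcendental_meromorphic f)
  (f_poles : finitely_many_poles f)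
  (c_pos : 0 < c) (d_pos : 0 < d) (r0_pos : 0 < r0) (d_gt1 : 1 < d)
  (f_min : forall r : R, r0 <= r ->
     exists rho : R, r < rho < d * r /\ Rbar_le (min_modulus rho f) (Finite c))
  (a_pos : forall n : nat, (1 <= n)%nat -> 0 < a n)
  (a_infty : is_lim_seq a p_infty)
  (a_bigO : exists (K : R) (N : nat), 0 < K /\
     forall n : nat, (N <= n)%nat ->
       Rbar_le (Finite (a (S n)))
               (Rbar_mult (Finite K) (max_modulus (a n) f))) :
  exists (zeta : C) (A : R),
    Julia f zeta /\ 1 < A /\
    forall n : nat, (1 <= n)%nat ->
      exists w : C, iterate f n zeta = Some (Fin w) /\
        a n <= Cmod w <= A * a n.

Proof.
  destruct (transcendental_data f f_trans f_poles) as [F [rs [R0 [HF [Hnp Hdata]]]]].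
  set (g := fin f) in *.
  destruct a_bigO as [K [N [HK Hbig]]].
  assert (Hmin : forall r, Rmax r0 R0 <= r ->
    exists rho z, r < rho < d * r /\ Cmod z = rho /\ Cmod (g z) <= c + 1).
  { intros r Hr. pose proof (Rmax_l r0 R0). pose proof (Rmax_r r0 R0).
    destruct (f_min r ltac:(lra)) as [rho [Hrho Hm]].
    destruct (min_modulus_le f rho c Hm) as [z [w [Hz [Hw Hc]]]].
    exists rho, z. split; auto. split; auto. unfold g, fin. rewrite Hw. exact Hc. }
  destruct (preimages_in_annuli g F rs R0 (Rmax r0 R0) (c + 1) d (2 * K) HF Hnp
    (fun z Hz => proj2 (Hdata z Hz)) ltac:(lra) d_gt1 ltac:(lra) Hmin)
    as [k [R1 [Hk [HR1 [HR01 [Hunb [Hret Hpre]]]]]]].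
  (* the margin 1 keeps neighbourhoods of the orbit points in the region where [f] is finite *)
  set (R2 := Rmax (R1 + 1) 1). assert (L1 : R1 + 1 <= R2) by apply Rmax_l.
  assert (Hlarge : forall M, exists n0, forall n, (n0 <= n)%nat -> M <= a n).
  { intros M. destruct (a_infty (fun x => M < x)) as [n0 Hn0]; [exists M; auto|].
    exists n0. intros n Hn. left. apply Hn0. exact Hn. }
  destruct (Hlarge R2) as [n0 Hn0]. set (N1 := (N + n0 + 1)%nat).
  destruct (enlarge_initial_terms (reaches (2 * K) g) R2 Hunb N1 a) as [b [Hba Hb]].
  { intros n Hn. unfold N1 in Hn. split; [apply Hn0; lia|].
    apply (le_max_modulus_reaches f R0); auto.
    - intros w Hw. apply Hdata. exact Hw.
    - specialize (Hn0 n ltac:(lia)). lra.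
    - apply a_pos. lia.
    - apply Hbig. lia. }
  set (B := (6 * d) ^ k).
  destruct (bounded_ratio a b N1 a_pos) as [A [HA HAb]].
  assert (Hba' : forall n, (1 <= n)%nat -> b n <= A * a n).
  { intros n Hn. destruct (Nat.lt_ge_cases n N1) as [L|L]; [apply HAb; lia|].
    rewrite Hba by auto. specialize (a_pos n Hn). nra. }
  assert (PB : 1 <= B) by (apply pow_R1_Rle; lra).
  assert (Horb : forall len, exists y,
    (forall j, (j <= len)%nat -> b j <= Cmod (orbit g j y) <= B * b j) /\
    Cmod (orbit g (S len) y) <= c + 1).
  { apply (escaping_then_returning g (6 * d) (2 * K) R1 (c + 1) k b); auto; try lra.
    - intros n. destruct (Hb n) as [_ [L _]]. lra.
    - intros n. apply Hb. }
  set (P := fun len y => (forall j, (j <= len)%nat -> b j <= Cmod (orbit g j y) <= B * b j) /\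
    Cmod (orbit g (S len) y) <= c + 1).
  set (y := fun len => epsilon (inhabits (RtoC 0)) (P len)).
  assert (Hy : forall len, P len (y len)) by (intros len; apply epsilon_spec, Horb).
  destruct (bounded_cluster_point y (B * b O)) as [q Hq].
  { intros n. destruct (Hy n) as [H1 _]. apply (H1 O). lia. }
  assert (Hlow : forall n, R2 <= b n) by (intros n; apply Hb).
  assert (Hqorb : forall j, ccont (orbit g j) q /\ b j <= Cmod (orbit g j q) <= B * b j).
  { assert (Step : forall j, ccont (orbit g j) q -> b j <= Cmod (orbit g j q) <= B * b j).
    { intros j Hc. split; apply le_of_approx; intros e He;
        destruct (Hc e He) as [del [Hdel Hd]];
        destruct (Hq del j Hdel) as [n [Hn Hyn]];
        specialize (Hd _ Hyn); destruct (Hy n) as [H1 _]; specialize (H1 j Hn).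
      - pose proof (Cmod_le_add (orbit g j (y n)) (orbit g j q)). lra.
      - pose proof (Cmod_le_add (orbit g j q) (orbit g j (y n))) as T.
        rewrite (Cmod_sub_sym (orbit g j q)) in T. lra. }
    induction j as [|j [IH1 IH2]].
    - assert (C0 : ccont (orbit g 0) q) by apply ccont_id. split; auto.
    - assert (C1 : ccont (orbit g (S j)) q).
      { apply (ccont_comp g (orbit g j)); auto. apply hol_ccont, Hdata. specialize (Hlow j). lra. }
      split; auto. }
  exists q, (1 + B * A). split; [|split].
  - apply (Julia_criterion f q R0 (c + 1)); fold g.
    + intros w Hw. destruct (Hdata w Hw) as [E1 [E2 _]]. auto.
    + intros j. destruct (Hqorb j) as [_ H]. specialize (Hlow j). lra.
    + intros M. destruct (Hlarge M) as [n1 Hn1]. exists n1. intros n Hn.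
      destruct (Hqorb n) as [_ H]. destruct (Hb n) as [H' _]. specialize (Hn1 n Hn). lra.
    + lra.
    + intros del n' Hdel. destruct (Hq del n' Hdel) as [n [Hn Hyn]].
      exists n, (y n). destruct (Hy n) as [H1 H2]. split; auto. split; auto. split; auto.
      intros j Hj. specialize (H1 j Hj). specialize (Hlow j). lra.
  - assert (1 * 1 <= B * A) by (apply Rmult_le_compat; lra). lra.
  - intros n Hn. exists (orbit g n q). split.
    + apply (iterate_orbit f R0).
      * intros w Hw. apply Hdata. exact Hw.
      * intros j _. destruct (Hqorb j) as [_ H]. specialize (Hlow j). fold g. lra.
    + destruct (Hqorb n) as [_ [H1 H2]]. destruct (Hb n) as [H3 _]. split; [lra|].
      specialize (Hba' n Hn). specialize (a_pos n Hn).
      assert (B * b n <= B * (A * a n)) by (apply Rmult_le_compat_l; lra). lra.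
Qed.
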